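(* Let $\overline D=(D,g)$ be a metrised $\mathbb R$-divisor on $X$. Assume that $\deg(D)>0$ and that $g$ is plurisubharmonic. Then $$\lim_{n\rightarrow+\infty}\frac{-\ln\|s_1\wedge\cdots\wedge s_{r_n}\|_{ng,\det}}{n^2/2}=(\overline D\cdot\overline D),$$ where $r_n=\dim_k H^0(nD)$, $(s_i)_{i=1}^{r_n}$ is a basis of $H^0(nD)$ over $k$, and $\|\cdot\|_{ng,\det}$ is the determinant norm on $\det(H^0(nD))=\Lambda^{r_n}(H^0(nD))$ associated with the norm $\|\cdot\|_{ng}$ on $H^0(nD)$.
   Context: Let $k$ be a field equipped with the trivial absolute value and $X$ a regular irreducible projective curve over $\operatorname{Spec} k$. $X^{(1)}$ is the set of closed points, $k(x)$ the residue field of $x$, $\operatorname{Rat}(X)$ the field of rational functions. Berkovich space. $X^{\mathrm{an}}$ is identified with the following tree: the quotient of $\coprod_{x\in X^{(1)}}[0,+\infty]$ obtained by gluing all points $0$ into one root point $\eta_0$. For $x\in X^{(1)}$, $\xi_x:[0,+\infty]\to X^{\mathrm{an}}$ is the map on the copy indexed by $x$, $x_0:=\xi_x(+\infty)$, $[\eta_0,x_0]:=\xi_x([0,+\infty])$ (similarly for half-open and open intervals), and $t(\xi)\in[0,+\infty]$ is the unique number with $\xi_x(t(\xi))=\xi$ for $\xi\in[\eta_0,x_0]$. A subset $U$ is open iff each $\xi_x^{-1}(U)$ is open in $[0,+\infty]$ and, if $\eta_0\in U$, $U\supseteq[\eta_0,x_0]$ for all but finitely many $x$. Divisors. An $\mathbb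 R$-divisor is a finite formal sum $D=\sum_x\operatorname{ord}_x(D)\,x$ with real coefficients; $\deg(D)=\sum_x[k(x):k]\operatorname{ord}_x(D)$; $D$ is effective ($D\geqslant0$) if all $\operatorname{ord}_x(D)\geqslant0$. $\operatorname{Rat}(X)^\times_{\mathbb R}:=\operatorname{Rat}(X)^\times\otimes_{\mathbb Z}\mathbb R$, and $s\mapsto(s)=\sum_x\operatorname{ord}_x(s)x$ is the $\mathbb R$-linear extension of the principal divisor map. $\Gamma(D)^\times_{\mathbb R}:=\{s\in\operatorname{Rat}(X)^\times_{\mathbb R}:(s)+D\geqslant0\}$ and $H^0(D):=\{f\in\operatorname{Rat}(X)^\times:(f)+D\geqslant0\}\cup\{0\}$, a finite-dimensional $k$-vector space. Green functions. A Green function of $D$ is a continuous map $g:X^{\mathrm{an}}\to[-\infty,+\infty]$ for which there is a continuous $\varphi_g:X^{\mathrm{an}}\to\mathbb R$ with $\varphi_g(\xi)=g(\xi)-\operatorname{ord}_x(D)t(\xi)$ for all $x$ and all $\xi\in[\eta_0,x_0[$. A metrised $\mathbb R$-divisor is a pair $(D,g)$ with $g$ a Green function of $D$. The sum of two Green functions is the Green function equal to the pointwise sum away from the leaves $x_0$. $g_D$ denotes the canonical Green function $\xi\in[\eta_0,x_0]\mapsto\operatorname{ord}_x(D)t(\xi)$ (equal to $0$ where $\operatorname{ord}_x(D)=0$). Norms. For $s\in\Gamma(D)^\times_{\mathbb R}$ (in particular for non-zero $s\in H^0(D)$), $\|s\|_g:=\exp\big(-\inf_{\xi\in X^{\mathrm{an}}}(g_{(s)}+g)(\xi)\big)$,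 and $\|0\|_g:=0$; this is an ultrametric norm on $H^0(D)$. For an ultrametrically normed $k$-space $(E,\|\cdot\|)$ of dimension $r$, the determinant norm on $\Lambda^r E$ is $\|\eta\|_{\det}=\inf\{\|s_1\|\cdots\|s_r\|: s_1\wedge\cdots\wedge s_r=\eta\}$. Plurisubharmonicity. If $\Gamma(D)^\times_{\mathbb R}\neq\emptyset$ (automatic if $\deg(D)>0$), for $\xi\in X^{\mathrm{an}}\setminus\{x_0:x\in X^{(1)}\}$ put $\widetilde g(\xi):=\sup_{s\in\Gamma(D)^\times_{\mathbb R}}(\ln|s|(\xi)-\ln\|s\|_g)$, where $\ln|s|(\xi)=-t(\xi)\operatorname{ord}_x(s)$ for $\xi\in[\eta_0,x_0[$. $g$ is called plurisubharmonic if $g=\widetilde g$ (on $X^{\mathrm{an}}\setminus\{x_0:x\in X^{(1)}\}$). Self-intersection number: $(\overline D\cdot\overline D):=2g(\eta_0)\deg(D)-\sum_{x\in X^{(1)}}[k(x):k]\int_0^{+\infty}\big((\varphi_g\circ\xi_x)'(t)\big)^2\,\mathrm dt$, the derivative being in the sense of distributions on $\mathbb R_{>0}$. *)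

(* Defs.v *)
From HB Require Import structures.
From mathcomp Require Import all_boot all_order all_algebra.
From mathcomp Require Import all_classical all_reals all_analysis.
(* The notations of mpoly clash with those of analysis. *)
From mathcomp Require Import -(notations) mpoly.

Set Implicit Arguments.
Unset Strict Implicit.
Unset Printing Implicit Defensive.

Import Order.TTheory GRing.Theory Num.Theory numFieldNormedType.Exports.

Local Open Scope classical_set_scope.
Local Open Scope ring_scope.

(** An integral projective scheme over [k] is a closed subscheme V_+(I) of some
    P^N_k, with I a homogeneous prime ideal not containing every variable.  It
    is given here by its generic point: a point [gen] of P^N with homogeneous
    coordinates in the function field [ratf], whose values F(gen)/G(gen) (F, G
    homogeneous of the same degree, G(gen) <> 0) exhaust [ratf].  The ideal I is
    generated by the homogeneous F with F(gen) = 0, and every such I arises,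
    with [ratf] the degree-0 part of the homogeneous fractions of k[T]/I. *)
Record projective_variety (k : fieldType) := ProjectiveVariety {
  ratf : fieldType ;
  scalar : {rmorphism k -> ratf} ;
  pdim : nat ;
  gen : 'I_pdim.+1 -> ratf ;
  gen_neq0 : exists i, gen i != 0 ;
  gen_ratf : forall f : ratf, exists (d : nat) (F G : mpoly pdim.+1 k),
    [/\ F \is ishomog1 d mdeg, G \is ishomog1 d mdeg, mmap scalar gen G != 0 &
        f = mmap scalar gen F / mmap scalar gen G] }.

Section Curve.
Context (k : fieldType) (X : projective_variety k).
Local Notation K := (ratf X).
Local Notation poly := (mpoly (pdim X).+1 k).

Definition eval_gen (F : poly) : K := mmap (scalar X) (@gen k X) F.

(** Dimension 1: [ratf X] has transcendence degree 1 over [k]; [z] is a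
    transcendence basis, and a nonzero relation Q(z, f) = 0 with z
    transcendental makes f algebraic over k(z). *)
Definition is_curve : Prop :=
  exists z : K, ~ algebraicOver (scalar X) z /\
    forall f : K, exists2 Q : {poly {poly k}}, Q != 0 &
      (map_poly (fun q => (map_poly (scalar X) q).[z]) Q).[f] = 0.

(** The points of Proj (k[T]/I), as prime ideals of k[T]. *)
Record is_point (P : set poly) : Prop := IsPoint {
  point0 : P 0 ;
  pointD : forall F G, P F -> P G -> P (F + G) ;
  pointM : forall F G, P G -> P (F * G) ;
  point_homog : forall F d, P F -> P (pihomog mdeg d F) ;
  point_prime : forall F G, P (F * G) -> P F \/ P G ;
  point_relevant : exists i, ~ P (mpolyX k (mnm1 i)) ;
  point_on : forall F d, F \is ishomog1 d mdeg -> eval_gen F = 0 -> P F }.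

Record closed_point := ClosedPoint {
  ideal_of : set poly ;
  closed_is_point : is_point ideal_of ;
  closed_max : forall Q, is_point Q -> ideal_of `<=` Q -> Q = ideal_of }.

HB.instance Definition _ := gen_eqMixin closed_point.
HB.instance Definition _ := gen_choiceMixin closed_point.

Definition local_ring (x : closed_point) : set K :=
  [set f | exists (d : nat) (F G : poly),
     [/\ F \is ishomog1 d mdeg, G \is ishomog1 d mdeg, ~ ideal_of x G &
         f = eval_gen F / eval_gen G]].

Definition local_ideal (x : closed_point) : set K :=
  [set f | exists (d : nat) (F G : poly),
     [/\ F \is ishomog1 d mdeg /\ ideal_of x F, G \is ishomog1 d mdeg, ~ ideal_of x G &
         f = eval_gen F / eval_gen G]].

Definition uniformizer (x : closed_point) (p : K) : Prop :=
  local_ideal x p /\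
  forall f, local_ideal x f -> exists2 a, local_ring x a & f = a * p.

(** The local rings at closed points have dimension 1 on a curve, so such a ring
    is regular iff its maximal ideal is generated by one element.  (The local
    ring at the generic point is the field [ratf X].) *)
Definition is_regular : Prop := forall x, exists p, uniformizer x p.

(** The order of f <> 0 is the n such that f = a p^n with a a unit. *)
Definition ord (x : closed_point) (f : K) : int :=
  xget 0 [set n | exists p a, [/\ uniformizer x p,
    local_ring x a, ~ local_ideal x a & f = a * p ^ n]].

(** [e] lies in [U] and induces a [k]-basis of [U / W]. *)
Definition is_basis_mod (U W : set K) (d : nat) (e : 'I_d -> K) : Prop :=
  [/\ forall i, U (e i),
      forall c : 'I_d -> k, W (\sum_i scalar X (c i) * e i) ->
        forall i, c i = 0
    & forall u, U u ->
        exists c : 'I_d -> k, W (u - \sum_i scalar X (c i) * e i)].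

Definition is_basis (U : set K) (d : nat) (e : 'I_d -> K) : Prop :=
  is_basis_mod U [set 0] e.

(** [k(x) : k] *)
Definition residue_degree (x : closed_point) : nat :=
  xget 0%N [set d | exists e : 'I_d -> K,
    is_basis_mod (local_ring x) (local_ideal x) e].

(** Equality of t_1 /\ ... /\ t_r and s_1 /\ ... /\ s_r in the r-th exterior
    power of the [k]-subspace [E], through its universal property. *)
Definition alternating (E : set K) (r : nat) (V : lmodType k)
    (w : ('I_r -> K) -> V) : Prop :=
  (forall (t : 'I_r -> K) (i : 'I_r) (c : k) (u v : K),
     (forall j, E (t j)) -> E u -> E v ->
     w (dfwith t i (scalar X c * u + v)) =
       c *: w (dfwith t i u) + w (dfwith t i v)) /\
  (forall (t : 'I_r -> K) (i j : 'I_r),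
     (forall l, E (t l)) -> i != j -> t i = t j -> w t = 0).

Definition wedge_eq (E : set K) (r : nat) (t s : 'I_r -> K) : Prop :=
  forall (V : lmodType k) (w : ('I_r -> K) -> V), alternating E w -> w t = w s.

End Curve.

Section Metrised.
Context (R : realType) (k : fieldType) (X : projective_variety k).
Local Notation K := (ratf X).
Local Notation pt := (closed_point X).
Implicit Types (x : pt) (D : pt -> R).

Definition is_Rdivisor D : Prop := finite_set [set x | D x != 0].

Definition deg D : R := \sum_(x \in [set: pt]) (residue_degree x)%:R * D x.

(** Rat(X)^* (x)_Z R: formal sums of pure tensors f (x) a, two of them being
    identified when no Z-bilinear map on Rat(X)^* x R separates them. *)
Definition tensor_rep : Type := seq ({f : K | f != 0} * R)%type.
HB.instance Definition _ := Choice.on tensor_rep.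

Definition bilinear_on_units (V : zmodType) (b : K -> R -> V) : Prop :=
  (forall f g a, f != 0 -> g != 0 -> b (f * g) a = b f a + b g a) /\
  (forall f a c, f != 0 -> b f (a + c) = b f a + b f c).

Definition same_tensor (s t : tensor_rep) : Prop :=
  forall (V : zmodType) (b : K -> R -> V), bilinear_on_units b ->
    \sum_(p <- s) b (val p.1) p.2 = \sum_(p <- t) b (val p.1) p.2.

Definition tensor_rel : rel tensor_rep := fun s t => `[< same_tensor s t >].

Lemma tensor_rel_equiv : equiv_class_of tensor_rel.
Proof.
split.
- by move=> s; apply/asboolP.
- by move=> s t; apply/asboolP/asboolP => st V b bb; rewrite (st V b bb).
- move=> t s u /asboolP st /asboolP tu; apply/asboolP => V b bb.
  by rewrite (st V b bb) (tu V b bb).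
Qed.

Canonical tensor_equiv := EquivRelPack tensor_rel_equiv.

Definition ratR : Type := {eq_quot tensor_equiv}%qT.
HB.instance Definition _ := Choice.on ratR.

Definition ordR x (s : ratR) : R :=
  \sum_(p <- (repr (s : {eq_quot tensor_equiv}%qT) : tensor_rep))
    p.2 * (ord x (val p.1))%:~R.

Definition GammaR D : set ratR := [set s | forall x, 0 <= ordR x s + D x].

Definition H0 D : set K :=
  [set f | f = 0 \/ (f != 0 /\ forall x, 0 <= (ord x f)%:~R + D x)].

(** The tree X^an: the root and, on each branch, the points with t > 0. *)
Inductive berkovich : Type :=
  | eta0
  | on_branch of pt & {t : \bar R | (0 < t)%E}.

HB.instance Definition _ := gen_eqMixin berkovich.
HB.instance Definition _ := gen_choiceMixin berkovich.

(** [xi x t] is meant for 0 <= t. *)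
Definition xi x (t : \bar R) : berkovich :=
  if insub t is Some u then on_branch x u else eta0.

Definition tcoord (p : berkovich) : \bar R :=
  if p is on_branch _ u then val u else 0%E.

Definition leaf (p : berkovich) : Prop := exists x, p = xi x +oo%E.

Definition berkovich_open (U : set berkovich) : Prop :=
  (forall x,
     open (xi x @^-1` U : set (subspace [set t : \bar R | (0 <= t)%E]))) /\
  (U eta0 ->
     finite_set [set x | ~ xi x @` [set t : \bar R | (0 <= t)%E] `<=` U]).

Lemma berkovich_openT : berkovich_open setT.
Proof.
split=> [x|_]; first by rewrite preimage_setT; exact: openT.
by apply: (sub_finite_set _ (finite_set0 _)) => x /=; apply.
Qed.

Lemma berkovich_openI : setI_closed berkovich_open.
Proof.
move=> U V [oU fU] [oV fV]; split=> [x|[Ur Vr]].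
  by rewrite preimage_setI; exact: openI.
have fUV := conj (fU Ur) (fV Vr); rewrite -finite_setU in fUV.
apply: sub_finite_set fUV => x /= nUV.
by apply/not_andP => -[hU hV]; apply: nUV => p hp; split; [exact: hU|exact: hV].
Qed.

Lemma berkovich_open_bigU (I : Type) (f : I -> set berkovich) :
  (forall i, berkovich_open (f i)) -> berkovich_open (\bigcup_i f i).
Proof.
move=> of_; split=> [x|[i _ fi]].
  by rewrite preimage_bigcup; apply: bigcup_open => i _; exact: (of_ i).1.
apply: sub_finite_set ((of_ i).2 fi) => x /= nx h.
by apply: nx => p /h fp; exists i.
Qed.

HB.instance Definition _ := isOpenTopological.Build berkovich
  berkovich_openT berkovich_openI berkovich_open_bigU.

Implicit Types g : berkovich -> \bar R.

Definition is_green D g : Prop :=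
  continuous g /\
  exists phi : berkovich -> R, continuous phi /\
    forall x (t : R), 0 <= t ->
      (phi (xi x t%:E))%:E = (g (xi x t%:E) - (D x * t)%:E)%E.

(** phi_g \o xi_x on [0, +oo[. *)
Definition phi_branch D g x (t : R) : R := fine (g (xi x t%:E)) - D x * t.

(** Here (D x) * +oo is 0 when D x = 0. *)
Definition canonical_green D : berkovich -> \bar R := fun p =>
  if p is on_branch x u then ((D x)%:E * val u)%E else 0%E.

(** At a leaf, where the pointwise sum may be +oo - oo, the value is the limit
    of the sum along the branch. *)
Definition green_add g1 g2 : berkovich -> \bar R := fun p =>
  if p is on_branch x u then
    if val u == +oo%E then
      lim ((g1 (xi x t%:E) + g2 (xi x t%:E))%E @[t --> +oo%R])
    else (g1 p + g2 p)%E
  else (g1 p + g2 p)%E.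

(** exp (- inf (g_E + g)); used for E = (s). *)
Definition div_norm g (E : pt -> R) : R :=
  expR (- fine (ereal_inf (range (green_add (canonical_green E) g)))).

Definition normR g (s : ratR) : R := div_norm g (fun x => ordR x s).

Definition norm g (f : K) : R :=
  if f == 0 then 0 else div_norm g (fun x => (ord x f)%:~R).

(** The determinant norm of s_1 /\ ... /\ s_r, for a norm [N] on [E]. *)
Definition det_norm (E : set K) (N : K -> R) (r : nat) (s : 'I_r -> K) : R :=
  inf [set c | exists t : 'I_r -> K,
    [/\ forall i, E (t i), wedge_eq E t s & c = \prod_i N (t i)]].

(** ln |s|; meant away from the leaves. *)
Definition ln_abs (s : ratR) (p : berkovich) : \bar R :=
  if p is on_branch x u then (- (val u * (ordR x s)%:E))%E else 0%E.

Definition psh_envelope D g (p : berkovich) : \bar R :=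
  ereal_sup [set (ln_abs s p - (ln (normR g s))%:E)%E | s in GammaR D].

(** When [GammaR D] is empty the envelope is -oo, so no Green function
    is plurisubharmonic. *)
Definition plurisubharmonic D g : Prop :=
  forall p, ~ leaf p -> g p = psh_envelope D g p.

Definition test_function (psi : R -> R) : Prop :=
  (forall n t, derivable (derive1n n psi) t 1) /\
  (exists a b, 0 < a /\ forall t, ~ (a <= t <= b) -> psi t = 0).

(** [u] is the derivative of [f] in the sense of distributions on R_{>0}. *)
Definition distr_derivative (f u : R -> R) : Prop :=
  locally_integrable `]0, +oo[ u /\
  forall psi, test_function psi ->
    Rintegral lebesgue_measure `]0, +oo[ (fun t => f t * derive1 psi t) =
    - Rintegral lebesgue_measure `]0, +oo[ (fun t => u t * psi t).

(** The integral of f'^2 over R_{>0}; it is +oo by convention when the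
    distribution f' is not a function. *)
Definition energy (f : R -> R) : \bar R :=
  xget +oo%E [set e | exists2 u, distr_derivative f u &
    e = (\int[lebesgue_measure]_(t in `]0%R, +oo[) ((u t) ^+ 2)%:E)%E].

Definition self_intersection D g : \bar R :=
  ((2 * fine (g eta0) * deg D)%:E -
   \esum_(x in [set: pt])
      ((residue_degree x)%:R%:E * energy (phi_branch D g x)))%E.

End Metrised.

Arguments berkovich R {k} X.
Arguments eta0 {R k X}.

(* Main.v *)
(** An orthogonal basis (e_i) of H^0(nD) turns -ln of the determinant norm into
    the sum of the heights h_n(e_i) = -ln ||e_i||_{ng}, that is, into
      n a r_n + n \int_a^{g(eta_0)} #{i : h_n(e_i) >= n t} dt
    for a lower bound a of phi_g.  Plurisubharmonicity makes every
    phi_x = phi_g o xi_x convex and nonincreasing, and then f in H^0(nD) has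
    height >= n t iff ord_x f + n (D(x) - P_t(x)) >= 0 for all x, where P_t(x) is
    the least p >= 0 such that t - p s <= phi_x(s) for all s > 0.  So the number
    of such basis vectors is dim H^0(n(D - P_t)) = n (deg D - deg P_t) + O(1), and
    the limit is 2 (a deg D + \int_a^{g(eta_0)} (deg D - deg P_t) dt).  By
    Legendre duality and Tonelli, \int_a^{phi_x(0)} P_t(x) dt is half the energy
    of phi_x, which gives the self-intersection number.

    The curve is known only through its generic point and its local rings.
    Properness enters through the finite dimension of H^0(0), which is implied by
    the existence of the basis s_0; the degree formula and Riemann's inequality
    follow from it by counting functions that are linearly independent over
    k[f]. *)

Require Import Defs.
From mathcomp Require Import all_boot all_order all_algebra.
From mathcomp Require Import all_classical all_reals all_analysis.
From mathcomp Require Import perm measurable_realfun.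
From mathcomp Require Import zify ring lra.
From mathcomp Require Import -(notations) mpoly.

Set Implicit Arguments.
Unset Strict Implicit.
Unset Printing Implicit Defensive.

Import Order.TTheory GRing.Theory Num.Theory numFieldNormedType.Exports.

Local Open Scope classical_set_scope.
Local Open Scope ring_scope.

(** * Linear independence and growth *)

(** No finiteness is assumed of the local rings: that a function has finitely many zeros, that
    residue degrees are finite, and that a nonzero function has a finite order at each point all
    come from one count. As the function field is algebraic over k(z), polynomials of degree at most
    M in finitely many functions span a space of dimension O(M). Hence any two functions satisfy a
    polynomial relation, and the number of functions independent over k[f] is bounded. The finite
    dimension of H^0(0) bounds dim L(E) by a constant plus deg E for effective E; comparing growth
    rates along multiples of a pole divisor then gives degree 0 for principal divisors. On the
    analytic side the obstacle is the level t = g(eta_0). Below it, a section of height above t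
    dominates P_t, which is therefore a divisor of degree at most deg D; at the level itself P_t may
    have infinite support or infinite coefficients. So the integrals run over the open interval ]a,
    g(eta_0)[, and exchanging the sum over points with the integral requires a cutoff near the right
    end. *)

Section LinearAlgebra.
Context (k K : fieldType) (sc : {rmorphism k -> K}).

Definition indep (I : finType) (w : I -> K) : Prop :=
  forall c : I -> k, \sum_i sc (c i) * w i = 0 -> forall i, c i = 0.

(** Only the inequality dim U >= m is encoded, so that spaces not yet known to be finite-dimensional
    can be handled; upper bounds are stated as implications from it. *)
Definition dimge (U : set K) (m : nat) : Prop :=
  exists w : 'I_m -> K, (forall i, U (w i)) /\ indep w.

Definition lin_closed (U : set K) : Prop :=
  U 0 /\ forall c u v, U u -> U v -> U (sc c * u + v).

Lemma lin_closed_sum (U : set K) (I : finType) (c : I -> k) (w : I -> K) :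
  lin_closed U -> (forall i, U (w i)) -> U (\sum_i sc (c i) * w i).
Proof.
move=> [U0 UD] Uw; elim/big_rec: _ => [//|i x _ Ux]; exact: UD.
Qed.

Lemma lin_closedD (U : set K) u v : lin_closed U -> U u -> U v -> U (u + v).
Proof. by move=> [_ UD] Uu Uv; rewrite -[u]mul1r -(rmorph1 sc); exact: UD. Qed.

Lemma lin_closedZ (U : set K) c u : lin_closed U -> U u -> U (sc c * u).
Proof. by move=> [U0 UD] Uu; rewrite -[_ * _]addr0; exact: UD. Qed.

Lemma indep_inj (I J : finType) (f : J -> I) (w : I -> K) :
  injective f -> indep w -> indep (w \o f).
Proof.
move=> fi iw c /= c0 j.
pose c' i := \sum_(l | f l == i) c l.
have <- : c' (f j) = c j.
  by rewrite /c' (big_pred1 j) // => l; rewrite (inj_eq fi).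
apply: iw; rewrite -[RHS]c0 [RHS](partition_big f predT) //=.
apply: eq_bigr => i _; rewrite rmorph_sum mulr_suml.
by apply: eq_bigr => l /eqP ->.
Qed.

Lemma dimge_fin (U : set K) (I : finType) (w : I -> K) :
  (forall i, U (w i)) -> indep w -> dimge U #|I|.
Proof.
move=> Uw iw; exists (w \o enum_val); split=> [i|]; first exact: Uw.
exact: indep_inj enum_val_inj iw.
Qed.

Lemma dimge_sub (U V : set K) m : U `<=` V -> dimge U m -> dimge V m.
Proof. by move=> UV [w [Uw iw]]; exists w; split=> // i; exact/UV/Uw. Qed.

Lemma dimge_le (U : set K) m n : (m <= n)%N -> dimge U n -> dimge U m.
Proof.
move=> mn [w [Uw iw]]; exists (w \o widen_ord mn); split=> [i|]; first exact: Uw.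
by apply: indep_inj iw => i j /(congr1 val) /= ij; apply: val_inj.
Qed.

Lemma indep_mul (I : finType) (w : I -> K) (a : K) :
  a != 0 -> indep w -> indep (fun i => a * w i).
Proof.
move=> a0 iw c c0; apply: iw; apply: (mulfI a0).
by rewrite mulr0 -[RHS]c0 mulr_sumr; apply: eq_bigr => i _; rewrite mulrCA.
Qed.

Lemma dimge_mul (U V : set K) (a : K) m : a != 0 ->
  (forall u, U u -> V (a * u)) -> dimge U m -> dimge V m.
Proof.
move=> a0 UV [w [Uw iw]]; exists (fun i => a * w i).
by split=> [i|]; [exact/UV/Uw|exact: indep_mul].
Qed.

Lemma indep_mx m p (w : 'I_m -> K) (A : 'M[k]_(p, m)) :
  row_free A -> indep w -> indep (fun i => \sum_j sc (A i j) * w j).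
Proof.
move=> fA iw c c0.
have cA : (\row_i c i) *m A = 0.
  apply/rowP => j; rewrite !mxE; apply: (iw (fun j => \sum_i (\row_i c i) 0 i * A i j)).
  rewrite -[RHS]c0; under eq_bigr do rewrite rmorph_sum mulr_suml.
  rewrite exchange_big; apply: eq_bigr => i _; rewrite mulr_sumr.
  by apply: eq_bigr => l _; rewrite mxE rmorphM mulrA.
have /rowP c0' : \row_i c i = 0.
  by apply: (row_free_inj fA); rewrite cA mul0mx.
by move=> i; have := c0' i; rewrite !mxE.
Qed.

(* A k-linear map from U to a d-dimensional space, given on families by the
   matrix M, whose kernel is contained in V. *)
Lemma dimge_kernel (U V : set K) m d :
  (forall w : 'I_m -> K, (forall i, U (w i)) -> exists M : 'M[k]_(m, d),
     forall c : 'rV_m, c *m M = 0 -> V (\sum_i sc (c 0 i) * w i)) ->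
  dimge U m -> dimge V (m - d).
Proof.
move=> UV [w [Uw iw]]; have [M MV] := UV w Uw.
have le : (m - d <= \rank (kermx M))%N.
  by rewrite mxrank_ker leq_sub2l // rank_leq_col.
apply: dimge_le le _.
exists (fun i => \sum_j sc (row_base (kermx M) i j) * w j).
split=> [i|]; last exact: indep_mx (row_base_free _) iw.
under eq_bigr => j _ do rewrite -[row_base _ i j]mulr1.
have := MV (row i (row_base (kermx M))).
have -> : row i (row_base (kermx M)) *m M = 0.
  apply/eqP; rewrite -sub_kermx (submx_trans (row_sub _ _)) //.
  by rewrite eq_row_base.
move=> /(_ erefl); congr V; apply: eq_bigr => j _.
by rewrite mxE mulr1.
Qed.

(** The coordinates on [s] form the matrix of [dimge_kernel] with target {0}, where no positive
    number of independent vectors exists. *)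
Lemma dimge_span_ord (U : set K) m d (s : 'I_d -> K) :
  (forall u, U u -> exists c : 'I_d -> k, u = \sum_i sc (c i) * s i) ->
  dimge U m -> (m <= d)%N.
Proof.
move=> Us dU; rewrite -subn_eq0.
have : dimge [set 0] (m - d).
  apply: dimge_kernel dU => w Uw; have /choice[a wa] i := Us _ (Uw i).
  exists (\matrix_(i, j) a i j) => c /rowP cM /=.
  under eq_bigr do rewrite wa mulr_sumr.
  rewrite exchange_big big1 // => j _.
  have := cM j; rewrite !mxE => /(congr1 sc) /(congr1 (fun u => u * s j)).
  rewrite rmorph0 mul0r rmorph_sum mulr_suml => cj; rewrite -[RHS]cj.
  by apply: eq_bigr => i _; rewrite mxE rmorphM mulrA.
case: (m - d)%N => // n [w [w0 /(_ (fun i => (i == ord0)%:R))]].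
rewrite big1 => [/(_ erefl ord0)/eqP|i _]; first by rewrite eqxx oner_eq0.
by rewrite w0 mulr0.
Qed.

Lemma dimge_span (U : set K) m (I : finType) (s : I -> K) :
  (forall u, U u -> exists c : I -> k, u = \sum_i sc (c i) * s i) ->
  dimge U m -> (m <= #|I|)%N.
Proof.
move=> Us; apply: (@dimge_span_ord _ _ _ (s \o enum_val)) => u /Us[c ->].
exists (c \o enum_val) => /=.
rewrite (reindex (enum_val (A := {: I}))) //=.
by apply: onW_bij; exact: enum_val_bij.
Qed.

Definition peval (f : K) (q : {poly k}) : K := (map_poly sc q).[f].

Lemma pevalD f p q : peval f (p + q) = peval f p + peval f q.
Proof. by rewrite /peval rmorphD hornerD. Qed.
Lemma pevalM f p q : peval f (p * q) = peval f p * peval f q.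
Proof. by rewrite /peval rmorphM hornerM. Qed.
Lemma pevalC f c : peval f c%:P = sc c.
Proof. by rewrite /peval map_polyC hornerC. Qed.
Lemma pevalX f : peval f 'X = f.
Proof. by rewrite /peval map_polyX hornerX. Qed.
Lemma peval0 f : peval f 0 = 0.
Proof. by rewrite /peval rmorph0 horner0. Qed.
Lemma pevalE f (q : {poly k}) n : (size q <= n)%N ->
  peval f q = \sum_(j < n) sc q`_j * f ^+ j.
Proof.
move=> sq; rewrite /peval (@horner_coef_wide _ n) ?size_map_poly //.
by apply: eq_bigr => i _; rewrite coef_map.
Qed.

Definition transc (f : K) : Prop := forall q : {poly k}, peval f q = 0 -> q = 0.

Lemma transc_neq0 f : transc f -> f != 0.
Proof.
move=> tf; apply/eqP => f0; have := tf 'X; rewrite pevalX.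
by move=> /(_ f0)/eqP; rewrite polyX_eq0.
Qed.

Definition indepX (I : finType) (f : K) (w : I -> K) : Prop :=
  forall c : I -> {poly k}, \sum_i peval f (c i) * w i = 0 -> forall i, c i = 0.

(** Passes from rank over k[f] to dimension over k; this is the lower bound in the counts of
    [indepX_bound] and [RR_growth]. *)
Lemma indepX_pow (I : finType) f (w : I -> K) l : indepX f w ->
  indep (fun ij : I * 'I_l => w ij.1 * f ^+ ij.2).
Proof.
move=> iw c c0 [i j].
pose q i := \poly_(j < l) oapp (fun j => c (i, j)) 0 (insub j : option 'I_l).
have qE i' (j' : 'I_l) : (q i')`_j' = c (i', j').
  by rewrite coef_poly ltn_ord valK.
rewrite -qE; suff -> : q i = 0 by rewrite coef0.
apply: iw; rewrite -[RHS]c0.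
transitivity (\sum_i' \sum_(j' < l) sc (c (i', j')) * (w i' * f ^+ j')).
  apply: eq_bigr => i' _; rewrite (@pevalE _ _ l) ?size_poly // mulr_suml.
  by apply: eq_bigr => j' _; rewrite qE -mulrA [_ * w _]mulrC.
by rewrite pair_bigA /=; apply: eq_bigr => -[].
Qed.

(** * Linear growth in algebraic extensions of k(z) *)

Section Growth.
Variables (z : K) (z_transc : transc z).

(* The filtrations T of subspaces of K whose growth stays linear when an element
   algebraic over k(z) is adjoined. *)
Record module_filtration (T : nat -> set K) (D : nat) : Prop := ModuleFiltration {
  mf_lin : forall L, lin_closed (T L) ;
  mf_poly : forall (q : {poly k}) L e v, (size q <= e.+1)%N -> T L v -> T (L + e)%N (peval z q * v) ;
  mf_1 : T 0%N 1 ;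
  mf_dim : forall L, exists (I : finType) (s : I -> K), #|I| = (D * L.+1)%N /\
    forall u, T L u -> exists c : I -> k, u = \sum_i sc (c i) * s i }.

Lemma mf_le T D L L' : module_filtration T D -> (L <= L')%N -> T L `<=` T L'.
Proof.
move=> mT LL v Tv; have := mf_poly mT (q := 1) (e := L' - L) (L := L) (v := v).
by rewrite size_poly1 subnKC // -polyC1 pevalC rmorph1 mul1r; apply.
Qed.

Lemma mf_base : module_filtration
  (fun L => [set v | exists2 q : {poly k}, (size q <= L.+1)%N & v = peval z q]) 1.
Proof.
split=> /=.
- move=> L; split; first by exists 0; rewrite ?size_poly0 ?peval0.
  move=> c u v [p sp ->] [q sq ->]; exists (c%:P * p + q); last first.
    by rewrite pevalD pevalM pevalC.
  rewrite (leq_trans (size_polyD _ _)) // geq_max sq andbT mul_polyC.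
  exact: leq_trans (size_scale_leq _ _) sp.
- move=> q L e v sq [p sp ->]; exists (q * p); last by rewrite pevalM.
  rewrite (leq_trans (size_polyMleq _ _)) //.
  by apply: (@leq_trans (e.+1 + L.+1).-1); [rewrite -!subn1 leq_sub2r // leq_add|lia].
- by exists 1; rewrite ?size_poly1 // -polyC1 pevalC rmorph1.
- move=> L; exists 'I_L.+1, (fun i : 'I_L.+1 => z ^+ i); rewrite card_ord mul1n; split=> // u [q sq ->].
  by exists (fun i : 'I_L.+1 => q`_i); rewrite (pevalE _ sq).
Qed.

Definition mf_adjoin (T : nat -> set K) (a : K) (d : nat) (L : nat) : set K :=
  [set v | exists2 t : 'I_d -> K, (forall j, T L (t j)) & v = \sum_j t j * a ^+ j].

Lemma mf_adjoinP T D a d : module_filtration T D -> (0 < d)%N ->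
  module_filtration (mf_adjoin T a d) (D * d).
Proof.
move=> mT d0; split.
- move=> L; split.
    exists (fun=> 0); first by move=> _; exact: (mf_lin mT L).1.
    by rewrite big1 // => j _; rewrite mul0r.
  move=> c u v [t Tt ->] [s Ts ->]; exists (fun j => sc c * t j + s j).
    by move=> j; apply: (mf_lin mT L).2.
  rewrite mulr_sumr -big_split; apply: eq_bigr => j _ /=; ring.
- move=> q L e v sq [t Tt ->]; exists (fun j => peval z q * t j).
    by move=> j; exact: mf_poly mT _ _ _ _ sq (Tt j).
  by rewrite mulr_sumr; apply: eq_bigr => j _ /=; ring.
- case: d d0 => // d _; exists (fun j => if j == ord0 then 1 else 0).
    by move=> j; case: eqP => _; [exact: mf_1 mT|exact: (mf_lin mT 0%N).1].
  rewrite (bigD1 ord0) //= mul1r big1 ?addr0 // => j /negPf ->.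
  by rewrite mul0r.
- move=> L; have [I [s [cI Ts]]] := mf_dim mT L.
  exists (I * 'I_d)%type, (fun ij : I * 'I_d => s ij.1 * a ^+ ij.2).
  split; first by rewrite card_prod cI card_ord; lia.
  move=> u [t Tt ->]; have /choice[c tc] j := Ts _ (Tt j).
  exists (fun ij : I * 'I_d => c ij.2 ij.1).
  rewrite -(pair_bigA _ (fun i (j : 'I_d) => sc (c j i) * (s i * a ^+ j))) exchange_big /=.
  apply: eq_bigr => j _; rewrite tc mulr_suml.
  by apply: eq_bigr => i _; rewrite mulrA.
Qed.

(* C a maps degree L to degree L + h; C clears the leading coefficient of the
   relation of a over k[z]. *)
Definition acts (T : nat -> set K) (h : nat) (C : {poly k}) (a : K) : Prop :=
  forall L v, T L v -> T (L + h)%N (peval z C * a * v).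

Definition alg_over (a : K) : Prop :=
  exists2 Q : {poly {poly k}}, Q != 0 &
    (map_poly (fun q => (map_poly sc q).[z]) Q).[a] = 0.

Lemma alg_relation a : alg_over a ->
  exists (d : nat) (C : {poly k}) (b : 'I_d -> {poly k}),
    [/\ (0 < d)%N, C != 0 & peval z C * a ^+ d = \sum_j peval z (b j) * a ^+ j].
Proof.
move=> [Q Q0 Qa].
have sQ : size (map_poly (peval z) Q) = size Q.
  apply: size_map_poly_id0; apply: contraNneq Q0 => /z_transc/eqP.
  by rewrite lead_coef_eq0.
have Qa' : \sum_(j < size Q) peval z Q`_j * a ^+ j = 0.
  rewrite -[RHS]Qa [RHS]horner_coef sQ; apply: eq_bigr => j _.
  by rewrite coef_map_id0 //; exact: peval0.
have := size_poly_gt0 Q; rewrite Q0; case sE: (size Q) Qa' => [//|d] + _.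
rewrite big_ord_recr /= => /eqP; rewrite addrC addr_eq0 => /eqP lE.
exists d, (lead_coef Q), (fun j => - Q`_j); split=> //.
- rewrite lt0n; apply: contraNneq Q0 => d0; move: lE; rewrite d0 big_ord0 oppr0 expr0.
  rewrite mulr1 => /z_transc => Q00; rewrite -lead_coef_eq0 lead_coefE sE d0.
  by rewrite Q00.
- by rewrite lead_coef_eq0.
- rewrite lead_coefE sE lE -sumrN; apply: eq_bigr => j _.
  by rewrite -mulNr -[- Q`_j]mulN1r -[in RHS]polyCN pevalM pevalC rmorphN1 mulN1r.
Qed.

Lemma acts_mul T D h (C C' : {poly k}) a : module_filtration T D -> acts T h C a ->
  acts T (h + size C') (C' * C) a.
Proof.
move=> mT aC L v Tv; rewrite addnA pevalM -2!mulrA.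
by apply: mf_poly mT _ _ _ _ _ _; [exact: leqnSn|rewrite mulrA; exact: aC].
Qed.

Lemma acts_le T D h h' C a : module_filtration T D -> (h <= h')%N ->
  acts T h C a -> acts T h' C a.
Proof.
move=> mT hh aC L v /aC; apply: (mf_le mT); by rewrite leq_add2l.
Qed.

(** Adjoining [a] replaces T by the sums of t_j a^j with j < d, which multiplies the dimension
    constant D by d. Multiplication by c a shifts the powers of a, and the relation rewrites c a^d
    in lower powers. The common multiplier C is the product of the leading coefficients of all the
    relations. *)
Lemma growth (A : seq K) : (forall a, a \in A -> alg_over a) ->
  exists T D h (C : {poly k}), [/\ module_filtration T D, C != 0 &
    forall a, a \in A -> acts T h C a].
Proof.
elim: A => [_|a A IH Aa].
  exists (fun L => [set v | exists2 q : {poly k}, (size q <= L.+1)%N & v = peval z q]).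
  by exists 1%N, 0%N, 1; split; [exact: mf_base|exact: oner_neq0|].
have [b bA|T [D [h [C [mT C0 AT]]]]] := IH; first by apply: Aa; rewrite inE bA orbT.
have [|d [c [r [d0 c0 ar]]]] := alg_relation (a := a); first by apply: Aa; rewrite inE eqxx.
have mT' := mf_adjoinP a mT d0.
pose m := \max_(j < d) size (r j).
have new : acts (mf_adjoin T a d) (size c + m) c a.
  case: d d0 r @m ar mT' => // d _ r m ar mT' L v [t Tt ->].
  (* The first term is the shift of powers; the second expands c a^(d+1), which only the top
     coefficient [t ord_max] meets. *)
  exists (fun j : 'I_d.+1 => (if val j == 0%N then 0 else peval z c * t (inord j.-1))
      + peval z (r j) * t ord_max).
    move=> j; apply: lin_closedD (mf_lin mT _) _ _.
      case: eqP => _; first exact: (mf_lin mT _).1.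
      rewrite addnA; apply: (mf_le mT (leq_addr _ _)).
      by apply: mf_poly mT _ _ _ _ _ _; [exact: leqnSn|exact: Tt].
    apply: mf_poly mT _ _ _ _ _ (Tt _).
    apply: leqW; apply: leq_trans (leq_addl _ _).
    by rewrite /m (leq_bigmax j).
  rewrite mulr_sumr; under [RHS]eq_bigr do rewrite mulrDl.
  rewrite big_split /= [X in _ = X + _]big_ord_recl /= mul0r add0r.
  rewrite [LHS]big_ord_recr /=; congr (_ + _).
    apply: eq_bigr => j _; rewrite /bump /= add1n /= exprS.
    have -> : inord j = widen_ord (leqnSn d) j :> 'I_d.+1.
      by apply: val_inj; rewrite /= inordK // ltnS ltnW.
    ring.
  have -> : peval z c * a * (t ord_max * a ^+ d) = t ord_max * (peval z c * a ^+ d.+1).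
    by rewrite exprS; ring.
  by rewrite ar mulr_sumr; apply: eq_bigr => j _; ring.
have old b : b \in A -> acts (mf_adjoin T a d) h C b.
  move=> bA L v [t Tt ->]; exists (fun j => peval z C * b * t j).
    by move=> j; exact: AT.
  by rewrite mulr_sumr; apply: eq_bigr => j _; rewrite mulrA.
(* The old elements need the shift [h + size c], the new one [size c + m + size C]; the sum serves
   both. *)
exists (mf_adjoin T a d), (D * d)%N, (h + size c + (size c + m + size C))%N, (c * C).
split=> //; first by rewrite mulf_neq0.
move=> b; rewrite inE => /orP[/eqP ->|/old bA].
  rewrite mulrC; apply: (acts_le mT' (leq_addl _ _)).
  exact: acts_mul mT' new.
by apply: (acts_le mT' (leq_addr _ _)); apply: acts_mul mT' bA.
Qed.

End Growth.

(** * Polynomials of bounded degree in finitely many functions *)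

Inductive polyle (A : seq K) : nat -> K -> Prop :=
| polyle_const c : polyle A 0 (sc c)
| polyle_mul M a u : a \in A -> polyle A M u -> polyle A M.+1 (a * u)
| polyle_lin M c u v : polyle A M u -> polyle A M v -> polyle A M (sc c * u + v)
| polyle_S M u : polyle A M u -> polyle A M.+1 u.

Lemma polyle_le A M N u : (M <= N)%N -> polyle A M u -> polyle A N u.
Proof.
by move=> /subnK <-; elim: (N - M)%N => // n IH /IH; rewrite addSn; exact: polyle_S.
Qed.

Lemma polyle_const_le A M c : polyle A M (sc c).
Proof. by apply: (@polyle_le _ 0); [|exact: polyle_const]. Qed.

Lemma polyleM A M N u v : polyle A M u -> polyle A N v -> polyle A (M + N) (u * v).
Proof.
move=> Mu Nv; elim: Mu => [c|{}M a {}u aA _ IH|{}M c u1 u2 _ IH1 _ IH2|{}M {}u _ IH].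
- rewrite -[_ * _]addr0 -(rmorph0 sc); apply: polyle_lin => //.
  exact: polyle_const_le.
- by rewrite -mulrA; exact: polyle_mul.
- by rewrite mulrDl -mulrA; exact: polyle_lin.
- exact: polyle_S.
Qed.

Lemma polyleX A a n : a \in A -> polyle A n (a ^+ n).
Proof.
move=> aA; elim: n => [|n IH]; first by rewrite expr0 -(rmorph1 sc); exact: polyle_const.
by rewrite exprS; exact: polyle_mul.
Qed.

Lemma polyle_lin_closed A M : lin_closed (polyle A M).
Proof.
split; first by rewrite -(rmorph0 sc); exact: polyle_const_le.
by move=> c u v; exact: polyle_lin.
Qed.

Lemma polyle_sub A B M u : {subset A <= B} -> polyle A M u -> polyle B M u.
Proof.
move=> AB; elim=> [c|{}M a {}u aA _ IH|{}M c u1 u2 _ IH1 _ IH2|{}M {}u _ IH].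
- exact: polyle_const.
- by apply: polyle_mul => //; exact: AB.
- exact: polyle_lin.
- exact: polyle_S.
Qed.

(** C^M clears the denominators of every polynomial of degree at most M in A and carries it into
    level g M of the filtration, whose dimension is linear in M. *)
Lemma polyle_growth (z : K) (A : seq K) : transc z ->
  (forall a, a \in A -> alg_over z a) ->
  exists c, forall M m, dimge (polyle A M) m -> (m <= c * M.+1)%N.
Proof.
move=> tz /(growth tz)[T [D [h [C [mT C0 AT]]]]].
(* One more degree costs [h] if a factor from A absorbs the new factor C, and [size C] if C is
   merely multiplied in. *)
pose g := (h + size C)%N.
have polyT M u : polyle A M u -> T (g * M)%N (peval z C ^+ M * u).
  elim=> {M u} [c|M a u aA _ IH|M c u v _ IHu _ IHv|M u _ IH].
  - rewrite expr0 mul1r muln0 -[sc c]mulr1; apply: lin_closedZ (mf_lin mT _) _.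
    exact: mf_1 mT.
  - rewrite mulnS addnC exprS.
    have -> : peval z C * peval z C ^+ M * (a * u) =
      peval z C * a * (peval z C ^+ M * u) by ring.
    rewrite addnA; apply: (mf_le mT (leq_addr _ _)); exact: AT.
  - rewrite mulrDr mulrCA; exact: (mf_lin mT _).2.
  - rewrite exprS -mulrA mulnS addnC.
    apply: mf_poly mT _ _ _ _ _ IH; apply: leqW; exact: leq_addl.
exists (D * g.+1)%N => M m dm.
have {}dm : dimge (T (g * M)%N) m.
  apply: dimge_mul dm; last exact: polyT.
  by rewrite expf_neq0 //; apply: contraNneq C0 => /tz ->.
have [I [s [cI Ts]]] := mf_dim mT (g * M)%N.
apply: leq_trans (dimge_span Ts dm) _; rewrite cI -mulnA leq_mul2l; apply/orP; right.
nia.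
Qed.

(** The monomials p^i f^j with i, j < l number l^2 but lie in a space of dimension O(l), so some
    k-linear relation holds between them. *)
Lemma alg_over_pair (z p f : K) : transc z -> (forall a, alg_over z a) ->
  alg_over p f.
Proof.
move=> tz zK; have [|c cP] := @polyle_growth z [:: p; f] tz; first by move=> a _; exact: zK.
(* Large enough for l^2 > c (2 l + 1). *)
pose l := (3 * c).+1.
pose w (ij : 'I_l * 'I_l) := p ^+ ij.1 * f ^+ ij.2.
have : ~ indep w.
  move=> iw; have : (l * l <= c * (l + l).+1)%N; last by rewrite /l; nia.
  apply: cP; have <- : #|{: 'I_l * 'I_l}| = (l * l)%N by rewrite card_prod !card_ord.
  apply: dimge_fin iw => -[i j]; rewrite /w /=.
  apply: (@polyle_le _ (i + j)); first by apply: leq_add; exact: ltnW.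
  by apply: polyleM; apply: polyleX; rewrite !inE eqxx ?orbT.
move=> /existsNP[a] /not_implyP[a0] /existsNP[[i0 j0]] /eqP aij.
pose Q : {poly {poly k}} := \poly_(j < l) \poly_(i < l) a (inord i, inord j).
have QE (i j : 'I_l) : Q`_j`_i = a (i, j).
  by rewrite /Q coef_poly ltn_ord coef_poly ltn_ord !inord_val.
exists Q.
  by apply: contraNneq aij => Q0; rewrite -QE Q0 !coef0.
have sQ : (size (map_poly (peval p) Q) <= l)%N.
  by apply: leq_trans (size_poly _ _) (size_poly _ _).
rewrite (horner_coef_wide _ sQ) -[RHS]a0.
transitivity (\sum_(j < l) \sum_(i < l) sc (a (i, j)) * (p ^+ i * f ^+ j)).
  apply: eq_bigr => j _; rewrite coef_map_id0; last exact: peval0.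
  rewrite -/(peval p _) (@pevalE _ _ l); last by rewrite coef_poly ltn_ord size_poly.
  by rewrite mulr_suml; apply: eq_bigr => i _; rewrite QE mulrA.
by rewrite exchange_big pair_bigA /=; apply: eq_bigr => -[].
Qed.

Lemma common_denominator (Y : seq K) (s : seq K) :
  (forall w, exists M u v, [/\ polyle Y M u, polyle Y M v, v != 0 & w = u / v]) ->
  exists M v, [/\ polyle Y M v, v != 0 & forall w, w \in s -> polyle Y M (v * w)].
Proof.
move=> genY; elim: s => [|w s [M [v [Mv v0 sv]]]].
  by exists 0%N, 1; split=> //; [rewrite -(rmorph1 sc); exact: polyle_const|exact: oner_neq0].
have [N [u [t [Nu Nt t0 ->]]]] := genY w.
exists (M + N)%N, (v * t); split; [exact: polyleM|by rewrite mulf_neq0|].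
move=> w'; rewrite inE => /orP[/eqP ->|/sv Mw'].
  by rewrite -mulrA [t * _]mulrC divfK //; exact: polyleM.
by rewrite mulrAC; exact: polyleM.
Qed.

(** After multiplication by a common denominator of degree M, the m l products w_i f^j with j < l
    have degree at most M + l in f and Y. Growth of slope c then forces m <= c. *)
Lemma indepX_bound (z : K) (Y : seq K) (f : K) : transc z -> (forall a, alg_over z a) ->
  (forall w, exists M u v, [/\ polyle Y M u, polyle Y M v, v != 0 & w = u / v]) ->
  exists c, forall m (w : 'I_m -> K), indepX f w -> (m <= c)%N.
Proof.
move=> tz zK genY; have [|c cP] := @polyle_growth z (f :: Y) tz.
  by move=> a _; exact: zK.
exists c => m w iw.
have [M [v [_ v0 Mw]]] := common_denominator (codom w) genY.
have grow l : (m * l <= c * (M + l).+1)%N.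
  apply: cP; have <- : #|{: 'I_m * 'I_l}| = (m * l)%N by rewrite card_prod !card_ord.
  apply: dimge_fin (indep_mul v0 (indepX_pow (l := l) iw)) => -[i j] /=.
  rewrite mulrA; apply: polyleM.
    apply: (@polyle_sub Y); last by apply: Mw; exact: codom_f.
    by move=> y; rewrite inE orbC => ->.
  by apply: polyle_le (ltnW (ltn_ord j)) _; apply: polyleX; rewrite inE eqxx.
rewrite leqNgt; apply/negP => cm.
(* For m > c the inequality m l <= c l + c (M + 1) fails as soon as l > c (M + 1). *)
have := grow (c * M.+1).+1; nia.
Qed.

End LinearAlgebra.

(** * Local rings of the curve *)

Section LocalRings.
Context (k : fieldType) (X : projective_variety k).
Local Notation K := (ratf X).
Local Notation sc := (Defs.scalar X).
Local Notation pt := (closed_point X).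
Local Notation ring_of := (@local_ring k X).
Local Notation ideal := (@local_ideal k X).
Local Notation poly := (mpoly (pdim X).+1 k).

Lemma ev_genD (F G : poly) : eval_gen (F + G) = eval_gen F + eval_gen G.
Proof. exact: raddfD. Qed.
Lemma ev_genB (F G : poly) : eval_gen (F - G) = eval_gen F - eval_gen G.
Proof. exact: raddfB. Qed.
Lemma ev_genM (F G : poly) : eval_gen (F * G) = eval_gen F * eval_gen G.
Proof. by rewrite /eval_gen rmorphM. Qed.
Lemma ev_genC (c : k) : eval_gen (mpolyC (pdim X).+1 c) = sc c.
Proof. by rewrite /eval_gen mmapC. Qed.

Lemma point_ev_neq0 (x : pt) (d : nat) (F : poly) :
  F \is ishomog1 d mdeg -> ~ ideal_of x F -> eval_gen F != 0.
Proof.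
by move=> hF nF; apply/eqP => F0; apply: nF; exact: (point_on (closed_is_point x) hF F0).
Qed.

Lemma point_homogM (d e : nat) (F G : poly) : F \is ishomog1 d mdeg ->
  G \is ishomog1 e mdeg -> F * G \is ishomog1 (d + e) mdeg.
Proof. exact: dhomogM. Qed.

Lemma ev_quot_ring (x : pt) (d : nat) (F G : poly) : F \is ishomog1 d mdeg ->
  G \is ishomog1 d mdeg -> ~ ideal_of x G -> ring_of x (eval_gen F / eval_gen G).
Proof. by move=> hF hG nG; exists d, F, G. Qed.

Lemma local_ringD (x : pt) f g : ring_of x f -> ring_of x g -> ring_of x (f + g).
Proof.
move=> [d [F [G [hF hG nG ->]]]] [e [F' [G' [hF' hG' nG' ->]]]].
exists (d + e)%N, (F * G' + F' * G), (G * G'); split.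
- apply: rpredD; first exact: point_homogM.
  by rewrite addnC; exact: point_homogM.
- exact: point_homogM.
- by case/(point_prime (closed_is_point x)).
- by rewrite ev_genD !ev_genM addf_div // ?(point_ev_neq0 hG nG) ?(point_ev_neq0 hG' nG').
Qed.

Lemma local_ringM (x : pt) f g : ring_of x f -> ring_of x g -> ring_of x (f * g).
Proof.
move=> [d [F [G [hF hG nG ->]]]] [e [F' [G' [hF' hG' nG' ->]]]].
exists (d + e)%N, (F * F'), (G * G'); split; [exact: point_homogM..| |].
- by case/(point_prime (closed_is_point x)).
- by rewrite !ev_genM mulf_div.
Qed.

Lemma ideal_of1 (x : pt) : ~ ideal_of x 1.
Proof.
move=> x1; have [i] := point_relevant (closed_is_point x); apply.
by rewrite -[mpolyX _ _]mulr1; exact: (pointM (closed_is_point x)).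
Qed.

Lemma local_ring_sc (x : pt) c : ring_of x (sc c).
Proof.
exists 0%N, (mpolyC (pdim X).+1 c), 1; split.
- by rewrite -[mpolyC _ _]mulr1 mul_mpolyC; apply: rpredZ; exact: dhomog1.
- exact: dhomog1.
- exact: ideal_of1.
- by rewrite ev_genC /eval_gen rmorph1 divr1.
Qed.

Lemma local_ideal_sub (x : pt) f : ideal x f -> ring_of x f.
Proof. by move=> [d [F [G [[hF _] hG nG ->]]]]; exists d, F, G. Qed.

Lemma local_ring0 (x : pt) : ring_of x 0.
Proof. by rewrite -(rmorph0 sc); exact: local_ring_sc. Qed.

Lemma local_ring1 (x : pt) : ring_of x 1.
Proof. by rewrite -(rmorph1 sc); exact: local_ring_sc. Qed.

Lemma local_ringN (x : pt) f : ring_of x f -> ring_of x (- f).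
Proof.
by move=> xf; rewrite -mulN1r; apply: local_ringM => //; rewrite -(rmorphN1 sc); exact: local_ring_sc.
Qed.

Lemma local_idealM (x : pt) f g : ring_of x f -> ideal x g -> ideal x (f * g).
Proof.
move=> [d [F [G [hF hG nG ->]]]] [e [F' [G' [[hF' xF'] hG' nG' ->]]]].
exists (d + e)%N, (F * F'), (G * G'); split; [|exact: point_homogM| |].
- split; [exact: point_homogM|exact: (pointM (closed_is_point x))].
- by case/(point_prime (closed_is_point x)).
- by rewrite !ev_genM mulf_div.
Qed.

Lemma local_idealD (x : pt) f g : ideal x f -> ideal x g -> ideal x (f + g).
Proof.
move=> [d [F [G [[hF xF] hG nG ->]]]] [e [F' [G' [[hF' xF'] hG' nG' ->]]]].
exists (d + e)%N, (F * G' + F' * G), (G * G'); split.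
- split.
    apply: rpredD; first exact: point_homogM.
    by rewrite addnC; exact: point_homogM.
  by apply: (pointD (closed_is_point x)); rewrite mulrC; apply: (pointM (closed_is_point x)).
- exact: point_homogM.
- by case/(point_prime (closed_is_point x)).
- by rewrite ev_genD !ev_genM addf_div // ?(point_ev_neq0 hG nG) ?(point_ev_neq0 hG' nG').
Qed.

Lemma local_ideal_proper (x : pt) : ~ ideal x 1.
Proof.
move=> [d [F [G [[hF xF] hG nG FG]]]].
have G0 := point_ev_neq0 hG nG; apply: nG.
have e0 : eval_gen (G - F) = 0.
  by rewrite ev_genB -[X in X - _]mul1r FG divfK // subrr.
rewrite -[G](subrK F); apply: (pointD (closed_is_point x)) => //.
by apply: (point_on (closed_is_point x) (d := d)) e0; exact: rpredB.
Qed.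

Lemma local_ring_unit (x : pt) f : ring_of x f -> ~ ideal x f ->
  [/\ f != 0, ring_of x f^-1 & ~ ideal x f^-1].
Proof.
move=> xf nf.
have f0 : f != 0.
  apply/eqP => f0; apply: nf; rewrite f0.
  exists 0%N, 0, 1; split; [split; [exact: rpred0|exact: point0 (closed_is_point x)]|
    exact: dhomog1|exact: ideal_of1|by rewrite /eval_gen rmorph0 mul0r].
have xf' : ring_of x f^-1.
  case: xf nf => d [F [G [hF hG nG ->]]] nf; exists d, G, F; split=> //.
    by move=> xF; apply: nf; exists d, F, G.
  by rewrite invf_div.
split=> // /(local_idealM xf); rewrite divff //; exact: local_ideal_proper.
Qed.

(** Numerator and denominator of common degree d are both divided by the d-th power of a coordinate
    that does not vanish at x. *)
Lemma frac_quot (x : pt) f : exists g h, [/\ ring_of x g, ring_of x h, h != 0 & f = g / h].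
Proof.
have [d [F [G [hF hG G0 ->]]]] := gen_ratf f.
have [i nT] := point_relevant (closed_is_point x).
have hT : mpolyX k (mnm1 i) ^+ d \is @ishomog1 (pdim X).+1 k d mdeg.
  by rewrite -[in X in ishomog1 X](mul1n d); apply: dhomogMn; rewrite dhomogX; apply/eqP; exact: mdeg1.
have nTd : ~ ideal_of x (mpolyX k (mnm1 i) ^+ d).
  elim: {hT F G hF hG G0} d => [|d IH]; first by rewrite expr0; exact: ideal_of1.
  by rewrite exprS => /(point_prime (closed_is_point x))[].
have T0 := point_ev_neq0 hT nTd.
exists (eval_gen F / eval_gen (mpolyX k (mnm1 i) ^+ d)),
  (eval_gen G / eval_gen (mpolyX k (mnm1 i) ^+ d)).
split; [exact: ev_quot_ring hF hT nTd|exact: ev_quot_ring hG hT nTd| |].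
- by rewrite mulf_neq0 ?invr_eq0.
- by rewrite -/(eval_gen F) -/(eval_gen G) invf_div mulrA divfK.
Qed.

Lemma closed_point_eq (x y : pt) : ideal_of x = ideal_of y -> x = y.
Proof.
case: x y => [P p1 p2] [Q q1 q2] /= PQ; subst Q.
by rewrite (Prop_irrelevance p1 q1) (Prop_irrelevance p2 q2).
Qed.

Lemma homog_sub (x y : pt) :
  (forall F d, F \is ishomog1 d mdeg -> ideal_of x F -> ideal_of y F) -> y = x.
Proof.
move=> xy; apply: closed_point_eq; apply: closed_max => [|F xF]; first exact: closed_is_point.
rewrite (@pihomog_partitionE _ _ mdeg _ F (leqnn _)).
apply: (big_ind (ideal_of y)) => [|F1 F2|d _]; first exact: (point0 (closed_is_point y)).
  exact: (pointD (closed_is_point y)).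
apply: (xy _ d); first exact: pihomogP.
exact: (point_homog (closed_is_point x)).
Qed.

(** If the ring at x lay in the ring at y, a form F vanishing at y but not at x would give G / F
    regular at y and F / G in the maximal ideal there, with product 1. So every form vanishing at y
    vanishes at x, and maximality gives x = y. *)
Lemma local_ring_not_sub (x y : pt) : x <> y -> exists2 f, ring_of x f & ~ ring_of y f.
Proof.
move=> xy; apply: contrapT => nf; apply: xy.
have {nf}sub f : ring_of x f -> ring_of y f.
  by move=> xf; apply: contrapT => yf; apply: nf; exists f.
have [i nTx] := point_relevant (closed_is_point x).
have [j nTy] := point_relevant (closed_is_point y).
have hT l : mpolyX k (mnm1 l) \is @ishomog1 (pdim X).+1 k 1 mdeg.
  by rewrite dhomogX; apply/eqP; exact: mdeg1.
have contra d (F G : poly) : F \is ishomog1 d mdeg -> G \is ishomog1 d mdeg ->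
    ~ ideal_of x F -> ideal_of y F -> ~ ideal_of y G -> False.
  move=> hF hG nF yF nG; apply: (@local_ideal_proper y).
  have F0 := point_ev_neq0 hF nF; have G0 := point_ev_neq0 hG nG.
  rewrite (_ : 1 = (eval_gen G / eval_gen F) * (eval_gen F / eval_gen G)); last first.
    by rewrite mulrA divfK // divff.
  apply: local_idealM; first by apply: sub; exact: ev_quot_ring hG hF nF.
  by exists d, F, G.
have nTiy : ~ ideal_of y (mpolyX k (mnm1 i)).
  by move=> yT; apply: (contra _ _ _ (hT i) (hT j)).
apply: homog_sub => F d hF yF; apply: contrapT => nF.
apply: (contra d F (mpolyX k (mnm1 i) ^+ d)) => //.
  by rewrite -[in X in ishomog1 X](mul1n d); exact: dhomogMn.
elim: {hF} d => [|d IH]; first by rewrite expr0; exact: ideal_of1.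
by rewrite exprS => /(point_prime (closed_is_point y))[].
Qed.

Lemma gen_polyle (w : K) : exists M u v, [/\ polyle sc (codom (@gen k X)) M u,
  polyle sc (codom (@gen k X)) M v, v != 0 & w = u / v].
Proof.
have evP F : exists M, polyle sc (codom (@gen k X)) M (eval_gen F).
  exists (msize F); rewrite /eval_gen (mmapE _ (leqnn _)).
  have [P0 PD] := polyle_lin_closed sc (codom (@gen k X)) (msize F).
  apply: big_ind => [||m _] //.
    by move=> u v Pu Pv; rewrite -[u]mul1r -(rmorph1 sc); exact: PD.
  apply: lin_closedZ => //; apply: (@polyle_le _ _ _ _ (mdeg m)); first exact/ltnW/bmdeg.
  rewrite /mmap1 mdegE; elim/big_rec2: _ => [|i n u _ Pu].
    by rewrite -(rmorph1 sc); exact: polyle_const.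
  by apply: polyleM => //; apply: polyleX; exact: codom_f.
have [d [F [G [_ _ G0 ->]]]] := gen_ratf w.
have [[M FM] [N GN]] := (evP F, evP G).
exists (M + N)%N, (eval_gen F), (eval_gen G); split=> //.
  exact: polyle_le (leq_addr _ _) FM.
exact: polyle_le (leq_addl _ _) GN.
Qed.

Lemma curve_transc : is_curve X -> exists2 z, transc sc z & forall a, alg_over sc z a.
Proof.
move=> [z [nz zK]]; exists z => [q q0|]; last exact: zK.
apply: contrapT => /eqP q1; apply: nz; exists q => //; exact/rootP.
Qed.

Context (X_curve : is_curve X) (X_regular : is_regular X).

Definition unif (x : pt) : K := projT1 (cid (X_regular x)).

Lemma unifP (x : pt) : uniformizer x (unif x).
Proof. exact: projT2 (cid (X_regular x)). Qed.

Lemma alg_pair (p f : K) : alg_over sc p f.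
Proof. by have [z tz zK] := curve_transc X_curve; exact: alg_over_pair tz zK. Qed.

Definition unit_of (x : pt) (a : K) : Prop := ring_of x a /\ ~ ideal x a.

Lemma unit_ofM x a b : unit_of x a -> unit_of x b -> unit_of x (a * b).
Proof.
move=> [xa na] [xb nb]; split; first exact: local_ringM.
have [a0 xa' _] := local_ring_unit xa na.
by move=> /(local_idealM xa'); rewrite mulKf.
Qed.

Lemma unit_of_sc x c : c != 0 -> unit_of x (sc c).
Proof.
move=> c0; split; first exact: local_ring_sc.
move=> /(local_idealM (local_ring_sc x c^-1)).
by rewrite -rmorphM mulVf // rmorph1; exact: local_ideal_proper.
Qed.

Lemma unit_ofV x a : unit_of x a -> unit_of x a^-1.
Proof. by move=> [xa na]; have [] := local_ring_unit xa na. Qed.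

Lemma unit_of_neq0 x a : unit_of x a -> a != 0.
Proof. by move=> [xa na]; have [] := local_ring_unit xa na. Qed.

Lemma unit_of1 x : unit_of x 1.
Proof. by rewrite -(rmorph1 sc); apply: unit_of_sc; exact: oner_neq0. Qed.

(** Once the largest power of X is factored out of q, a nonzero constant term remains, and a nonzero
    constant plus an element of the maximal ideal is a unit. *)
Lemma peval_unif x p (q : {poly k}) : ideal x p -> q != 0 ->
  exists (e : nat) a, unit_of x a /\ peval sc p q = a * p ^+ e.
Proof.
move=> xp; elim/poly_ind: q => [|q c IH qc]; first by rewrite eqxx.
rewrite pevalD pevalM pevalX pevalC.
have xpol q' : ring_of x (peval sc p q').
  elim/poly_ind: q' => [|q' c' IH']; first by rewrite peval0; exact: local_ring0.
  rewrite pevalD pevalM pevalX pevalC; apply: local_ringD; last exact: local_ring_sc.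
  by apply: local_ringM => //; exact: local_ideal_sub.
have [c0|c0] := eqVneq c 0; last first.
  exists 0%N, (peval sc p q * p + sc c); rewrite mulr1; split=> //.
  have xqp : ideal x (peval sc p q * p) by exact: local_idealM.
  have [xc nc] := unit_of_sc x c0; split; first by apply: local_ringD => //; exact: local_ideal_sub.
  move=> /local_idealD /(_ (local_idealM (local_ringN (local_ring1 x)) xqp)).
  by rewrite mulN1r addrAC subrr add0r.
have [|e [a [xa ->]]] := IH.
  by apply: contraNneq qc => ->; rewrite c0 mul0r add0r.
by exists e.+1, a; rewrite c0 rmorph0 addr0 exprSr mulrA.
Qed.

(** Krull's intersection theorem through algebraicity. Otherwise f is divisible by every power of p.
    Take a relation Q(p, f) = 0, divided by f until its constant term is nonzero: that term is a
    unit times p^e, while the other terms are divisible by f, hence by p^(e+1). *)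
Lemma uniformizer_exp x p f : uniformizer x p -> p != 0 -> f != 0 -> ring_of x f ->
  exists (n : nat) a, unit_of x a /\ f = a * p ^+ n.
Proof.
move=> [xp pP] p0 f0 xf; apply: contrapT => nf.
have div n : exists2 a, ring_of x a & f = a * p ^+ n.
  elim: n => [|n [a xa fa]]; first by exists f => //; rewrite mulr1.
  have [/pP[b xb ab]|na] := pselect (ideal x a).
    by exists b => //; rewrite fa ab exprS mulrA.
  by exfalso; apply: nf; exists n, a.
have [Q Q0] := alg_pair p f.
have [ev evE] : exists ev : {rmorphism {poly k} -> K}, forall q, ev q = peval sc p q.
  by exists (horner_eval p \o map_poly sc).
rewrite -(eq_map_poly evE).
have evX (q : {poly {poly k}}) c :
    (map_poly ev (q * 'X + c%:P)).[f] = (map_poly ev q).[f] * f + peval sc p c.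
  rewrite rmorphD rmorphM /= map_polyX map_polyC hornerMXaddC.
  by congr (_ + _); exact: evE.
have ringQ (q : {poly {poly k}}) : ring_of x (map_poly ev q).[f].
  elim/poly_ind: q => [|q c IH]; first by rewrite rmorph0 horner0; exact: local_ring0.
  rewrite evX.
  apply: local_ringD; first exact: local_ringM.
  have [c0|c0] := eqVneq c 0; first by rewrite c0 peval0; exact: local_ring0.
  have [e [a [xa ->]]] := peval_unif xp c0.
  apply: local_ringM; first exact: xa.1.
  elim: e => [|e IHe]; first exact: local_ring1.
  by rewrite exprS; apply: local_ringM => //; exact: local_ideal_sub.
elim/poly_ind: Q Q0 => [|Q c IH Qc]; first by rewrite eqxx.
rewrite evX => /eqP.
have [c0|c0] := eqVneq c 0.
  rewrite c0 peval0 addr0 mulf_eq0 (negPf f0) orbF => /eqP; apply: IH.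
  by apply: contraNneq Qc => ->; rewrite c0 mul0r add0r.
have [e [a [xa ea]]] := peval_unif xp c0.
rewrite addrC addr_eq0 ea => /eqP.
have [b xb fb] := div e.+1; rewrite [X in - (_ * X)]fb.
rewrite exprS !mulrA -mulNr => /(mulIf (expf_neq0 e p0)) /esym aE.
apply: xa.2; rewrite -aE -mulNr; apply: local_idealM => //.
by apply: local_ringN; exact: local_ringM.
Qed.

Lemma uniformizer_frac x p f : uniformizer x p -> p != 0 -> f != 0 ->
  exists (n : int) a, unit_of x a /\ f = a * p ^ n.
Proof.
move=> up p0 f0; have [g [h [xg xh h0 fE]]] := frac_quot x f.
have g0 : g != 0 by apply: contraNneq f0 => g0; rewrite fE g0 mul0r.
have [m [a [xa gE]]] := uniformizer_exp up p0 g0 xg.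
have [n [b [xb hE]]] := uniformizer_exp up p0 h0 xh.
exists (m%:Z - n%:Z), (a / b); split; first by apply: unit_ofM => //; exact: unit_ofV.
by rewrite fE gE hE expfzDr // -exprnP -exprnN invfM; ring.
Qed.

(** Two uniformizers differ by a unit. This makes [ord] independent of the choice hidden in
    [xget]. *)
Lemma uniformizer_uniq x p q a b (m n : int) : uniformizer x p -> uniformizer x q ->
  p != 0 -> unit_of x a -> unit_of x b -> a * p ^ m = b * q ^ n -> m = n.
Proof.
move=> [xp pP] [xq qP] p0 xa xb.
have [u xu qE] := pP _ xq; have [v xv pE] := qP _ xp.
have uv : v * u = 1 by apply: (mulIf p0); rewrite mul1r {2}pE qE mulrA.
have uu : unit_of x u.
  by split=> // /(local_idealM xv); rewrite uv; exact: local_ideal_proper.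
have u0 := unit_of_neq0 uu.
have unit_exp c (i : int) : unit_of x c -> unit_of x (c ^ i).
  have nat_exp c' (j : nat) : unit_of x c' -> unit_of x (c' ^+ j).
    move=> xc; elim: j => [|j IH]; first exact: unit_of1.
    by rewrite exprS; exact: unit_ofM.
  move=> xc; case: i => i; first exact: nat_exp.
  by rewrite NegzE -exprz_inv; apply: nat_exp; exact: unit_ofV.
have gt (i : int) w : 0 < i -> unit_of x w -> p ^ i = w -> False.
  case: i => [[|i]|//] // _ [xw nw] pw; apply: nw.
  rewrite -pw -exprnP exprSr; apply: local_idealM => //.
  elim: i {pw} => [|i IH]; first exact: local_ring1.
  by rewrite exprS; apply: local_ringM => //; exact: local_ideal_sub.
have xw := unit_ofM (unit_ofM xb (unit_ofV xa)) (unit_exp _ n uu).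
rewrite qE expfzMl => E.
have {}E : p ^ (m - n) = b / a * u ^ n.
  rewrite expfzDr // -invr_expz; apply: (mulfI (unit_of_neq0 xa)).
  rewrite mulrA E; field; rewrite ?expfz_neq0 ?(unit_of_neq0 xa) //.
have [mn|mn|//] := ltgtP m n; last first.
  by exfalso; apply: gt xw E; rewrite subr_gt0.
exfalso; apply: (gt (n - m) _ _ (unit_ofV xw)); first by rewrite subr_gt0.
by rewrite -E invr_expz opprB.
Qed.

End LocalRings.

(** * Orders, divisors and Riemann's inequality *)

Section Valuations.
Context (k : fieldType) (X : projective_variety k).
Local Notation K := (ratf X).
Local Notation sc := (Defs.scalar X).
Local Notation pt := (closed_point X).
Local Notation ring_of := (@local_ring k X).
Local Notation ideal := (@local_ideal k X).
Context (X_curve : is_curve X) (X_regular : is_regular X).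

Definition regular_fun : set K := [set f | f = 0 \/ f != 0 /\ forall x : pt, 0 <= ord x f].

(* Stands in for properness: it excludes a degenerate closed point and, below,
   forces every principal divisor to have degree 0. *)
Context (r0 : nat) (regular_fin : forall m, dimge sc regular_fun m -> (m <= r0)%N).

Local Notation unif := (unif X_regular).

(** A zero uniformizer would make the maximal ideal at x zero. Then x lies below every closed point,
    so it is the only one, and all orders vanish because f = a 0^n is nonzero only for n = 0. Every
    function would be regular, and the powers of a transcendental z contradict [regular_fin]. *)
Lemma unif_neq0 (x : pt) : unif x != 0.
Proof.
apply/eqP => p0; have [_] := unifP X_regular x; rewrite p0 => pP.
have only (y : pt) : y = x.
  apply: homog_sub => F d hF xF.
  have [i nT] := point_relevant (closed_is_point x).
  have hT : mpolyX k (mnm1 i) ^+ d \is @ishomog1 (pdim X).+1 k d mdeg.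
    by rewrite -[in X in ishomog1 X](mul1n d); apply: dhomogMn; rewrite dhomogX; apply/eqP; exact: mdeg1.
  have nTd : ~ ideal_of x (mpolyX k (mnm1 i) ^+ d).
    elim: {hT F hF xF} d => [|d IH]; first by rewrite expr0; exact: ideal_of1.
    by rewrite exprS => /(point_prime (closed_is_point x))[].
  have T0 := point_ev_neq0 hT nTd.
  have [|a _] := pP (eval_gen F / eval_gen (mpolyX k (mnm1 i) ^+ d)).
    by exists d, F, (mpolyX k (mnm1 i) ^+ d).
  rewrite mulr0 => /eqP; rewrite mulf_eq0 invr_eq0 (negPf T0) orbF => /eqP F0.
  exact: (point_on (closed_is_point y) hF F0).
have ord0 (f : K) (y : pt) : f != 0 -> ord y f = 0.
  move=> f0; rewrite /ord; case: xgetP => // n _ [p [a [[xp _] _ _ fE]]].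
  move: xp; rewrite (only y) => /pP[b _]; rewrite mulr0 => p00.
  apply/eqP; apply: contraNT f0 => n0.
  by rewrite fE p00 exp0rz (negPf n0) mulr0.
have [z tz _] := curve_transc X_curve.
have : (r0.+1 <= r0)%N; last by rewrite ltnn.
apply: regular_fin; exists (fun i : 'I_r0.+1 => z ^+ i); split.
  move=> i; right; have zi : z ^+ i != 0 by rewrite expf_neq0 // (transc_neq0 tz).
  by split=> // y; rewrite ord0.
move=> c c0 i.
have /tz q0 : peval sc z (\poly_(j < r0.+1) c (inord j)) = 0.
  rewrite (@pevalE _ _ _ _ _ r0.+1) ?size_poly // -[RHS]c0.
  by apply: eq_bigr => j _; rewrite coef_poly ltn_ord inord_val.
have := congr1 (fun q : {poly k} => q`_i) q0.
by rewrite coef_poly ltn_ord inord_val coef0.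
Qed.

Lemma ord_eq (x : pt) a n : unit_of x a -> ord x (a * unif x ^ n) = n.
Proof.
move=> xa; rewrite /ord; case: xgetP => [m _ [p [b [up xb nb E]]]|/(_ n) /=]; last first.
  by case; exists (unif x), a; case: xa => xa na; split=> //; exact: unifP.
apply/esym; apply: uniformizer_uniq (unifP X_regular x) up (unif_neq0 x) xa _ E.
by split.
Qed.

Lemma ord_unit (x : pt) f : f != 0 ->
  exists2 a, unit_of x a & f = a * unif x ^ (ord x f).
Proof.
move=> f0; have [n [a [xa fE]]] := uniformizer_frac X_curve (unifP X_regular x) (unif_neq0 x) f0.
by exists a => //; rewrite {2}fE ord_eq.
Qed.

Lemma ord_expz x n : ord x (unif x ^ n) = n.
Proof. by rewrite -[_ ^ _]mul1r ord_eq //; exact: unit_of1. Qed.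

Lemma ord_unit0 (x : pt) a : unit_of x a -> ord x a = 0.
Proof. by move=> xa; rewrite -[a]mulr1 -(expr0z (unif x)) ord_eq. Qed.

Lemma ordM (x : pt) f g : f != 0 -> g != 0 -> ord x (f * g) = ord x f + ord x g.
Proof.
move=> /(ord_unit x)[a xa fE] /(ord_unit x)[b xb gE].
have -> : f * g = (a * b) * unif x ^ (ord x f + ord x g).
  by rewrite {1}fE {1}gE expfzDr ?unif_neq0 // mulrACA.
by rewrite ord_eq //; exact: unit_ofM.
Qed.

Lemma ord_sc (x : pt) c : c != 0 -> ord x (sc c) = 0.
Proof. by move=> c0; apply: ord_unit0; exact: unit_of_sc. Qed.

Lemma ordV (x : pt) f : f != 0 -> ord x f^-1 = - ord x f.
Proof.
move=> f0; have E : ord x (f^-1 * f) = 0 by rewrite mulVf // (ord_unit0 (unit_of1 x)).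
by move: E; rewrite ordM ?invr_eq0 // => /eqP; rewrite addr_eq0 => /eqP.
Qed.

Lemma ordX (x : pt) f n : f != 0 -> ord x (f ^+ n) = ord x f *+ n.
Proof.
move=> f0; elim: n => [|n IH]; first by rewrite expr0 (ord_unit0 (unit_of1 x)).
by rewrite exprS ordM ?expf_neq0 // IH mulrS.
Qed.

(* ord_x f >= n, or f = 0 *)
Definition vge (x : pt) (n : int) (f : K) : Prop := ring_of x (f * unif x ^ (- n)).

Lemma ring_ord (x : pt) f : f != 0 -> ring_of x f <-> 0 <= ord x f.
Proof.
move=> f0; have [a xa fE] := ord_unit x f0; split; last first.
  rewrite {2}fE; case: (ord x f) => // n _; apply: local_ringM; first exact: xa.1.
  rewrite -exprnP; elim: n => [|n IH]; first exact: local_ring1.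
  by rewrite exprS; apply: local_ringM => //; apply: local_ideal_sub; exact: (unifP _ _).1.
move=> xf; rewrite leNgt; apply/negP => lt0.
have [n nE] : exists n : nat, ord x f = - n.+1%:Z.
  by case: (ord x f) lt0 => // n _; exists n; rewrite NegzE.
apply: (@local_ideal_proper _ _ x).
suff -> : 1 = (a^-1 * f * unif x ^+ n) * unif x.
  apply: local_idealM; last exact: (unifP _ _).1.
  apply: local_ringM; first by apply: local_ringM => //; exact: (unit_ofV xa).1.
  elim: n {nE} => [|n IH]; first exact: local_ring1.
  by rewrite exprS; apply: local_ringM => //; apply: local_ideal_sub; exact: (unifP _ _).1.
rewrite {1}fE nE -mulrA -exprSr mulKf ?(unit_of_neq0 xa) //.
by rewrite exprnP -expfzDr ?unif_neq0 // addNr.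
Qed.

Lemma vgeP (x : pt) n f : f != 0 -> vge x n f <-> n <= ord x f.
Proof.
move=> f0; have p0 : unif x ^ (- n) != 0 by rewrite expfz_neq0 // unif_neq0.
rewrite /vge ring_ord ?mulf_neq0 // ordM // ord_expz.
by rewrite subr_ge0.
Qed.

Lemma vge0 x n : vge x n 0.
Proof. by rewrite /vge mul0r; exact: local_ring0. Qed.

Lemma vgeD x n f g : vge x n f -> vge x n g -> vge x n (f + g).
Proof. by rewrite /vge mulrDl; exact: local_ringD. Qed.

Lemma vge_ring x f : vge x 0 f <-> ring_of x f.
Proof. by rewrite /vge oppr0 expr0z mulr1. Qed.

Lemma vgeM x m n f g : vge x m f -> vge x n g -> vge x (m + n) (f * g).
Proof.
rewrite /vge opprD expfzDr ?unif_neq0 // => vf vg.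
by rewrite mulrACA; exact: local_ringM.
Qed.

Lemma vge_le x m n f : m <= n -> vge x n f -> vge x m f.
Proof.
have [->|f0] := eqVneq f 0; first by move=> *; exact: vge0.
by move=> mn /(vgeP x _ f0) nf; apply/(vgeP x _ f0); exact: le_trans nf.
Qed.

Lemma vge_sc x c : vge x 0 (sc c).
Proof. by apply/vge_ring; exact: local_ring_sc. Qed.

Lemma vge_lin_closed x n : lin_closed sc (vge x n).
Proof.
split=> [|c u v vu vv]; first exact: vge0.
by apply: vgeD => //; rewrite -[n]add0r; apply: vgeM => //; exact: vge_sc.
Qed.

Lemma ideal_vge x f : ideal x f <-> vge x 1 f.
Proof.
rewrite /vge exprN1; split=> [/(unifP _ _).2[a xa ->]|xf].
  by rewrite mulfK ?unif_neq0.
rewrite -[f](divfK (unif_neq0 x)); apply: local_idealM => //; exact: (unifP _ _).1.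
Qed.

Lemma ordD_lt (x : pt) f g : f != 0 -> g != 0 -> ord x f < ord x g ->
  f + g != 0 /\ ord x (f + g) = ord x f.
Proof.
move=> f0 g0 fg.
have s0 : f + g != 0.
  by apply: contraTneq fg => /eqP; rewrite addr_eq0 => /eqP ->; rewrite -mulN1r ordM ?oppr_eq0 ?oner_eq0 //
   -(rmorphN1 sc) ord_sc ?oppr_eq0 ?oner_eq0 // add0r ltxx.
split=> //; apply/eqP; rewrite eq_le; apply/andP; split; last first.
  apply/(vgeP _ _ s0); apply: vgeD; first exact/vgeP.
  by apply/vgeP => //; exact: ltW.
rewrite leNgt; apply/negP => lt.
have : vge x (ord x f + 1) f.
  rewrite -[X in vge _ _ X](addrK g); apply: vgeD; first by apply/vgeP => //; rewrite lezD1.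
  rewrite -mulN1r -[ord x f + 1]add0r; apply: vgeM; last by apply/vgeP => //; rewrite lezD1.
  by rewrite -(rmorphN1 sc); exact: vge_sc.
by move/(vgeP _ _ f0); rewrite lezD1 ltxx.
Qed.

Lemma ord_sep2 (x y : pt) : x <> y ->
  exists e, [/\ e != 0, 0 < ord x e & ord y e < 0].
Proof.
move=> xy; have [f xf yf] := local_ring_not_sub xy.
have [g yg xg] := local_ring_not_sub (not_eq_sym xy).
have f0 : f != 0 by apply/eqP => f0; apply: yf; rewrite f0; exact: local_ring0.
have g0 : g != 0 by apply/eqP => g0; apply: xg; rewrite g0; exact: local_ring0.
have {}yf : ord y f < 0 by rewrite ltNge; apply/negP => /(ring_ord y f0).
have {}xg : ord x g < 0 by rewrite ltNge; apply/negP => /(ring_ord x g0).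
move/(ring_ord x f0) : xf => xf; move/(ring_ord y g0) : yg => yg.
exists (f / g); split; first by rewrite mulf_neq0 ?invr_eq0.
  rewrite ordM ?invr_eq0 // ordV //; lia.
rewrite ordM ?invr_eq0 // ordV //; lia.
Qed.

Lemma ord_sep (x : pt) (s : seq pt) : x \notin s ->
  exists e, [/\ e != 0, 0 < ord x e & forall y, y \in s -> ord y e < 0].
Proof.
elim: s => [_|y s IH].
  by exists (unif x); split=> //; [exact: unif_neq0|rewrite -[unif x]expr1z ord_expz].
rewrite inE negb_or => /andP[/eqP xy /IH[e [e0 xe se]]].
have [ye|ye] := ltP (ord y e) 0.
  by exists e; split=> // y'; rewrite inE => /orP[/eqP ->|/se].
have [e' [e'0 xe' ye']] := ord_sep2 xy.
(* N exceeds every order of e on s in absolute value, so a negative order of e is never a multiple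
   of N. Hence the orders of e and e'^N differ on s and the sum keeps a pole there. *)
pose N := (1 + \sum_(y <- s) `|ord y e|)%N.
have NP y' : y' \in s -> (`|ord y' e| < N)%N.
  move=> sy; rewrite /N add1n ltnS.
  elim: s sy {IH se N} => // a s IH; rewrite inE big_cons => /orP[/eqP ->|/IH h]; first exact: leq_addr.
  exact: leq_trans h (leq_addl _ _).
have eN : e' ^+ N != 0 by rewrite expf_neq0.
have yN : ord y (e' ^+ N) < ord y e.
  by rewrite ordX //; apply: lt_le_trans ye; rewrite pmulrn_llt0.
have [s0 ys] := ordD_lt eN e0 yN.
exists (e' ^+ N + e); split=> //.
  suff : 1 <= ord x (e' ^+ N + e) by lia.
  apply/(vgeP x _ s0); apply: vgeD; apply/vgeP => //.
    have N0 : (0 < N)%N by [].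
    by rewrite ordX // -mulr_natr; nia.
move=> y'; rewrite inE => /orP[/eqP ->|sy].
  by rewrite ys ordX // pmulrn_llt0.
have := se _ sy; have := NP _ sy => Ny y'e.
have [lt|lt|E] := ltgtP (ord y' (e' ^+ N)) (ord y' e).
- by have [_ ->] := ordD_lt eN e0 lt; apply: lt_trans y'e.
- by rewrite addrC; have [_ ->] := ordD_lt e0 eN lt.
- exfalso; move: E; rewrite ordX // -mulr_natr.
  have : - N%:Z < ord y' e by lia.
  move: y'e; move: (ord y' e) (ord y' e') => w v w0 wN vN.
  have v0 : v <= -1 by rewrite leNgt; apply/negP => v1; nia.
  have : v * N%:R <= - N%:Z by rewrite natz; nia.
  by rewrite vN leNgt wN.
Qed.

(* The elements 1 / (1 + e), with e as in [ord_sep]. *)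
Lemma ord_approx (x : pt) (s : seq pt) (N : nat) : x \notin s ->
  exists e, [/\ e != 0, ord x e = 0 & forall y, y \in s -> N%:Z <= ord y e].
Proof.
move=> /ord_sep[e [e0 xe se]].
have one0 : (1 : K) != 0 by exact: oner_neq0.
have ord1 (y : pt) : ord y 1 = 0 by exact: (ord_unit0 (unit_of1 y)).
have [d0 xd] := ordD_lt (x := x) one0 e0 (etrans (congr1 (fun n => n < ord x e) (ord1 x)) xe).
have i0 : (1 + e)^-1 != 0 by rewrite invr_eq0.
exists ((1 + e)^-1 ^+ N); split; first by rewrite expf_neq0.
  by rewrite ordX // ordV // xd ord1 oppr0 mul0rn.
move=> y /se ye; rewrite ordX // ordV //.
have [|_] := ordD_lt (x := y) e0 one0; first by rewrite ord1.
rewrite addrC => ->; rewrite -mulr_natr; nia.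
Qed.

(** The constant terms of a relation over k[f] form a k-linear relation modulo J, since f A lies in
    J; they vanish, the relation is divided by f, and the sizes of its coefficients drop. *)
Lemma mod_indepX (I : finType) (A J : set K) (f : K) (w : I -> K) :
  f != 0 -> lin_closed sc A -> (forall a, A a -> A (f * a)) -> (forall a, A a -> J (- (f * a))) ->
  (forall i, A (w i)) ->
  (forall c : I -> k, J (\sum_i sc (c i) * w i) -> forall i, c i = 0) ->
  indepX sc f w.
Proof.
move=> f0 linA fA fJ Aw iw c c0.
have [n] : exists n, forall i, (size (c i) <= n)%N.
  by exists (\max_i size (c i)) => i; rewrite (leq_bigmax i).
elim: n c c0 => [|n IH] c c0 sc_n i.
  by apply/eqP; rewrite -size_poly_eq0 -leqn0.
pose c' i := drop_poly 1 (c i).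
have cE j : c j = c' j * 'X + ((c j)`_0)%:P.
  rewrite -[LHS](poly_take_drop 1) addrC; congr (_ + _).
  by apply/polyP => -[|l]; rewrite coef_take_poly coefC.
have Apol a q : A a -> A (peval sc f q * a).
  move=> Aa; elim/poly_ind: q => [|q d IHq]; first by rewrite peval0 mul0r; exact: linA.1.
  rewrite pevalD pevalM pevalX pevalC mulrDl -mulrA mulrCA.
  apply: (lin_closedD linA); [exact: fA|exact: lin_closedZ linA Aa].
pose s := \sum_j peval sc f (c' j) * w j.
have As : A s.
  by apply: (big_ind A) => [|u v Au Av|j _]; [exact: linA.1|exact: lin_closedD linA Au Av|exact: Apol].
have sumE : f * s + \sum_j sc (c j)`_0 * w j = 0.
  rewrite -[RHS]c0 mulr_sumr -big_split; apply: eq_bigr => j _ /=.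
  by rewrite [in RHS]cE pevalD pevalM pevalX pevalC; ring.
have d0 j : (c j)`_0 = 0.
  apply: (iw (fun j => (c j)`_0)); move: sumE => /eqP; rewrite addrC addr_eq0 => /eqP ->.
  exact: fJ.
rewrite cE d0 addr0 (IH c') ?mul0r //.
  apply: (mulfI f0); rewrite mulr0 -[RHS]sumE -/s big1 ?addr0 // => j _.
  by rewrite d0 rmorph0 mul0r.
by move=> j; rewrite size_drop_poly leq_subLR.
Qed.

Lemma indepX_fin (f : K) : exists c, forall m (w : 'I_m -> K), indepX sc f w -> (m <= c)%N.
Proof.
have [z tz zK] := curve_transc X_curve.
exact: indepX_bound tz zK (@gen_polyle _ X).
Qed.

(** The residue field is finite over k: families independent modulo the maximal ideal are
    independent over k[unif], so their sizes are bounded, and one of maximal size is a basis. Thus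
    [residue_degree] never takes its default value. *)
Lemma residue_basis (x : pt) :
  exists e : 'I_(residue_degree x) -> K, is_basis_mod (ring_of x) (ideal x) e.
Proof.
rewrite /residue_degree; case: xgetP => [d _ //|no].
pose P d := exists e : 'I_d -> K, (forall i, ring_of x (e i)) /\
  forall c : 'I_d -> k, ideal x (\sum_i sc (c i) * e i) -> forall i, c i = 0.
have [c cP] := indepX_fin (unif x).
have Pc d : P d -> (d <= c)%N.
  move=> [e [xe ie]]; apply: (cP _ e).
  apply: (@mod_indepX _ (ring_of x) (ideal x)) => //.
  - exact: unif_neq0  _.
  - split; first exact: local_ring0.
    by move=> b u v xu xv; apply: local_ringD => //; apply: local_ringM => //; exact: local_ring_sc.
  - by move=> a xa; apply: local_ringM => //; apply: local_ideal_sub; exact: (unifP _ _).1.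
  - move=> a xa; rewrite mulrC -mulNr; apply: local_idealM; first exact: local_ringN.
    exact: (unifP _ _).1.
have [d] : exists d, `[< P d >] && [forall e : 'I_c.+1, `[< P e >] ==> (e <= d)%N].
  have P0 : exists d, `[< P d >] by exists 0%N; apply/asboolP; exists (fun=> 0); split=> [[]|c' _ []].
  have Pm d : `[< P d >] -> (d <= c)%N by move/asboolP; exact: Pc.
  have := ex_maxnP P0 Pm; case: ex_maxnP => d Pd dP _.
  by exists d; rewrite Pd; apply/forallP => e; apply/implyP; exact: dP.
case/andP => /asboolP[e [xe ie]] /forallP max.
exfalso; apply: (no d) => /=; exists e; split=> // u xu.
apply: contrapT => nu.
have Pd1 : P d.+1.
  exists (fun i => if unlift ord0 i is Some j then e j else u); split.
    by move=> i; case: unliftP.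
  move=> b; rewrite big_ord_recl unlift_none => bI.
  have {}bI : ideal x (sc (b ord0) * u + \sum_i sc (b (lift ord0 i)) * e i).
    by move: bI; congr (ideal x (_ + _)); apply: eq_bigr => i _; rewrite liftK.
  have [b0|b0] := eqVneq (b ord0) 0.
    have iE : forall i, b (lift ord0 i) = 0.
      by apply: (ie (fun i => b (lift ord0 i))); move: bI; rewrite b0 rmorph0 mul0r add0r.
    by move=> i; have [j ->|->] := unliftP ord0 i.
  exfalso; apply: nu; exists (fun i => - (b ord0)^-1 * b (lift ord0 i)).
  move/(local_idealM (local_ring_sc x (b ord0)^-1)): bI.
  rewrite mulrDr mulrA -rmorphM mulVf // rmorph1 mul1r mulr_sumr; congr (ideal x (_ + _)).
  by rewrite -sumrN; apply: eq_bigr => i _; rewrite !rmorphM rmorphN; ring.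
have := max (Ordinal (n := c.+1) (m := d.+1) (Pc _ Pd1)).
by rewrite /= (introT (asboolP _) Pd1) ltnn.
Qed.

Lemma residue_degree_gt0 (x : pt) : (0 < residue_degree x)%N.
Proof.
have [e [_ _ /(_ 1 (local_ring1 x))[c]]] := residue_basis x.
rewrite lt0n; case: eqP => // d0; rewrite big1 ?subr0 => [/local_ideal_proper //|i _].
by have := ltn_ord i; rewrite {2}d0.
Qed.

(* Effective divisors are sequences of points, counted with multiplicity. *)
Definition sdeg (S : seq pt) : nat := \sum_(x <- S) residue_degree x.

Lemma sdeg_cat S T : sdeg (S ++ T) = (sdeg S + sdeg T)%N.
Proof. by rewrite /sdeg big_cat. Qed.

Lemma sdeg_cons x S : sdeg (x :: S) = (residue_degree x + sdeg S)%N.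
Proof. by rewrite /sdeg big_cons. Qed.

Lemma size_sdeg S : (size S <= sdeg S)%N.
Proof.
elim: S => // x S IH; rewrite sdeg_cons /= -add1n leq_add // residue_degree_gt0 //.
Qed.

Lemma leq_sum_mem (T : eqType) (s : seq T) (F : T -> nat) y :
  y \in s -> (F y <= \sum_(z <- s) F z)%N.
Proof.
elim: s => // a s IH; rewrite inE big_cons => /orP[/eqP <-|/IH h]; first exact: leq_addr.
exact: leq_trans h (leq_addl _ _).
Qed.

(** A Chinese remainder count: [sdeg S] functions independent modulo those vanishing along S. The
    set T stays fixed in the induction because functions found for a shorter S must be regular at
    the points added later. *)
Lemma zeros_independent (T S : seq pt) : {subset S <= T} ->
  exists w : 'I_(sdeg S) -> K, (forall i y, y \in T -> vge y 0 (w i)) /\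
   forall c : 'I_(sdeg S) -> k,
     (forall y, y \in T -> vge y (count_mem y S)%:Z (\sum_i sc (c i) * w i)) ->
     forall i, c i = 0.
Proof.
elim: S => [_|x S IH xST].
  rewrite (_ : sdeg [::] = 0%N); last by rewrite /sdeg big_nil.
  by exists (fun=> 0); split=> [[]|c _ []].
have [w [Tw iw]] : exists w : 'I_(sdeg S) -> K, (forall i y, y \in T -> vge y 0 (w i)) /\
   forall c : 'I_(sdeg S) -> k,
     (forall y, y \in T -> vge y (count_mem y S)%:Z (\sum_i sc (c i) * w i)) ->
     forall i, c i = 0 by apply: IH => y Sy; apply: xST; rewrite inE Sy orbT.
have [e [xe ie _]] := residue_basis x.
set n := count_mem x S.
(* Vanishing of eps to order N away from x outweighs the poles of [e i * unif x ^ n] and leaves the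
   zeros that S prescribes. *)
pose N := (\sum_(y <- T) (count_mem y S + \sum_i `|ord y (e i * unif x ^ n%:Z)|))%N.
have [|eps [eps0 xeps seps]] := @ord_approx x [seq y <- T | y != x] N; first by rewrite mem_filter eqxx.
pose v i := e i * unif x ^ n%:Z * eps.
have p0 := unif_neq0 x.
have vxE (c : 'I_(residue_degree x) -> k) :
  \sum_i sc (c i) * v i = (\sum_i sc (c i) * e i) * unif x ^ n%:Z * eps.
  by rewrite !mulr_suml; apply: eq_bigr => i _; rewrite !mulrA.
have vM := vgeM. have vP := vgeP.
have vpn : vge x n (unif x ^ n%:Z).
  by apply/vP; rewrite ?expfz_neq0 // ord_expz.
have veps : vge x 0 eps by apply/vP; rewrite ?xeps.
have vxn i y : y \in T -> vge y (count_mem y S)%:Z (v i).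
  have [->|yx] := eqVneq y x => yT.
    rewrite -[_%:Z]addr0; apply: (vM) => //; rewrite -[X in vge _ X]add0r; apply: (vM) => //.
    by apply/vge_ring; exact: xe.
  have [u0|u0] := eqVneq (e i * unif x ^ n%:Z) 0; first by rewrite /v u0 mul0r; exact: vge0.
  apply/vP; first by rewrite mulf_neq0.
  rewrite ordM //.
  have := seps y; rewrite mem_filter yx yT => /(_ erefl).
  have hN := leq_sum_mem (fun y => count_mem y S + \sum_i `|ord y (e i * unif x ^ n%:Z)|)%N yT.
  have := @leq_sum_mem _ (index_enum _) (fun i => `|ord y (e i * unif x ^ n%:Z)|)%N i.
  rewrite mem_index_enum => /(_ isT) hi.
  have {hN hi} := leq_trans (leq_add (leqnn (count_mem y S)) hi) hN; rewrite -/N.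
  move: (ord y eps) (ord y _) (count_mem y S) => o1 o2 m; clearbody N; clear; lia.
rewrite sdeg_cons.
exists (fun i => match fintype.split i with inl a => v a | inr b => w b end); split.
  move=> i y yT; case: fintype.splitP => j _; last exact: Tw.
  by apply: vge_le (vxn j y yT).
move=> c cT.
have cE : \sum_i sc (c i) * (match fintype.split i with inl a => v a | inr b => w b end) =
   \sum_i sc (c (lshift _ i)) * v i + \sum_i sc (c (rshift _ i)) * w i.
  rewrite big_split_ord /=; congr (_ + _); apply: eq_bigr => i _.
    by rewrite (unsplitK (inl i)).
  by rewrite (unsplitK (inr i)).
have lin y m := vge_lin_closed y m.
(* The [v i] already vanish along S, so the [w] part does too and induction kills its coefficients.
   What remains has one more zero at x, which forces the residues of the [e i] to cancel. *)
have cr : forall i, c (rshift _ i) = 0.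
  apply: (iw (fun i => c (rshift _ i))) => y yT.
  have := cT y yT; rewrite cE => /(vge_le (m := count_mem y S)) h.
  have {h} := h _; rewrite /= PoszD lerDr lez_nat => /(_ isT).
  have hS : vge y (count_mem y S) (\sum_i sc (c (lshift _ i)) * v i).
    by apply: lin_closed_sum; [exact: lin|move=> i; exact: vxn].
  move=> h2; have := lin_closedD (lin y _) (lin_closedZ (-1) (lin y _) hS) h2.
  by rewrite rmorphN1 mulN1r addKr.
have cl : forall i, c (lshift _ i) = 0.
  apply: (ie (fun i => c (lshift _ i))); apply/ideal_vge.
  have := cT x (xST x (mem_head _ _)).
  rewrite cE [X in _ + X]big1 ?addr0 => [|i _]; last by rewrite cr rmorph0 mul0r.
  rewrite vxE /= eqxx add1n -/n => h.
  have p' : vge x (- n%:Z) (unif x ^ (- n%:Z)).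
    by apply/vP; rewrite ?expfz_neq0 // ord_expz.
  have e' : vge x 0 eps^-1.
    by apply/vP; rewrite ?invr_eq0 // ordV // xeps.
  have := vM _ _ _ _ _ h (vM _ _ _ _ _ p' e').
  rewrite addr0 (_ : n.+1%:Z - n%:Z = 1); last by lia.
  congr (vge x 1 _).
  have : unif x ^ n%:Z != 0 by rewrite expfz_neq0.
  rewrite -invr_expz; move: (unif x ^ n%:Z) (\sum_i _) => P s P0.
  by field; rewrite ?eps0 ?P0.
by move=> i; rewrite -[i]fintype.splitK; case: (fintype.split i) => j /=.
Qed.

(** Zeros counted with residue degrees cannot exceed the rank over k[f]: multiplication by f maps
    the functions regular along S into those vanishing along S. *)
Lemma zeros_indepX (f : K) (S : seq pt) : f != 0 ->
  (forall y, (count_mem y S)%:Z <= Num.max 0 (ord y f)) ->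
  exists w : 'I_(sdeg S) -> K, indepX sc f w.
Proof.
move=> f0 Sf; have [w [Sw iw]] := @zeros_independent S S (fun _ => id).
have pos y : y \in S -> (count_mem y S)%:Z <= ord y f.
  move=> yS; have := Sf y; rewrite le_max => /orP[|//].
  by rewrite lez_nat leqn0 -leqn0 leqNgt -has_count has_pred1 yS.
exists w; apply: (@mod_indepX _ (fun h => forall y, y \in S -> vge y 0 h)
  (fun h => forall y, y \in S -> vge y (count_mem y S) h)) => //.
- split=> [y _|c u v hu hv y yS]; first exact: vge0.
  by apply: (vge_lin_closed y 0).2; [exact: hu|exact: hv].
- move=> a ha y yS; rewrite -[0]add0r; apply: vgeM; last exact: ha.
  by apply/vgeP => //; apply: le_trans (pos y yS).
- move=> a ha y yS; rewrite -mulN1r -(rmorphN1 sc).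
  apply: lin_closedZ (vge_lin_closed y _) _; rewrite -[_%:Z]addr0; apply: vgeM; last exact: ha.
  by apply/vgeP => //; exact: pos.
Qed.

Lemma transcV f : transc sc f -> transc sc f^-1.
Proof.
move=> tf q q0; have f0 := transc_neq0 tf.
have [->//|qn0] := eqVneq q 0.
pose n := (size q).-1; have nE : size q = n.+1 by rewrite prednK // size_poly_gt0.
pose r := \poly_(i < n.+1) q`_(n - i).
have r0' : peval sc f r = 0.
  apply: (mulfI (expf_neq0 n (invr_neq0 f0))).
  rewrite mulr0 -[RHS]q0 (@pevalE _ _ _ _ _ n.+1) ?size_poly // mulr_sumr.
  rewrite (@pevalE _ _ _ _ _ n.+1) ?nE // (reindex_inj rev_ord_inj) /=.
  apply: eq_bigr => j _; rewrite coef_poly subSS ltnS leq_subr subKn ?leq_ord //.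
  rewrite mulrCA; congr (_ * _).
  have fj : f^-1 ^+ (n - j) * f ^+ (n - j) = 1 by rewrite -exprMn mulVf // expr1n.
  by rewrite -{1}(subnKC (leq_ord j)) exprD -mulrA fj mulr1.
apply/polyP => i; rewrite coef0; case: (ltnP n i) => ni; first by rewrite nth_default ?nE.
have := congr1 (fun p : {poly k} => p`_(n - i)) (tf _ r0').
by rewrite coef_poly ltnS leq_subr subKn // coef0.
Qed.

(** A function with a zero is transcendental, as [peval_unif] writes q(f) as a unit times a power of
    f; a pole is a zero of the inverse. *)
Lemma const_ord (f : K) y : f != 0 -> ~ transc sc f -> ord y f = 0.
Proof.
have pos g z : g != 0 -> 0 < ord z g -> transc sc g.
  move=> g0 zg q q0; apply/eqP; apply: contraT => qn0.
  have zI : ideal z g by apply/ideal_vge/vgeP.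
  have [e [a [za E]]] := peval_unif zI qn0.
  by move: q0; rewrite E => /eqP; rewrite mulf_eq0 (negPf (unit_of_neq0 za)) expf_eq0 (negPf g0) andbF.
move=> f0 nt; apply/eqP; case: ltgtP => // yf; exfalso; apply: nt; last exact: pos yf.
rewrite -[f]invrK; apply: transcV; apply: (pos _ y); first by rewrite invr_eq0.
by rewrite ordV // oppr_gt0.
Qed.

(** Sequences lying below the zero divisor of f have bounded length by [zeros_indepX] and
    [indepX_fin]; one of maximal length exhausts the zeros. *)
Lemma zero_seq (f : K) : f != 0 ->
  exists Z, forall y, (count_mem y Z)%:Z = Num.max 0 (ord y f).
Proof.
move=> f0; have [tf|nt] := pselect (transc sc f); last first.
  by exists [::] => y; rewrite (const_ord _ f0 nt).
have [c cP] := indepX_fin f.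
pose ok S := forall y, (count_mem y S)%:Z <= Num.max 0 (ord y f).
have okc S : ok S -> (size S <= c)%N.
  by move=> /(zeros_indepX f0)[w /cP]; apply: leq_trans; exact: size_sdeg.
pose P n := `[< exists2 S, ok S & size S = n >].
have P0 : exists n, P n.
  by exists 0%N; apply/asboolP; exists [::] => // y; rewrite le_max lexx.
have Pm n : P n -> (n <= c)%N by move=> /asboolP[S /okc + <-].
case: (ex_maxnP P0 Pm) => n /asboolP[S okS Sn] max.
exists S => y; apply/eqP; rewrite eq_le okS leNgt; apply/negP => lt.
suff /max : P n.+1 by rewrite ltnn.
apply/asboolP; exists (y :: S); last by rewrite /= Sn.
move=> z /=; have [<-|_] := eqVneq y z; last exact: okS.
by rewrite add1n; move: lt; move: (Num.max _ _) => M.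
Qed.

(** * The spaces L(E), the degree formula and Riemann's inequality *)

(* The space L(E). *)
Definition RR (E : pt -> int) : set K := [set f | forall y, vge y (- E y) f].

Definition effdiv (S : seq pt) : pt -> int := fun y => (count_mem y S)%:Z.

Lemma RR_mono E E' : (forall y, E y <= E' y) -> RR E `<=` RR E'.
Proof. by move=> EE f Ef y; apply: vge_le (Ef y); rewrite lerN2. Qed.

(** Multiplied by [unif x ^ (E x + 1)], an element of L(E + x) is regular at x, and it comes from
    L(E) when its residue vanishes: [residue_degree x] linear conditions. *)
Lemma RR_step (E E' : pt -> int) (x : pt) m :
  (forall y, E' y <= E y + (y == x)%:Z) -> dimge sc (RR E') m ->
  dimge sc (RR E) (m - residue_degree x).
Proof.
move=> EE; apply: dimge_kernel => w Ew; have [e [xe ie se]] := residue_basis x.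
have p0 := unif_neq0 x.
have xw i : ring_of x (w i * unif x ^ (E x + 1)).
  have := Ew i x; rewrite /vge opprK.
  move=> /(vge_ring x _) h1; apply/vge_ring.
  have : vge x (E x + 1 - E' x) (unif x ^ (E x + 1 - E' x)).
    by apply/vgeP; rewrite ?expfz_neq0 // ord_expz.
  move=> /(vge_le (m := 0)) h2; have {h2} := h2 _; have := EE x; rewrite eqxx => le.
  move=> /(_ ltac:(lia)) /(vgeM h1); rewrite addr0 -mulrA -expfzDr //.
  by rewrite addrC subrK.
have /choice[a wa] i := se _ (xw i).
exists (\matrix_(i, j) a i j) => c /rowP cM y.
have Ey : vge y (- E' y) (\sum_i sc (c 0 i) * w i).
  by apply: lin_closed_sum; [exact: vge_lin_closed|move=> i; exact: Ew].
have [yx|yx] := eqVneq y x; last first.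
  by apply: vge_le Ey; have := EE y; rewrite (negPf yx); lia.
have : ideal x (\sum_i sc (c 0 i) * (w i * unif x ^ (E x + 1) - \sum_j sc (a i j) * e j)).
  have /lin_closed_sum : lin_closed sc (vge x 1) by exact: vge_lin_closed.
  by move=> h; apply/ideal_vge; apply: h => i; apply/ideal_vge; exact: wa.
have -> : \sum_i sc (c 0 i) * (w i * unif x ^ (E x + 1) - \sum_j sc (a i j) * e j) =
   (\sum_i sc (c 0 i) * w i) * unif x ^ (E x + 1).
  under eq_bigr do rewrite mulrBr; rewrite sumrB mulr_suml.
  rewrite [X in _ - X](_ : _ = 0) ?subr0; first by apply: eq_bigr => i _; rewrite mulrA.
  under eq_bigr do rewrite mulr_sumr; rewrite exchange_big big1 // => j _.
  have := cM j; rewrite !mxE => /(congr1 sc) /(congr1 (fun u => u * e j)).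
  rewrite rmorph0 mul0r rmorph_sum mulr_suml => cj; rewrite -[RHS]cj.
  by apply: eq_bigr => i _; rewrite mxE rmorphM mulrA.
move=> /ideal_vge h.
have p' : vge x (- (E x + 1)) (unif x ^ (- (E x + 1))).
  by apply/vgeP; rewrite ?expfz_neq0 // ord_expz.
have := vgeM h p'; rewrite -mulrA -expfzDr // subrr expr0z mulr1 yx.
by rewrite opprD addrCA subrr addr0.
Qed.

Lemma RR_compare (S : seq pt) (E E' : pt -> int) m :
  (forall y, E' y <= E y + effdiv S y) -> dimge sc (RR E') m ->
  dimge sc (RR E) (m - sdeg S).
Proof.
elim: S E' m => [|x S IH] E' m EE.
  rewrite /sdeg big_nil subn0; apply: dimge_sub; apply: RR_mono => y.
  by have := EE y; rewrite addr0.
rewrite sdeg_cons subnDA => dm; apply: (IH (fun y => E y + effdiv S y)) => //.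
apply: RR_step dm => y; have := EE y; rewrite /effdiv /= [x == y]eq_sym PoszD; lia.
Qed.

Lemma RR0_fin m : dimge sc (RR (fun=> 0)) m -> (m <= r0)%N.
Proof.
move=> dm; apply: regular_fin; apply: dimge_sub dm => f Ef.
have [->|f0] := eqVneq f 0; [by left|right; split=> // y].
by apply/(vgeP y _ f0); have := Ef y; rewrite oppr0.
Qed.

Lemma RR_effdiv_bound S m : dimge sc (RR (effdiv S)) m -> (m <= r0 + sdeg S)%N.
Proof.
move=> dm; rewrite addnC -leq_subLR; apply: RR0_fin; apply: RR_compare dm => y.
by rewrite add0r.
Qed.

Lemma RR_mulV E E' f m : f != 0 -> (forall y, E y + ord y f <= E' y) ->
  dimge sc (RR E) m -> dimge sc (RR E') m.
Proof.
move=> f0 EE; apply: (@dimge_mul _ _ _ _ _ f^-1); first by rewrite invr_eq0.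
move=> u Eu y; have vf : vge y (- ord y f) f^-1.
  by apply/vgeP; rewrite ?invr_eq0 // ordV.
by apply: vge_le (vgeM vf (Eu y)); have := EE y; lia.
Qed.

Lemma effdiv_cat S T y : effdiv (S ++ T) y = effdiv S y + effdiv T y.
Proof. by rewrite /effdiv count_cat PoszD. Qed.

Lemma pole_seqs (I : finType) (w : I -> K) :
  exists C : seq pt, forall i, RR (effdiv C) (w i).
Proof.
have /choice[Z ZP] i : exists Z, RR (effdiv Z) (w i).
  have [wi0|wi0] := eqVneq (w i) 0; first by exists [::] => y; rewrite wi0; exact: vge0.
  have [|Z ZP] := @zero_seq (w i)^-1; first by rewrite invr_eq0.
  exists Z => y; apply/vgeP => //; rewrite /effdiv ZP ordV //; lia.
exists (flatten [seq Z i | i <- index_enum I]) => i; apply: RR_mono (ZP i) => y.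
rewrite /effdiv lez_nat count_flatten sumnE !big_map.
by apply: (@leq_sum_mem _ _ (fun j => count_mem y (Z j))); rewrite mem_index_enum.
Qed.

Definition seqn (l : nat) (Z : seq pt) : seq pt := flatten (nseq l Z).

Lemma effdiv_seqn l Z y : effdiv (seqn l Z) y = effdiv Z y *+ l.
Proof. by elim: l => // l IH; rewrite /seqn /= effdiv_cat IH mulrS. Qed.

Lemma sdeg_seqn l Z : sdeg (seqn l Z) = (l * sdeg Z)%N.
Proof. by elim: l => [|l IH]; [rewrite /sdeg big_nil|rewrite /seqn /= sdeg_cat IH mulSn]. Qed.

(** With w independent over k[h], the products w_i h^j for j <= l have poles at most C + l Z, where
    C collects the poles of the w_i. *)
Lemma RR_growth (h : K) (P Z : seq pt) : transc sc h ->
  (forall y, effdiv P y = Num.max 0 (ord y h)) ->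
  (forall y, effdiv Z y = Num.max 0 (- ord y h)) ->
  exists C : seq pt, forall l, dimge sc (RR (effdiv (C ++ seqn l Z))) (sdeg P * l.+1).
Proof.
move=> th Ph Zh; have h0 := transc_neq0 th.
have [w iw] : exists w : 'I_(sdeg P) -> K, indepX sc h w.
  by apply: zeros_indepX => // y; have := Ph y; rewrite /effdiv => ->.
have [C CP] := pole_seqs w; exists C => l.
have <- : #|{: 'I_(sdeg P) * 'I_l.+1}| = (sdeg P * l.+1)%N by rewrite card_prod !card_ord.
apply: dimge_fin (indepX_pow (l := l.+1) iw) => -[i j] y /=.
rewrite effdiv_cat opprD; apply: vgeM; first exact: CP.
apply/vgeP; first by rewrite expf_neq0.
rewrite ordX // effdiv_seqn Zh -[_ *+ l]mulr_natr -[_ *+ j]mulr_natr !natz.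
have := leq_ord j; move: (nat_of_ord j) (ord y h) => a b; nia.
Qed.

Lemma zeros_le_poles (h : K) (P Z : seq pt) : transc sc h ->
  (forall y, effdiv P y = Num.max 0 (ord y h)) ->
  (forall y, effdiv Z y = Num.max 0 (- ord y h)) -> (sdeg P <= sdeg Z)%N.
Proof.
move=> th Ph Zh; have [C CP] := RR_growth th Ph Zh.
rewrite leqNgt; apply/negP => lt.
(* The bounds give sdeg P (l + 1) <= r0 + sdeg C + l sdeg Z for every l, which fails at l = r0 +
   sdeg C if sdeg P > sdeg Z. *)
have := RR_effdiv_bound (CP (r0 + sdeg C)%N); rewrite sdeg_cat sdeg_seqn; nia.
Qed.

Theorem product_formula (f : K) (P Z : seq pt) : f != 0 ->
  (forall y, effdiv P y = Num.max 0 (ord y f)) ->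
  (forall y, effdiv Z y = Num.max 0 (- ord y f)) -> sdeg P = sdeg Z.
Proof.
move=> f0 Pf Zf; have [tf|nt] := pselect (transc sc f); last first.
  have nil (S : seq pt) : (forall y, effdiv S y = 0) -> sdeg S = 0%N.
    case: S => [|x S] S0; first by rewrite /sdeg big_nil.
    by have := S0 x; rewrite /effdiv /= eqxx.
  by rewrite !nil // => y; rewrite ?Zf ?Pf const_ord.
apply/anti_leq; rewrite (zeros_le_poles tf) //=.
apply: (zeros_le_poles (transcV tf)) => y; rewrite ordV //.
by rewrite opprK.
Qed.

Lemma effective_seq (E : pt -> int) (A B : seq pt) : (forall y, 0 <= E y) ->
  (forall y, E y = effdiv A y - effdiv B y) ->
  exists Q, (forall y, effdiv Q y = E y) /\ (sdeg Q + sdeg B = sdeg A)%N.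
Proof.
elim: B A => [|b B IH] A E0 EA.
  by exists A; rewrite [X in (_ + X)%N]/sdeg big_nil addn0; split=> // y; rewrite EA subr0.
have bA : b \in A.
  rewrite -has_pred1 has_count; have := E0 b; rewrite EA /effdiv /= eqxx; lia.
have pA := perm_to_rem bA.
have cA y : effdiv A y = (b == y)%:Z + effdiv (rem b A) y.
  by rewrite /effdiv (seq.permP pA) /= PoszD.
have [|Q [QE Qd]] := IH (rem b A) E0.
  by move=> y; rewrite EA cA /effdiv /= PoszD; ring.
exists Q; split=> //.
rewrite sdeg_cons addnCA Qd -sdeg_cons /sdeg; exact/esym/perm_big.
Qed.

(** Multiples l Z of the pole divisor of z satisfy the bound by [RR_growth]. For l large some
    nonzero f lies in L(l Z - S), so l Z is equivalent to S + Q with Q effective; dropping Q costs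
    deg Q = l deg Z - deg S, and the defect deg C does not depend on S. *)
Theorem riemann : exists C0 : nat, forall S : seq pt, dimge sc (RR (effdiv S)) (sdeg S - C0).
Proof.
have [z tz _] := curve_transc X_curve; have z0 := transc_neq0 tz.
have [P Pz] := zero_seq z0.
have [|Z Zz] := @zero_seq z^-1; first by rewrite invr_eq0.
have {}Zz y : effdiv Z y = Num.max 0 (- ord y z) by rewrite /effdiv Zz ordV.
have PZ := product_formula z0 Pz Zz.
have [C CP] := RR_growth tz Pz Zz.
have lZ l : dimge sc (RR (effdiv (seqn l Z))) (sdeg Z * l - sdeg C).
  apply: dimge_le (RR_compare (S := C) (E := effdiv (seqn l Z)) _ (CP l)).
    by rewrite leq_sub2r // PZ leq_mul2l leqnSn orbT.
  by move=> y; rewrite effdiv_cat addrC.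
(* Without poles all powers of z would be regular, against [regular_fin]. *)
have Z0 : (0 < sdeg Z)%N.
  rewrite lt0n; apply/eqP => Z0.
  have Znil : Z = [::] by apply: size0nil; apply/eqP; rewrite -leqn0 -Z0; exact: size_sdeg.
  have zreg y : vge y 0 z by apply/vgeP => //; have := Zz y; rewrite Znil /effdiv /=; lia.
  have : (r0.+1 <= r0)%N; last by rewrite ltnn.
  apply: RR0_fin; exists (fun i : 'I_r0.+1 => z ^+ i); split.
    move=> i y; apply/vgeP; first by rewrite expf_neq0.
    rewrite oppr0 ordX //; have /vgeP := zreg y; move=> /(_ z0) h; exact: mulrn_wge0.
  move=> c c0 i.
  have /tz q0 : peval sc z (\poly_(j < r0.+1) c (inord j)) = 0.
    rewrite (@pevalE _ _ _ _ _ r0.+1) ?size_poly // -[RHS]c0.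
    by apply: eq_bigr => j _; rewrite coef_poly ltn_ord inord_val.
  have := congr1 (fun q : {poly k} => q`_i) q0.
  by rewrite coef_poly ltn_ord inord_val coef0.
exists (sdeg C) => S.
(* As sdeg Z >= 1, this leaves l sdeg Z - sdeg C - sdeg S >= 1, hence a nonzero function. *)
have [l lE] : exists l, l = (sdeg C + sdeg S).+1 by exists (sdeg C + sdeg S).+1.
have : dimge sc (RR (fun y => effdiv (seqn l Z) y - effdiv S y)) 1.
  apply: dimge_le (RR_compare (S := S) (E := fun y => effdiv (seqn l Z) y - effdiv S y) _ (lZ l)).
    rewrite lE; nia.
  by move=> y; rewrite subrK.
move=> [u [uS iu]]; set f := u ord0.
have f0 : f != 0.
  apply/eqP => f0; have := iu (fun=> 1) _ ord0; rewrite big_ord1 -/f f0 mulr0.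
  by move=> /(_ erefl)/eqP; rewrite oner_eq0.
have [Pf PfE] := zero_seq f0.
have [|Zf ZfE] := @zero_seq f^-1; first by rewrite invr_eq0.
have {}ZfE y : effdiv Zf y = Num.max 0 (- ord y f) by rewrite /effdiv ZfE ordV.
have fdeg := product_formula f0 PfE ZfE.
have ordE y : ord y f = effdiv Pf y - effdiv Zf y by rewrite ZfE /effdiv PfE; lia.
have [y||Q [QE Qd]] := @effective_seq (fun y => ord y f + effdiv (seqn l Z) y - effdiv S y)
   (Pf ++ seqn l Z) (Zf ++ S).
- by have /vgeP := uS ord0 y => /(_ f0); rewrite -/f; lia.
- by move=> y; rewrite !effdiv_cat ordE; ring.
have : dimge sc (RR (fun y => effdiv S y + effdiv Q y)) (sdeg Z * l - sdeg C).
  by apply: RR_mulV f0 _ (lZ l) => y; rewrite QE; lia.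
move=> /(RR_compare (S := Q) (E := effdiv S)) h.
apply: dimge_le (h _) => [|y //].
move: Qd; rewrite !sdeg_cat sdeg_seqn fdeg (mulnC l).
move: (sdeg Z * l)%N => m Qm; lia.
Qed.

(** * Real divisors and the growth of dim H^0(nE) *)

Context (R : realType).
Implicit Types (x y : pt) (E : pt -> R).

Lemma H0_RR E : H0 E = RR (fun y => Num.floor (E y)).
Proof.
have vP := @vgeP.
apply/seteqP; split=> f.
  move=> [->|[f0 Ef]] y; first exact: vge0.
  by apply/vP => //; rewrite lerNl floor_ge_int rmorphN /= lerNl -subr_ge0 opprK.
move=> Ef; have [->|f0] := eqVneq f 0; [by left|right; split=> // y].
have /vP := Ef y; rewrite lerNl floor_ge_int => /(_ f0).
by rewrite rmorphN /= lerNl -subr_ge0 opprK.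
Qed.

Lemma deg_seq E (s : seq pt) : uniq s -> (forall y, E y != 0 -> y \in s) ->
  deg E = \sum_(y <- s) (residue_degree y)%:R * E y.
Proof.
move=> us Es; rewrite /deg; apply/esym; rewrite fsbig_seq //; apply: fsbig_widen => //.
move=> y [_ /= /negP ys]; have [->|/Es] := eqVneq (E y) 0; first by rewrite mulr0.
by move=> yin; rewrite yin in ys.
Qed.

Lemma Rdivisor_seq E : is_Rdivisor E ->
  exists s : seq pt, uniq s /\ forall y, E y != 0 -> y \in s.
Proof.
move=> /finite_seqP[s sE]; exists (undup s); split; first exact: undup_uniq.
by move=> y Ey; rewrite mem_undup; have : [set` s] y by rewrite -sE.
Qed.

Lemma deg_effdiv (S : seq pt) : deg (fun y => (effdiv S y)%:~R : R) = (sdeg S)%:R.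
Proof.
rewrite (@deg_seq _ (undup S)) ?undup_uniq //; last first.
  move=> y; rewrite intr_eq0 mem_undup /effdiv => yS.
  by rewrite -has_pred1 has_count lt0n.
have sum_count (t : seq pt) : uniq t -> {subset S <= t} ->
    \sum_(y <- t) (residue_degree y)%:R * (effdiv S y)%:~R = (sdeg S)%:R :> R.
  move=> ut; elim: S => [_|x S IH xSt].
    by rewrite /sdeg big_nil big1 // => y _; rewrite mulr0.
  rewrite sdeg_cons natrD -IH; last by move=> y yS; apply: xSt; rewrite inE yS orbT.
  rewrite (bigD1_seq x) ?xSt ?mem_head //= [in RHS](bigD1_seq x) ?xSt ?mem_head //=.
  rewrite addrA; congr (_ + _); last first.
    by apply: eq_bigr => y /negPf yx; rewrite /effdiv /= [x == y]eq_sym yx.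
  by rewrite /effdiv /= eqxx PoszD rmorphD /= mulrDr mulr1.
by apply: sum_count; rewrite ?undup_uniq // => y; rewrite mem_undup.
Qed.

Lemma effdiv_finite (S : seq pt) : is_Rdivisor (fun y => (effdiv S y)%:~R : R).
Proof.
apply: (@sub_finite_set _ _ [set` S]); last exact: finite_seq.
move=> y /=; rewrite intr_eq0 /effdiv => yS.
by rewrite -has_pred1 has_count lt0n.
Qed.

Lemma deg_linear c E E' : is_Rdivisor E -> is_Rdivisor E' ->
  is_Rdivisor (fun y => c * E y + E' y) /\ deg (fun y => c * E y + E' y) = c * deg E + deg E'.
Proof.
move=> /Rdivisor_seq[s [us Es]] /Rdivisor_seq[t [ut Et]].
have sub (F : pt -> R) : (forall y, F y != 0 -> (y \in s) || (y \in t)) ->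
    deg F = \sum_(y <- undup (s ++ t)) (residue_degree y)%:R * F y.
  by move=> Fst; apply: deg_seq; rewrite ?undup_uniq // => y /Fst; rewrite mem_undup mem_cat.
have supp y : c * E y + E' y != 0 -> (y \in s) || (y \in t).
  have [Ey|/Es -> //] := eqVneq (E y) 0; have [E'y|/Et ->] := eqVneq (E' y) 0.
    by rewrite Ey E'y mulr0 addr0 eqxx.
  by rewrite orbT.
split.
  apply: (@sub_finite_set _ _ [set` s ++ t]); last exact: finite_seq.
  by move=> y /supp; rewrite /= mem_cat.
rewrite !sub //; [|by move=> y /Et ->; rewrite orbT|by move=> y /Es ->].
by rewrite mulr_sumr -big_split; apply: eq_bigr => y _; rewrite mulrDr mulrCA.
Qed.

Lemma is_RdivisorD E E' : is_Rdivisor E -> is_Rdivisor E' -> is_Rdivisor (fun y => E y + E' y).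
Proof.
move=> dE dE'; have [+ _] := deg_linear 1 dE dE'.
by congr is_Rdivisor; apply/funext => y; rewrite mul1r.
Qed.

Lemma degB E E' : is_Rdivisor E -> is_Rdivisor E' ->
  is_Rdivisor (fun y => E y - E' y) /\ deg (fun y => E y - E' y) = deg E - deg E'.
Proof.
move=> dE dE'; rewrite (_ : (fun y => E y - E' y) = (fun y => -1 * E' y + E y)).
  by have [] := deg_linear (-1) dE' dE; rewrite mulN1r addrC.
by apply/funext => y; rewrite mulN1r addrC.
Qed.

Lemma principal_deg (f : K) : f != 0 ->
  is_Rdivisor (fun y => (ord y f)%:~R : R) /\ deg (fun y => (ord y f)%:~R : R) = 0.
Proof.
move=> f0; have [P Pf] := zero_seq f0.
have [|Z Zf] := @zero_seq f^-1; first by rewrite invr_eq0.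
have {}Zf y : effdiv Z y = Num.max 0 (- ord y f).
  by rewrite /effdiv Zf ordV.
have fE : (fun y => (ord y f)%:~R) = (fun y => (effdiv P y)%:~R - (effdiv Z y)%:~R :> R).
  by apply/funext => y; rewrite -rmorphB; congr (_%:~R); rewrite Zf /effdiv Pf; lia.
rewrite fE (degB (effdiv_finite _) (effdiv_finite _)).2 !deg_effdiv.
rewrite (product_formula f0 Pf Zf) subrr; split=> //.
apply: (@sub_finite_set _ _ [set` P ++ Z]); last exact: finite_seq.
move=> y /=; apply: contraNT; rewrite mem_cat negb_or => /andP[yP yZ].
by rewrite /effdiv (count_memPn yP) (count_memPn yZ) subr0.
Qed.

Lemma int_div_seq (F : pt -> int) (s : seq pt) : uniq s ->
  exists A B : seq pt, (forall y, y \in s -> effdiv A y - effdiv B y = F y) /\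
   (forall y, y \notin s -> effdiv A y - effdiv B y = 0) /\
   (sdeg A)%:Z - (sdeg B)%:Z = \sum_(y <- s) (residue_degree y)%:Z * F y.
Proof.
elim: s => [_|x s IH /= /andP[xs us]].
  by exists [::], [::]; split=> //; split=> //; rewrite big_nil subrr.
have [A [B [AB [AB0 dAB]]]] := IH us.
pose p := if F x is Posz n then n else 0%N.
pose q := if F x is Negz n then n.+1 else 0%N.
have pq : p%:Z - q%:Z = F x by rewrite /p /q; case: (F x) => n; rewrite ?subr0 // NegzE sub0r.
have cn n y : effdiv (nseq n x) y = ((x == y) * n)%N by rewrite /effdiv count_nseq.
have sn n : sdeg (nseq n x) = (residue_degree x * n)%N.
  by elim: n => [|n IHn]; rewrite ?muln0 /sdeg ?big_nil // [nseq _ _]/= big_cons -/(sdeg _) IHn mulnS.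
exists (nseq p x ++ A), (nseq q x ++ B); split; [|split].
- move=> y; rewrite inE !effdiv_cat !cn [x == y]eq_sym; have [->|yx] := eqVneq y x => /=.
    by have := AB0 x xs; rewrite !mul1n; lia.
  by move=> /AB; lia.
- move=> y; rewrite inE negb_or !effdiv_cat !cn [x == y]eq_sym => /andP[/negPf -> /AB0].
  by rewrite /=; lia.
- by rewrite big_cons !sdeg_cat !sn -dAB -pq; lia.
Qed.

(** Rounding n E down loses less than [residue_degree y] at each point y of the support, so at most
    M for all n together. For the lower bound, Riemann's inequality is applied to the positive part
    A of the rounded divisor and B is subtracted; for the upper one, a nonzero section moves the
    divisor to an effective Q, where dim L(Q) <= r0 + deg Q. *)
Lemma dim_estimate E : is_Rdivisor E -> 0 <= deg E ->
  exists C : R, forall n : nat,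
   (forall m, dimge sc (H0 (fun y => n%:R * E y)) m -> m%:R <= n%:R * deg E + C) /\
   (exists2 m, dimge sc (H0 (fun y => n%:R * E y)) m & n%:R * deg E - C <= m%:R).
Proof.
move=> /Rdivisor_seq[s [us Es]] degE.
have [C0 C0P] := riemann.
pose M := \sum_(y <- s) (residue_degree y)%:R : R.
have M0 : 0 <= M by apply: sumr_ge0.
exists (r0%:R + C0%:R + M) => n.
pose F y := Num.floor (n%:R * E y).
have [A [B [AB [AB0 dAB]]]] := int_div_seq F us.
have FE y : F y = effdiv A y - effdiv B y.
  have [ys|ys] := boolP (y \in s); first by rewrite AB.
  rewrite AB0 // /F; have [->|/Es] := eqVneq (E y) 0; last by rewrite (negPf ys).
  by rewrite mulr0 floor0.
have {dAB} dAB : (sdeg A)%:R - (sdeg B)%:R = \sum_(y <- s) (residue_degree y)%:R * (F y)%:~R :> R.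
  rewrite -[LHS]/((sdeg A)%:Z%:~R - (sdeg B)%:Z%:~R) -rmorphB dAB rmorph_sum.
  by apply: eq_bigr => y _; rewrite rmorphM.
have dE := deg_seq us Es.
have up : (sdeg A)%:R - (sdeg B)%:R <= n%:R * deg E.
  rewrite dAB dE mulr_sumr; apply: ler_sum => y _; rewrite mulrCA.
  by apply: ler_wpM2l => //; exact: floor_le.
have low : n%:R * deg E - M <= (sdeg A)%:R - (sdeg B)%:R.
  rewrite dAB dE mulr_sumr -sumrB; apply: ler_sum => y _.
  rewrite mulrCA -[X in _ - X]mulr1 -mulrBr; apply: ler_wpM2l => //.
  by rewrite lerBlDr; apply/ltW; rewrite -intrD1; exact: floorD1_gt.
rewrite H0_RR -/F; split=> [m dm|].
  (* With m = 0 there is no section to move the divisor, and the bound rests on [0 <= deg E]. *)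
  have [->|m0] := posnP m.
    by rewrite addr_ge0 // ?mulr_ge0 // !addr_ge0.
  have [u [uF iu]] := dimge_le m0 dm; set f := u ord0.
  have f0 : f != 0.
    apply/eqP => f0; have := iu (fun=> 1) _ ord0; rewrite big_ord1 -/f f0 mulr0.
    by move=> /(_ erefl)/eqP; rewrite oner_eq0.
  have [P Pf] := zero_seq f0.
  have [|Z Zf] := @zero_seq f^-1; first by rewrite invr_eq0.
  have {}Zf y : effdiv Z y = Num.max 0 (- ord y f).
    by rewrite /effdiv Zf ordV.
  have PZ := product_formula f0 Pf Zf.
  have [y||Q [QE Qd]] := @effective_seq (fun y => F y + ord y f) (A ++ P) (B ++ Z).
  - by have /vgeP := uF ord0 y => /(_ f0); rewrite -/f; lia.
  - by move=> y; rewrite !effdiv_cat FE Zf [effdiv P y]Pf; lia.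
  have : dimge sc (RR (effdiv Q)) m.
    by apply: RR_mulV f0 _ dm => y; rewrite QE.
  move=> /RR_effdiv_bound; rewrite -(ler_nat R) natrD => mQ.
  move: Qd => /(congr1 (fun n => n%:R : R)); rewrite !sdeg_cat !natrD PZ => Qd.
  have : 0 <= C0%:R :> R by [].
  lra.
have := RR_compare (S := B) (E := F) _ (C0P A).
move=> /(_ _)[y|]; first by rewrite FE subrK.
move=> u uP; exists (sdeg A - C0 - sdeg B)%N; first by exists u.
have : (sdeg A)%:R <= (sdeg A - C0 - sdeg B)%:R + C0%:R + (sdeg B)%:R :> R.
  by rewrite -!natrD ler_nat; lia.
have : 0 <= r0%:R :> R by [].
lra.
Qed.

Lemma deg_ge0 E : is_Rdivisor E -> (forall y, 0 <= E y) -> 0 <= deg E.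
Proof.
move=> /Rdivisor_seq[s [us Es]] E0; rewrite (deg_seq us Es) sumr_ge0 // => y _.
by rewrite mulr_ge0.
Qed.

Lemma ord_min x u v : u != 0 -> v != 0 -> u + v != 0 ->
  Num.min (ord x u) (ord x v) <= ord x (u + v).
Proof.
move=> u0 v0 uv0; have vP := @vgeP.
apply/(vP x _ _ uv0); apply: vgeD; apply/vP => //; rewrite ge_min lexx ?orbT //.
Qed.

Lemma H0_lin_closed E : lin_closed sc (H0 E).
Proof.
rewrite H0_RR; split=> [|c u v hu hv] y; first exact: vge0.
exact: ((vge_lin_closed y _).2 c u v (hu y) (hv y)).
Qed.

(** Stated for formal sums, so that it applies to the representative through which [ordR] is
    computed. *)
Lemma tensor_principal (l : tensor_rep R X) :
  let E := fun y => \sum_(p <- l) p.2 * (ord y (val p.1))%:~R in is_Rdivisor E /\ deg E = 0.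
Proof.
elim: l => [|[f c] l [dl Dl]] /=.
  split; last by rewrite (@deg_seq _ [::]) ?big_nil // => y; rewrite big_nil eqxx.
  apply: (sub_finite_set _ (finite_set0 _)) => y /=; by rewrite big_nil eqxx.
have [df Df] := principal_deg (valP f).
have := deg_linear c df dl; rewrite Df Dl mulr0 addr0.
rewrite (_ : (fun y => c * _ + _) = (fun y => \sum_(p <- (f, c) :: l) p.2 * (ord y (val p.1))%:~R)) //.
by apply/funext => y; rewrite big_cons.
Qed.

Lemma bounded_defect_cvg (u : nat -> R) d C :
  (forall n, (0 < n)%N -> n%:R * d - C <= u n <= n%:R * d + C) -> u n / n%:R @[n --> \oo] --> d.
Proof.
move=> uP; apply/cvgrPdist_le => e e0; near=> n.
have n0 : (0 < n)%N by near: n; exists 1%N.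
have n0' : (0 : R) < n%:R by rewrite ltr0n.
have nC : C <= e * n%:R.
  rewrite mulrC -ler_pdivrMr //; apply: le_trans (ltW (truncnS_gt _)) _.
  by rewrite ler_nat; near: n; exact: nbhs_infty_ge.
have /andP[h1 h2] := uP n n0.
rewrite ler_distlC; apply/andP; split.
  by rewrite ler_pdivlMr // mulrBl; lra.
by rewrite ler_pdivrMr // mulrDl; lra.
Unshelve. all: by end_near. Qed.

Lemma dimension_cvg E (m : nat -> nat) : is_Rdivisor E -> 0 <= deg E ->
  (forall n j, (0 < n)%N -> dimge sc (H0 (fun y => n%:R * E y)) j <-> (j <= m n)%N) ->
  (exists2 L : R, 0 <= L & forall n, (0 < n)%N -> (m n)%:R <= n%:R * L) /\
  (m n)%:R / n%:R @[n --> \oo] --> deg E.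
Proof.
move=> dE degE mP; have [C CP] := dim_estimate dE degE.
have h n : (0 < n)%N -> n%:R * deg E - C <= (m n)%:R <= n%:R * deg E + C.
  move=> n0; have [C1 [j jP jC]] := CP n; apply/andP; split.
    by apply: le_trans jC _; rewrite ler_nat; apply/(mP n j n0).
  by apply: C1; apply/(mP n _ n0).
split; last exact: bounded_defect_cvg h.
exists (deg E + `|C|) => [|n n0]; first by rewrite addr_ge0.
have /andP[_ h2] := h n n0; apply: le_trans h2 _; rewrite mulrDr lerD2l.
by apply: le_trans (ler_norm C) _; rewrite ler_peMl // ler1n.
Qed.

Lemma basis_dimge (U : set K) r (e : 'I_r -> K) j : is_basis U e -> dimge sc U j <-> (j <= r)%N.
Proof.
move=> [Ue ie se]; split=> [dj|jr].
  apply: (dimge_span_ord _ dj) => u /se[c /eqP]; rewrite subr_eq0 => /eqP uE; exists c; exact: uE.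
by apply: dimge_le jr _; exists e; split.
Qed.

End Valuations.

(** * Orthogonal bases and the determinant norm *)

Section OrthogonalBasis.
Context (R : realType) (k : fieldType) (X : projective_variety k).
Local Notation K := (ratf X).
Local Notation sc := (Defs.scalar X).
Context (E : set K) (h : K -> R) (E_lin : lin_closed sc E).
Context (hZ : forall c u, c != 0 -> u != 0 -> E u -> h (sc c * u) = h u).
Context (hD : forall u v, u != 0 -> v != 0 -> u + v != 0 -> E u -> E v ->
  Num.min (h u) (h v) <= h (u + v)).

Lemma height_lt u v : E u -> E v -> u != 0 -> v != 0 -> h u < h v ->
  u + v != 0 /\ h (u + v) = h u.
Proof.
move=> Eu Ev u0 v0 uv.
have ENv : E (- v) by rewrite -mulN1r -(rmorphN1 sc); exact: lin_closedZ.
have Nv0 : - v != 0 by rewrite oppr_eq0.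
have hN : h (- v) = h v by rewrite -mulN1r -(rmorphN1 sc) hZ ?oppr_eq0 ?oner_eq0.
have s0 : u + v != 0 by apply: contraTneq uv => /eqP; rewrite addr_eq0 => /eqP ->; rewrite hN ltxx.
split=> //; apply/eqP; rewrite eq_le; apply/andP; split; last first.
  by have := hD u0 v0 s0 Eu Ev; rewrite (min_idPl (ltW uv)).
rewrite leNgt; apply/negP => lt.
have := @hD (u + v) (- v) s0 Nv0; rewrite addrK => /(_ u0 (lin_closedD E_lin Eu Ev) ENv).
by rewrite hN ge_min leNgt lt leNgt uv.
Qed.

Lemma height_sum (I : finType) (c : I -> k) (e : I -> K) : (forall i, E (e i)) ->
  (forall i, e i != 0) -> \sum_i sc (c i) * e i != 0 ->
  exists2 i, c i != 0 & h (e i) <= h (\sum_i sc (c i) * e i).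
Proof.
move=> Ee e0; set s := \sum_i _.
suff : E s /\ (s = 0 \/ exists2 i, c i != 0 & h (e i) <= h s) by case=> _ [->|//]; rewrite eqxx.
rewrite {}/s; elim/big_rec: _ => [|i x _ [Ex IH]]; first by split; [exact: E_lin.1|left].
split; first exact: E_lin.2.
have [ci|ci] := eqVneq (c i) 0; first by rewrite ci rmorph0 mul0r add0r.
have ce0 : sc (c i) * e i != 0 by rewrite mulf_neq0 ?fmorph_eq0.
have Ece : E (sc (c i) * e i) by exact: lin_closedZ.
have hce : h (sc (c i) * e i) = h (e i) by rewrite hZ.
have [x0|x0] := eqVneq x 0; first by right; exists i => //; rewrite x0 addr0 hce.
have [sum0|sum0] := eqVneq (sc (c i) * e i + x) 0; first by left.
right; have := hD ce0 x0 sum0 Ece Ex; rewrite hce ge_min => /orP[hi|hx]; first by exists i.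
case: IH => [/eqP|[j cj hj]]; first by rewrite (negPf x0).
by exists j => //; exact: le_trans hx.
Qed.

Lemma wedge_eq_trans r (t u v : 'I_r -> K) :
  wedge_eq E t u -> wedge_eq E u v -> wedge_eq E t v.
Proof. by move=> tu uv V w aw; rewrite (tu V w aw); exact: uv. Qed.

Lemma dfwith_id r (e : 'I_r -> K) j : dfwith e j (e j) = e.
Proof. by apply/funext => i; case: dfwithP. Qed.

(** For l different from j, the summand a_l e_l repeats e_l in slot j, where alternating maps
    vanish. *)
Lemma wedge_transvection r (e : 'I_r -> K) (j : 'I_r) (a : 'I_r -> k) :
  (forall i, E (e i)) -> a j = 0 ->
  wedge_eq E (dfwith e j (\sum_l sc (a l) * e l + e j)) e.
Proof.
move=> Ee aj V w [wlin walt].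
suff [] : E (\sum_l sc (a l) * e l) /\ w (dfwith e j (\sum_l sc (a l) * e l + e j)) = w e by [].
elim/big_rec: _ => [|l x _ [Ex IH]].
  by split; [exact: E_lin.1|rewrite add0r dfwith_id].
split; first exact: E_lin.2.
rewrite -addrA wlin //; last exact: (lin_closedD E_lin Ex (Ee _)).
rewrite IH; have [->|lj] := eqVneq l j; first by rewrite aj scale0r add0r.
rewrite (walt (dfwith e j (e l)) j l) ?scaler0 ?add0r // 1?eq_sym //.
  by move=> i; case: dfwithP.
by rewrite dfwithin dfwithout // eq_sym.
Qed.

Lemma basis_transvection r (e : 'I_r -> K) (j : 'I_r) (a : 'I_r -> k) :
  a j = 0 -> is_basis E e ->
  is_basis E (dfwith e j (\sum_l sc (a l) * e l + e j)).
Proof.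
move=> aj [Ee ie se]; set e' := dfwith _ _ _.
have sumE (c : 'I_r -> k) :
    \sum_i sc (c i) * e' i = \sum_i sc (c i + c j * a i) * e i.
  rewrite (bigD1 j) //= /e' dfwithin.
  transitivity (sc (c j) * (\sum_l sc (a l) * e l) + \sum_i sc (c i) * e i).
    rewrite mulrDr -addrA; congr (_ + _); rewrite [RHS](bigD1 j) //=; congr (_ + _).
    by apply: eq_bigr => i ij; rewrite dfwithout // eq_sym.
  rewrite addrC mulr_sumr -big_split; apply: eq_bigr => i _ /=.
  by rewrite rmorphD rmorphM mulrDl mulrA.
split.
- move=> i; rewrite /e'; case: dfwithP => [|l _]; last exact: Ee.
  apply: (lin_closedD E_lin _ (Ee _)); exact: (lin_closed_sum _ E_lin Ee).
- move=> c /=; rewrite sumE => /ie c0.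
  have cj : c j = 0 by have := c0 j; rewrite aj mulr0 addr0.
  by move=> i; have := c0 i; rewrite cj mul0r addr0.
- move=> u /se[c /= uc]; exists (fun i => c i - c j * a i) => /=.
  rewrite sumE -[RHS]uc; congr (_ - _); apply: eq_bigr => i _.
  by rewrite aj mulr0 subr0 subrK.
Qed.

Lemma basis_neq0 r (e : 'I_r -> K) i : is_basis E e -> e i != 0.
Proof.
move=> [_ ie _]; apply/eqP => ei.
have /(_ _ i)/eqP := ie (fun l => (l == i)%:R); rewrite eqxx oner_eq0 => /(_ _)/negP; apply => //=.
rewrite (bigD1 i) //= ei mulr0 add0r big1 // => l /negPf ->.
by rewrite rmorph0 mul0r.
Qed.

Definition orthogonal_upto r (j : nat) (e : 'I_r -> K) : Prop :=
  forall c : 'I_r -> k, (forall l : 'I_r, (j <= l)%N -> c l = 0) ->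
  forall i, c i != 0 -> h (\sum_l sc (c l) * e l) <= h (e i).

(** Gram-Schmidt: e_j is replaced by a vector of maximal height in its coset modulo the earlier
    vectors. Heights are real, so the maximum is found by minimising the number [mu] of basis
    vectors at or above the given height. *)
Lemma orthogonal_step r (j : 'I_r) (e : 'I_r -> K) : is_basis E e -> orthogonal_upto j e ->
  exists e', [/\ is_basis E e', orthogonal_upto j.+1 e' & wedge_eq E e' e].
Proof.
move=> be oe; have [Ee ie se] := be; have e0 i := basis_neq0 i be.
pose low (a : 'I_r -> k) := forall l : 'I_r, (j <= l)%N -> a l = 0.
pose v (a : 'I_r -> k) := \sum_l sc (a l) * e l + e j.
pose mu (a : 'I_r -> k) := #|[pred l : 'I_r | h (v a) <= h (e l)]|.
have vE a : v a = \sum_l sc (a l + (l == j)%:R) * e l.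
  rewrite /v [in RHS](eq_bigr (fun l => sc (a l) * e l + (l == j)%:R * e l)); last first.
    by move=> l _; rewrite rmorphD rmorph_nat mulrDl.
  rewrite big_split /=; congr (_ + _); rewrite (bigD1 j) //= eqxx mul1r big1 ?addr0 //.
  by move=> l /negPf ->; rewrite mul0r.
have v0 a : low a -> v a != 0.
  move=> la; rewrite vE; apply/eqP => /ie/(_ j)/eqP.
  by rewrite (la j (leqnn _)) add0r eqxx oner_eq0.
have Ev a : E (v a) by rewrite vE; exact: (lin_closed_sum _ E_lin Ee).
have [a [la amax]] : exists a, low a /\ forall b, low b -> h (v b) <= h (v a).
  pose P m := `[< exists2 a, low a & mu a = m >].
  have exP : exists m, P m by exists (mu (fun=> 0)); apply/asboolP; exists (fun=> 0).
  case: (ex_minnP exP) => m /asboolP[a la am] mmin; exists a; split=> // b lb.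
  rewrite leNgt; apply/negP => ab.
  suff : (mu b < mu a)%N.
    by rewrite am ltnNge mmin //; apply/asboolP; exists b.
  have dE : v a - v b = \sum_l sc (a l - b l) * e l.
    rewrite /v opprD addrACA subrr addr0 -sumrB.
    by apply: eq_bigr => l _; rewrite rmorphB mulrBl.
  have Nvb : - v b != 0 by rewrite oppr_eq0 v0.
  have hN : h (- v b) = h (v b) by rewrite -mulN1r -(rmorphN1 sc) hZ ?oppr_eq0 ?oner_eq0 ?v0.
  have ENvb : E (- v b) by rewrite -mulN1r -(rmorphN1 sc); exact: lin_closedZ.
  (* The difference has height h (v a) and lies in the span of the earlier vectors, so this is the
     height of some [e i], which is counted by [mu a] but not by [mu b]. *)
  have [|d0 dh] := height_lt (Ev a) ENvb (v0 _ la) Nvb; first by rewrite hN.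
  have [i ci hi] : exists2 i, a i - b i != 0 & h (e i) <= h (v a - v b).
    by rewrite dE; apply: height_sum => //; rewrite -dE.
  have hi' : h (v a - v b) <= h (e i).
    rewrite dE; apply: (oe (fun l => a l - b l)) ci => l jl.
    by rewrite la // lb // subrr.
  apply: proper_card; apply/properP; split.
    by apply/fintype.subsetP => l; rewrite !inE; apply: le_trans; exact: ltW.
  exists i; first by rewrite inE -dh.
  by rewrite inE -ltNge; apply: le_lt_trans hi _; rewrite dh.
have aj : a j = 0 by exact: la.
pose e' := dfwith e j (v a).
exists e'; split; [exact: basis_transvection| |exact: wedge_transvection].
move=> c cl i ci.
have e'j : e' j = v a by rewrite /e' dfwithin.
have e'l l : l != j -> e' l = e l by move=> lj; rewrite /e' dfwithout // eq_sym.
have ij : (i <= j)%N by rewrite leqNgt; apply: contraNN ci => ji; rewrite cl.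
have [cj|cj] := eqVneq (c j) 0.
  have ij' : i != j by apply: contraNneq ci => ->; rewrite cj.
  rewrite e'l // (eq_bigr (fun l => sc (c l) * e l)); last first.
    by move=> l _; have [->|lj] := eqVneq l j; rewrite ?cj ?rmorph0 ?mul0r // e'l.
  apply: oe => // l; rewrite leq_eqVlt => /orP[/eqP jl|]; last exact: cl.
  by rewrite -cj; congr c; apply: val_inj.
(* sum = c_j (v a + w) = c_j v (a + c / c_j) *)
pose w (l : 'I_r) := if l == j then 0 else c l / c j.
have lw : low w.
  move=> l; rewrite /w leq_eqVlt => /orP[/eqP jl|jl].
    by rewrite (_ : l == j) //; apply/eqP/val_inj.
  by case: eqP => // _; rewrite cl // mul0r.
have lwa : low (fun l => a l + w l) by move=> l jl; rewrite la // lw // addr0.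
have vwE : v (fun l => a l + w l) = \sum_l sc (w l) * e l + v a.
  rewrite /v addrA -big_split; congr (_ + _); apply: eq_bigr => l _ /=.
  by rewrite rmorphD mulrDl addrC.
have sE : \sum_l sc (c l) * e' l = sc (c j) * v (fun l => a l + w l).
  rewrite (bigD1 j) //= e'j vwE [RHS]mulrDr [RHS]addrC; congr (_ + _).
  rewrite [in RHS](bigD1 j) //= [w j]/w eqxx rmorph0 mul0r add0r mulr_sumr.
  apply: eq_bigr => l lj; rewrite e'l // /w (negPf lj) mulrA -rmorphM.
  by rewrite mulrCA divff // mulr1.
rewrite sE hZ ?v0 //.
have le_va := amax _ lwa.
have [->|ij'] := eqVneq i j; first by rewrite e'j.
rewrite e'l //; apply: (le_trans _ (y := h (\sum_l sc (w l) * e l))); last first.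
  apply: oe => //; rewrite /w (negPf ij'); by rewrite mulf_neq0 ?invr_eq0.
rewrite leNgt; apply/negP => lt.
have Ew : E (\sum_l sc (w l) * e l) by exact: (lin_closed_sum _ E_lin Ee).
have w0 : \sum_l sc (w l) * e l != 0.
  apply/eqP => /ie/(_ i)/eqP; rewrite /w (negPf ij') mulf_eq0 invr_eq0 (negPf cj) (negPf ci) //.
have [_ E1] := height_lt Ew (Ev a) w0 (v0 _ la) (lt_le_trans lt le_va).
by move: lt; rewrite vwE E1 ltxx.
Qed.

Lemma orthogonal_basis r (s : 'I_r -> K) : is_basis E s ->
  exists e, [/\ is_basis E e, wedge_eq E e s &
    forall c i, c i != 0 -> h (\sum_l sc (c l) * e l) <= h (e i)].
Proof.
move=> bs.
have step j : (j <= r)%N ->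
    exists e, [/\ is_basis E e, wedge_eq E e s & orthogonal_upto j e].
  elim: j => [_|j IH jr].
    exists s; split=> // c c0 i /eqP; by rewrite c0.
  have [e [be we oe]] := IH (ltnW jr).
  have [e' [be' oe' we']] := @orthogonal_step _ (Ordinal jr) e be oe.
  by exists e'; split=> //; exact: wedge_eq_trans we' we.
have [e [be we oe]] := step r (leqnn r).
exists e; split=> // c i ci; apply: oe => // l; rewrite leqNgt ltn_ord //.
Qed.

(** * The determinant norm in an orthogonal basis *)

Section Determinant.
Context (r : nat) (e : 'I_r -> K) (be : is_basis E e).

Definition coords (u : K) : 'I_r -> k :=
  xget (fun=> 0) [set c | u = \sum_i sc (c i) * e i].

Lemma coordsE u : E u -> u = \sum_i sc (coords u i) * e i.
Proof.
case: be => _ _ se Eu; rewrite /coords; case: xgetP => [c _ //|no].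
have [c /= /eqP] := se u Eu; rewrite subr_eq0 => /eqP uc.
by have := no c.
Qed.

Lemma coords_uniq u (c : 'I_r -> k) : u = \sum_i sc (c i) * e i -> coords u = c.
Proof.
case: be => Ee ie _ uc.
have Eu : E u by rewrite uc; exact: (lin_closed_sum _ E_lin Ee).
apply/funext => i; apply/eqP; rewrite -subr_eq0; apply/eqP.
apply: (ie (fun i => coords u i - c i)) => /=.
under eq_bigr do rewrite rmorphB mulrBl.
by rewrite sumrB -uc -coordsE // subrr.
Qed.

(** The alternating form with values in k on which the universal equality [wedge_eq] is tested. *)
Definition coord_det (t : 'I_r -> K) : k := \det (\matrix_(i, j) coords (t i) j).

Lemma alternating_coord_det : Defs.alternating E (coord_det : _ -> k^o).
Proof.
split=> [t i c u v Et Eu Ev|t i j Et ij tij].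
  rewrite /coord_det -[X in _ = _ + X]mul1r.
  apply: (@determinant_multilinear _ _ _ _ _ i).
  - apply/rowP => j; rewrite !mxE !dfwithin mul1r.
    rewrite (@coords_uniq _ (fun l => c * coords u l + coords v l)) //.
    rewrite {1}(coordsE Eu) {1}(coordsE Ev) mulr_sumr -big_split.
    by apply: eq_bigr => l _ /=; rewrite rmorphD rmorphM; ring.
  - by apply/matrixP => a b; rewrite !mxE !dfwithout // neq_lift.
  - by apply/matrixP => a b; rewrite !mxE !dfwithout // neq_lift.
by apply: (determinant_alternate ij) => l; rewrite !mxE tij.
Qed.

Lemma coord_det_basis : coord_det e = 1.
Proof.
rewrite /coord_det (_ : \matrix_(i, j) _ = 1%:M) ?det1 //.
apply/matrixP => i j; rewrite !mxE (@coords_uniq _ (fun l => (i == l)%:R)) //.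
rewrite (bigD1 i) //= eqxx rmorph1 mul1r big1 ?addr0 // => l il.
by rewrite eq_sym (negPf il) rmorph0 mul0r.
Qed.

Context (oe : forall c i, c i != 0 -> h (\sum_l sc (c l) * e l) <= h (e i)).

(** The coordinate determinant of t is 1, so some permutation sg picks only nonzero coordinates; as
    [e (sg i)] occurs in [t i], orthogonality gives h (t i) <= h (e (sg i)). *)
Lemma hadamard (t : 'I_r -> K) : (forall i, E (t i)) -> wedge_eq E t e ->
  (forall i, t i != 0) /\ \sum_i h (t i) <= \sum_i h (e i).
Proof.
move=> Et /(_ k^o coord_det alternating_coord_det); rewrite coord_det_basis => dt.
have [sg sgP] : exists sg : 'S_r, forall i, coords (t i) (sg i) != 0.
  apply: contrapT => no; have /eqP := dt; rewrite /coord_det /determinant big1; first by rewrite eq_sym oner_eq0.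
  move=> sg _; have [i /eqP ti] : exists i, ~ (coords (t i) (sg i) != 0).
    by apply/existsNP => h'; apply: no; exists sg.
  by rewrite (bigD1 i) //= mxE; move/eqP: ti => /negP/negPn/eqP ->; rewrite mul0r mulr0.
split=> [i|].
  apply/eqP => ti; have := sgP i; rewrite (@coords_uniq _ (fun=> 0)) ?eqxx //.
  by rewrite ti big1 // => l _; rewrite rmorph0 mul0r.
rewrite [leRHS](reindex_inj (@perm_inj _ sg)) /=; apply: ler_sum => i _.
by rewrite {1}(coordsE (Et i)); exact: oe.
Qed.

Lemma det_norm_orthogonal (N : K -> R) (s : 'I_r -> K) : wedge_eq E e s ->
  (forall u, u != 0 -> E u -> N u = expR (- h u)) ->
  - ln (det_norm E N s) = \sum_i h (e i).
Proof.
move=> we NE; have [Ee _ _] := be.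
have Nprod (t : 'I_r -> K) : (forall i, E (t i)) -> (forall i, t i != 0) ->
    \prod_i N (t i) = expR (- \sum_i h (t i)).
  by move=> Et t0; rewrite -sumrN expR_sum; apply: eq_bigr => i _; exact: NE.
suff -> : det_norm E N s = expR (- \sum_i h (e i)) by rewrite expRK opprK.
rewrite /det_norm; set S := [set c | _].
have lb : lbound S (expR (- \sum_i h (e i))).
  move=> c [t [Et ts ->]].
  have te : wedge_eq E t e by move=> V w aw; rewrite (ts V w aw) (we V w aw).
  have [t0 le] := hadamard Et te.
  by rewrite Nprod // ler_expR lerN2.
have Se : S (expR (- \sum_i h (e i))).
  by exists e; split=> //; rewrite Nprod // => i; exact: basis_neq0.
apply/eqP; rewrite eq_le; apply/andP; split.
  by apply: ge_inf => //; exists (expR (- \sum_i h (e i))).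
by apply: lb_le_inf => //; exists (expR (- \sum_i h (e i))).
Qed.

(** By orthogonality a vector of height at least l involves only basis vectors of height at least
    l. *)
Lemma dimge_height (l : R) m :
  dimge sc [set u | E u /\ (u = 0 \/ l <= h u)] m <->
  (m <= #|[pred i | (l <= h (e i))%R]|)%N.
Proof.
have [Ee ie se] := be; set I := [pred i | _].
split=> [dm|mI].
  apply: (@dimge_span_ord _ _ sc _ m _ (fun i : 'I_#|I| => e (enum_val i))) dm.
  move=> u [Eu hu]; exists (fun i => coords u (enum_val i)).
  rewrite {1}(coordsE Eu) (bigID (mem I)) /= [X in _ + X]big1 ?addr0 => [|i iI].
    by rewrite (big_enum_val (fun i => sc (coords u i) * e i)).
  case: hu => [u0|hu].
    have -> : coords u = (fun=> 0); last by rewrite rmorph0 mul0r.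
    by apply: coords_uniq; rewrite u0 big1 // => j _; rewrite rmorph0 mul0r.
  have [->|ci] := eqVneq (coords u i) 0; first by rewrite rmorph0 mul0r.
  exfalso; move: iI; rewrite inE => /negP; apply; apply: le_trans hu _.
  by rewrite {1}(coordsE Eu); exact: oe.
apply: dimge_le mI _; exists (e \o enum_val); split=> [i|].
  by have := enum_valP i; rewrite inE => hi; split; [exact: Ee|right].
by apply: indep_inj enum_val_inj _ => c; exact: ie.
Qed.

End Determinant.
End OrthogonalBasis.

(** * Distributional derivatives *)

Section Smooth.
Context (R : realType).

(** Recursion on the derivative lets closure under products and composition go by induction on the
    order. *)
Fixpoint smooth_upto (n : nat) (f : R -> R) : Prop :=
  if n is n'.+1 then (forall t, derivable f t 1) /\ smooth_upto n' (derive1 f) else True.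

Definition smooth (f : R -> R) : Prop := forall n, smooth_upto n f.

Lemma smooth_derive1n f : smooth f -> forall n t, derivable (derive1n n f) t 1.
Proof.
move=> sf n; have : smooth_upto n.+1 f by exact: sf.
elim: n f {sf} => [f [] //|n IH f [_ sf] t].
by rewrite /derive1n iterSr; exact: IH.
Qed.

Lemma smooth_uptoW n f : smooth_upto n.+1 f -> smooth_upto n f.
Proof. by elim: n f => // n IH f [df sf]; split=> //; exact: IH. Qed.

Lemma smooth_uptoS n f f' : (forall t : R, is_derive t (1 : R) f (f' t)) ->
  smooth_upto n f' -> smooth_upto n.+1 f.
Proof.
move=> df sf; split=> [t|]; first exact: (@ex_derive _ _ _ _ _ _ _ (df t)).
suff -> : derive1 f = f' by [].
by apply/funext => t; rewrite derive1E; exact: (@derive_val _ _ _ _ _ _ _ (df t)).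
Qed.

Lemma smooth_upto_is_derive n f : smooth_upto n.+1 f ->
  forall t : R, is_derive t (1 : R) f (derive1 f t).
Proof. by move=> [df _] t; rewrite derive1E; exact: derivableP. Qed.

Lemma smooth_uptoD n f g : smooth_upto n f -> smooth_upto n g ->
  smooth_upto n (fun t => f t + g t).
Proof.
elim: n f g => // n IH f g sf sg.
apply: (@smooth_uptoS _ _ (fun t => derive1 f t + derive1 g t)) => [t|].
  have hf := smooth_upto_is_derive sf t; have hg := smooth_upto_is_derive sg t.
  exact: is_deriveD.
by apply: IH; [exact: sf.2|exact: sg.2].
Qed.

Lemma smooth_uptoM n f g : smooth_upto n f -> smooth_upto n g ->
  smooth_upto n (fun t => f t * g t).
Proof.
elim: n f g => // n IH f g sf sg.
apply: (@smooth_uptoS _ _ (fun t => f t * derive1 g t + g t * derive1 f t)) => [t|].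
  have hf := smooth_upto_is_derive sf t; have hg := smooth_upto_is_derive sg t.
  exact: is_deriveM.
by apply: smooth_uptoD; apply: IH;
  [exact: smooth_uptoW|exact: sg.2|exact: smooth_uptoW|exact: sf.2].
Qed.

Lemma smooth_upto_comp n f p : smooth_upto n f -> smooth p ->
  smooth_upto n (fun t => f (p t)).
Proof.
elim: n f => // n IH f sf sp.
apply: (@smooth_uptoS _ _ (fun t => derive1 f (p t) * derive1 p t)) => [t|].
  have hf := smooth_upto_is_derive sf (p t); have hp := smooth_upto_is_derive (sp 1%N) t.
  have := @is_derive1_comp _ f p t _ _ hf hp; exact.
apply: smooth_uptoM; first exact: IH sf.2 sp.
by have [] := sp n.+1.
Qed.

Lemma smooth_affine (a b : R) : smooth (fun t => a * t + b).
Proof.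
have cst_smooth n (c : R) : smooth_upto n (fun=> c).
  elim: n c => // n IH c; have dc (t : R) : is_derive t (1 : R) (fun=> c) 0 by exact: is_derive_cst.
  exact: smooth_uptoS dc (IH 0).
case=> // n; have da (t : R) : is_derive t (1 : R) (fun t => a * t + b) a.
  have := is_deriveD (is_deriveM (is_derive_cst a t 1) (is_derive_id t 1)) (is_derive_cst b t 1).
  by move=> h; apply: is_derive_eq h _; rewrite scaler0 addr0 addr0 /GRing.scale /= mulr1.
exact: smooth_uptoS da (cst_smooth n a).
Qed.

(** * Flat functions, bumps, and uniqueness of the derivative *)

Section Flat.
Context (c : R) (c0 : 0 < c).

(** The classical exp(-c/x) with a polynomial in 1/x in front: the family is stable under
    differentiation, which sends q to X^2 (c q - q'). *)
Definition flat (q : {poly R}) (x : R) : R :=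
  if 0 < x then q.[x^-1] * expR (- (c / x)) else 0.

Lemma expR_pow_bound n : exists2 M, 0 <= M & forall y, 0 < y -> y ^+ n * expR (- (c * y)) <= M.
Proof.
case: n => [|n].
  by exists 1 => // y y0; rewrite mul1r -expR0 ler_expR oppr_le0 mulr_ge0 // ltW.
exists (n.+1`!%:R / c ^+ n.+1); first by rewrite divr_ge0 // exprn_ge0 // ltW.
move=> y y0; have cy0 : 0 <= c * y by rewrite mulr_ge0 // ltW.
rewrite expRN ler_pdivrMr ?expR_gt0 // mulrAC ler_pdivlMr ?exprn_gt0 //.
have h := expR_ge1Dxn n cy0.
have {}h : (c * y) ^+ n.+1 / n.+1`!%:R <= expR (c * y) by apply: le_trans h; rewrite lerDr.
by rewrite ler_pdivrMr ?ltr0n ?fact_gt0 // exprMn in h; rewrite mulrC [leRHS]mulrC.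
Qed.

(** A quadratic bound makes the difference quotient at 0 tend to 0. *)
Lemma flat_bound q : exists2 M, 0 <= M & forall x, `|flat q x| <= M * x ^+ 2.
Proof.
have [M M0 MP] : exists2 M, 0 <= M & forall y, 0 < y ->
    `|q.[y]| * y ^+ 2 * expR (- (c * y)) <= M.
  move: 2%N; elim/poly_ind: q => [|q d IH] n.
    by exists 0 => // y _; rewrite horner0 normr0 !mul0r.
  have [M M0 MP] := IH n.+1; have [N N0 NP] := expR_pow_bound n.
  exists (M + `|d| * N) => [|y y0]; first by rewrite addr_ge0 // mulr_ge0.
  rewrite hornerMXaddC; apply: (@le_trans _ _ (`|q.[y]| * y ^+ n.+1 * expR (- (c * y)) +
     `|d| * (y ^+ n * expR (- (c * y))))); last by rewrite lerD ?MP // ler_wpM2l ?NP.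
  rewrite mulrA -mulrDl ler_wpM2r ?expR_ge0 // exprS mulrA -mulrDl.
  rewrite ler_wpM2r ?exprn_ge0 ?(ltW y0) //.
  by apply: le_trans (ler_normD _ _) _; rewrite normrM (gtr0_norm y0).
exists M => // x; rewrite /flat; case: ifPn => [x0|_]; last by rewrite normr0 mulr_ge0 // sqr_ge0.
have xi0 : 0 < x^-1 by rewrite invr_gt0.
rewrite normrM (ger0_norm (expR_ge0 _)) -ler_pdivrMr ?exprn_gt0 //.
by apply: le_trans (MP _ xi0); rewrite exprVn mulrAC.
Qed.

Lemma flat_derive q x :
  is_derive x (1 : R) (flat q) (flat ('X^2 * (c *: q - q^`())) x).
Proof.
have [x0|x0|x0] := ltgtP x 0.
- have -> : flat ('X^2 * (c *: q - q^`())) x = 0 by rewrite /flat ltNge (ltW x0).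
  apply: (@near_eq_is_derive _ _ _ (cst 0)).
  near=> y; rewrite /flat ifN // -leNgt; apply: ltW; near: y; exact: lt_nbhsl.
- have dq : is_derive x (1 : R) (fun y => q.[y^-1] * expR (- (c / y)))
     (flat ('X^2 * (c *: q - q^`())) x).
    have di : is_derive x (1 : R) (fun y => y^-1) (- x ^- 2).
      have := @is_deriveV R id x 1 1 (lt0r_neq0 x0) (is_derive_id x 1).
      by move=> h; apply: is_derive_eq h _; rewrite /GRing.scale /= mulr1.
    have d1 := @is_derive1_comp _ (horner q) (fun y => y^-1) x _ _ (is_derive_poly q _) di.
    have d2 : is_derive x (1 : R) (fun y => - (c / y)) (- (c * - x ^- 2)).
      exact: is_deriveN.
    have d3 := @is_derive1_comp _ expR (fun y => - (c / y)) x _ _ (is_derive_expR _) d2.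
    have := is_deriveM d1 d3; move=> h; apply: is_derive_eq h _.
    rewrite /flat x0 hornerM hornerXn hornerD hornerN hornerZ exprVn /GRing.scale /=.
    by field; exact: lt0r_neq0.
  apply: near_eq_is_derive dq.
  near=> y; rewrite /flat ifT //; near: y; exact: lt_nbhsr.
- rewrite x0 (_ : flat ('X^2 * (c *: q - q^`())) 0 = 0); last by rewrite /flat ltxx.
  have [M M0 MP] := flat_bound q.
  have f0 : flat q 0 = 0 by rewrite /flat ltxx.
  have cv : h^-1 *: (flat q (h *: (1 : R) + 0) - flat q 0) @[h --> 0^'] --> (0 : R).
    apply/cvgr0Pnorm_lt => e e0; near=> h.
    have h0 : h != 0 by near: h; exact: nbhs_dnbhs_neq.
    rewrite f0 subr0 addr0 /GRing.scale /= mulr1 normrM normfV.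
    rewrite ltr_pdivrMl ?normr_gt0 //.
    apply: le_lt_trans (MP h) _; rewrite -real_normK ?num_real // expr2 mulrCA.
    rewrite ltr_pM2l ?normr_gt0 //.
    have : `|h| < e / (M + 1) by near: h; apply: dnbhs0_lt; rewrite divr_gt0 // ltr_wpDl.
    rewrite ltr_pdivlMr ?ltr_wpDl // => h1; apply: le_lt_trans h1.
    by rewrite mulrC ler_wpM2l // lerDl.
  apply: DeriveDef; last by rewrite /derive; apply/cvg_lim.
  by apply/cvg_ex; exists 0.
Unshelve. all: by end_near. Qed.

Lemma flat_smooth q : smooth (flat q).
Proof.
move=> n; elim: n q => // n IH q.
by apply: smooth_uptoS (IH _) => t; exact: flat_derive.
Qed.

End Flat.

(** The constant 1/(m+1) in the exponents tends to 0, so the bumps increase in height towards the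
    indicator of ]a, b[ while keeping the same support. *)
Definition bump (a b : R) (m : nat) (x : R) : R :=
  flat m.+1%:R^-1 1 (x - a) * flat m.+1%:R^-1 1 (b - x).

Lemma bumpE a b m x : bump a b m x =
  if a < x < b then expR (- (m.+1%:R^-1 / (x - a)) - m.+1%:R^-1 / (b - x)) else 0.
Proof.
rewrite /bump /flat !subr_gt0; case: ltP => ax; last by rewrite mul0r.
case: ltP => xb; last by rewrite mulr0.
by rewrite -polyC1 !hornerC !mul1r -expRD.
Qed.

Lemma bump_test a b m : 0 < a -> test_function (bump a b m).
Proof.
move=> a0; have m0 : 0 < m.+1%:R^-1 :> R by rewrite invr_gt0.
split; last first.
  exists a, b; split=> // t tab; rewrite bumpE ifN //; apply/negP => /andP[at_ tb].
  by apply: tab; rewrite !ltW.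
apply: smooth_derive1n => n; apply: smooth_uptoM.
  have := @smooth_upto_comp n _ (fun t => 1 * t - a) (flat_smooth m0 1 n) (@smooth_affine 1 (- a)).
  by congr smooth_upto; apply/funext => t; rewrite mul1r.
have := @smooth_upto_comp n _ (fun t => -1 * t + b) (flat_smooth m0 1 n) (@smooth_affine (-1) b).
by congr smooth_upto; apply/funext => t; rewrite mulN1r addrC.
Qed.

Lemma bump_bound a b m x : 0 <= bump a b m x <= 1.
Proof.
rewrite bumpE; case: ifPn => [/andP[ax xb]|_]; last by rewrite lexx ler01.
rewrite expR_ge0 /= -expR0 ler_expR -opprD oppr_le0.
by rewrite addr_ge0 // divr_ge0 ?invr_ge0 // subr_ge0 ltW.
Qed.

Lemma bump_cvg a b x : bump a b m x @[m --> \oo] --> (\1_(`]a, b[ : set R) x : R).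
Proof.
rewrite indicE; have [xab|xab] := boolP (a < x < b); last first.
  rewrite memNset; last by rewrite /= in_itv /= (negPf xab).
  by under eq_fun do rewrite bumpE (negPf xab); exact: cvg_cst.
rewrite mem_set; last by rewrite /= in_itv.
under eq_fun do rewrite bumpE xab.
suff h : expR (- (m.+1%:R^-1 / (x - a)) - m.+1%:R^-1 / (b - x)) @[m --> \oo] --> expR (0 : R).
  by rewrite expR0 in h.
apply: continuous_cvg; first exact: continuous_expR.
have hc : @harmonic R @ \oo --> (0 : R) by exact: cvg_harmonic.
have hz (z : R) : (@harmonic R m / z) @[m --> \oo] --> (0 : R).
  by rewrite -[X in _ --> X](mul0r z^-1); apply: cvgM => //; exact: cvg_cst.
have := cvgB (cvgN (hz (x - a))) (hz (b - x)).
rewrite oppr0 addr0; exact.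
Qed.

Local Notation mu := (@lebesgue_measure R).

Lemma locally_integrable_segment (u : R -> R) a b : 0 < a ->
  locally_integrable (`]0, +oo[ : set R) u -> mu.-integrable `[a, b] (EFin \o u).
Proof.
move=> a0 [mu_ _ iu].
have sub : (`[a, b] : set R) `<=` (`]0, +oo[ : set R).
  by move=> x /=; rewrite !in_itv /= andbT => /andP[/(lt_le_trans a0)].
apply/integrableP; split; last by apply: iu => //; exact: segment_compact.
by apply/measurable_EFinP; apply: measurable_funS mu_.
Qed.

Lemma measurable_bump a b m : measurable_fun setT (bump a b m).
Proof.
have m0 : 0 < m.+1%:R^-1 :> R by rewrite invr_gt0.
have cf : continuous (flat m.+1%:R^-1 1).
  move=> x; apply: differentiable_continuous; apply/derivable1_diffP.
  by have [] := flat_smooth m0 1 1.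
apply: measurable_funM; apply: measurableT_comp.
- exact: continuous_measurable_fun.
- by apply: measurable_funD => //; exact: measurable_cst.
- exact: continuous_measurable_fun.
- by apply: measurable_funB => //; exact: measurable_cst.
Qed.

Lemma bump_pairing (u : R -> R) a b : 0 < a ->
  locally_integrable (`]0, +oo[ : set R) u ->
  (Rintegral mu (`]0, +oo[ : set R) (fun t => u t * bump a b m t)) @[m --> \oo] -->
  Rintegral mu (`]a, b[ : set R) u.
Proof.
move=> a0 iu; have iab := locally_integrable_segment b a0 iu.
have mu_ : measurable_fun (`[a, b] : set R) u.
  by apply/measurable_EFinP; case/integrableP: iab.
have -> : Rintegral mu (`]a, b[ : set R) u =
    fine (\int[mu]_(x in (`[a, b] : set R)) ((u \_ (`]a, b[ : set R)) x)%:E)%E.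
  rewrite -[RHS]/(Rintegral mu _ _) Rintegral_mkcond [RHS]Rintegral_mkcond.
  congr Rintegral; apply/funext => t; rewrite !patchE.
  case: ifPn => //; last by rewrite if_same.
  rewrite inE /= in_itv /= => /andP[at_ tb]; rewrite mem_set //= in_itv /=.
  by rewrite !ltW.
have E m : Rintegral mu (`]0, +oo[ : set R) (fun t => u t * bump a b m t) =
    fine (\int[mu]_(x in (`[a, b] : set R)) (u x * bump a b m x)%:E)%E.
  rewrite -[RHS]/(Rintegral mu _ _) Rintegral_mkcond [RHS]Rintegral_mkcond.
  congr Rintegral; apply/funext => t; rewrite !patchE bumpE.
  have [/andP[at_ tb]|_] := boolP (a < t < b); last by rewrite !mulr0 !if_same.
  by rewrite !mem_set //= in_itv /= ?andbT; [rewrite !ltW|exact: lt_trans at_].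
under eq_fun do rewrite E.
have mab : measurable (`[a, b] : set R) by exact: measurable_itv.
have [|||||i1 _ cv] := @dominated_convergence _ _ R mu (`[a, b] : set R) mab
  (fun m x => (u x * bump a b m x)%:E) (fun x => ((u \_ (`]a, b[ : set R)) x)%:E)
  (fun x => `|u x|%:E).
- move=> m; apply/measurable_EFinP; apply: measurable_funM => //.
  by apply: measurable_funS (measurable_bump a b m).
- apply/measurable_EFinP; apply: (measurable_funS measurableT) => //.
  apply/(measurable_restrictT u) => //; apply: (measurable_funS mab) mu_.
  by move=> x /=; rewrite !in_itv /= => /andP[h1 h2]; rewrite !ltW.
- apply: aeW => x _; apply/cvg_EFin; first by near=> m.
  rewrite /comp /= patchE -[X in _ --> X](_ : u x * \1_(`]a, b[ : set R) x = _).
    by apply: cvgM; [exact: cvg_cst|exact: bump_cvg].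
  by rewrite indicE; case: ifP => _; rewrite ?mulr1 ?mulr0.
- exact: integrable_norm iab.
- apply: aeW => x m _; rewrite /= lee_fin normrM.
  have /andP[h1 h2] := bump_bound a b m x.
  by rewrite (ger0_norm h1) ler_piMr.
- by apply: fine_cvg; rewrite fineK //; exact: integrable_fin_num.
Unshelve. all: by end_near. Qed.

(** The primitive of w, extended by 0 outside ]a, c[, is identically zero, and by Lebesgue
    differentiation its derivative is w almost everywhere. *)
Lemma zero_integrals_ae (w : R -> R) a c :
  mu.-integrable (`]a, c[ : set R) (EFin \o w) ->
  (forall x, a < x <= c -> Rintegral mu (`]a, x[ : set R) w = 0) ->
  \forall x \ae mu, a < x < c -> w x = 0.
Proof.
move=> iw w0; pose f := w \_ (`]a, c[ : set R).
have iff : mu.-integrable setT (EFin \o f).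
  by rewrite -restrict_EFin; apply/(integrable_mkcond _ _).1.
have locf : locally_integrable setT f by apply: open_integrable_locally => //; exact: openT.
have iy y : mu.-integrable [set` Interval (BRight a) (BRight y)] (EFin \o f).
  by apply: integrableS iff.
have := @FTC1 R f (BRight a) iy locf.
have F0 x : Rintegral mu [set` Interval (BRight a) (BRight x)] f = 0.
  rewrite -Rintegral_itv_bndo_bndc; last by apply: integrableS iff.
  have [xa|ax] := leP x a.
    have -> : `]a, x[%classic = set0 :> set R by apply: set_itv_ge; rewrite bnd_simp -leNgt.
    exact: Rintegral_set0.
  have [xc|cx] := leP x c.
    rewrite -[RHS](w0 x) ?ax //; apply: eq_Rintegral => t.
    rewrite inE /= in_itv /= => /andP[at_ tx]; rewrite /f /patch mem_set //= in_itv /= at_.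
    exact: lt_le_trans xc.
  have [ca|ac] := leP c a.
    rewrite (@eq_Rintegral _ _ _ mu _ (cst 0)); first by rewrite Rintegral_cst // mul0r.
    move=> t _ /=; rewrite /f /patch ifN //; apply/negP.
    by rewrite inE /= in_itv /= => /andP[/lt_trans h /h]; rewrite ltNge ca.
  rewrite -[RHS](w0 c) ?ac ?lexx // Rintegral_mkcond [RHS]Rintegral_mkcond.
  congr Rintegral; apply/funext => t; rewrite /f /patch.
  case: ifPn => [|ntx]; first by [].
  rewrite ifN //; apply: contra ntx; rewrite !inE /= !in_itv /= => /andP[-> tc].
  exact: lt_trans cx.
apply: filterS; first exact: (ae_filter_ringOfSetsType mu).
move=> x h /andP[ax xc].
have [_] := h ax.
rewrite (_ : (fun x0 => _) = cst 0); last by apply/funext => y; exact: F0.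
by rewrite derive1_cst /f /patch mem_set //= in_itv /= ax.
Qed.

(** Needed because [energy] reads its value off an arbitrarily chosen derivative. Testing against
    bumps equates the integrals of u and v over all ]a, b[ with a > 0. *)
Lemma distr_derivative_unique (f u v : R -> R) :
  distr_derivative f u -> distr_derivative f v ->
  \forall x \ae mu, 0 < x -> u x = v x.
Proof.
move=> [iu fu] [iv fv].
have eq_int a b : 0 < a -> Rintegral mu (`]a, b[ : set R) u = Rintegral mu (`]a, b[ : set R) v.
  move=> a0; have hu := @bump_pairing u a b a0 iu; have hv := @bump_pairing v a b a0 iv.
  have E : (fun m => Rintegral mu (`]0, +oo[ : set R) (fun t => u t * bump a b m t)) =
      (fun m => Rintegral mu (`]0, +oo[ : set R) (fun t => v t * bump a b m t)).
    apply/funext => m; apply: oppr_inj.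
    by rewrite -(fu _ (bump_test b m a0)) (fv _ (bump_test b m a0)).
  rewrite E in hu; exact: cvg_unique hu hv.
(* These intervals exhaust ]0, +oo[ and stay away from 0, near which u and v may fail to be
   integrable. *)
have : \forall x \ae mu, forall n : nat, n.+1%:R^-1 < x < n.+1%:R -> (u \- v) x = 0.
  apply: ae_foralln => n; have a0 : 0 < n.+1%:R^-1 :> R by rewrite invr_gt0.
  have sub (z y : R) : (`]z, y[ : set R) `<=` (`[z, y] : set R).
    by move=> t /=; rewrite !in_itv /= => /andP[h1 h2]; rewrite !ltW.
  have ioo (h : R -> R) y : locally_integrable (`]0, +oo[ : set R) h ->
      mu.-integrable (`]n.+1%:R^-1, y[ : set R) (EFin \o h).
    by move=> ih; apply: integrableS (locally_integrable_segment y a0 ih) => //; exact: sub.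
  apply: zero_integrals_ae; first by have := integrableB _ (ioo u n.+1%:R iu) (ioo v n.+1%:R iv); exact.
  move=> x _; rewrite RintegralB //; [|exact: ioo..].
  by rewrite eq_int // subrr.
apply: filterS; first exact: (ae_filter_ringOfSetsType mu).
move=> x h x0; apply/eqP; rewrite -subr_eq0; apply/eqP.
pose n := Num.truncn (Num.max x x^-1).
apply: (h n); have := truncnS_gt (Num.max x x^-1).
rewrite -/n gt_max => /andP[-> h2]; rewrite andbT.
by rewrite -[x]invrK ltf_pV2 // posrE ?invr_gt0.
Qed.

Lemma energyE (f u : R -> R) : distr_derivative f u ->
  energy f = (\int[mu]_(t in (`]0%R, +oo[ : set R)) ((u t) ^+ 2)%:E)%E.
Proof.
move=> fu; rewrite /energy; case: xgetP => [e _ [v fv ->]|/(_ (\int[mu]_(t in (`]0%R, +oo[ : set R)) ((u t) ^+ 2)%:E)%E)]; last first.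
  by case; exists u.
have msq (h : R -> R) : distr_derivative f h ->
    measurable_fun (`]0, +oo[ : set R) (fun t => ((h t) ^+ 2)%:E).
  by move=> [[mh _ _] _]; apply/measurable_EFinP; exact: measurable_funX.
apply: ge0_ae_eq_integral => //; [exact: msq|exact: msq|..].
- by move=> x _; rewrite lee_fin sqr_ge0.
- by move=> x _; rewrite lee_fin sqr_ge0.
have := distr_derivative_unique fv fu.
apply: filterS; first exact: (ae_filter_ringOfSetsType mu).
move=> x h /=.
by rewrite in_itv /= andbT => /h ->.
Qed.

End Smooth.

(** * The layer-cake formula *)

Section LayerCake.
Context (R : realType).
Local Notation mu := (@lebesgue_measure R).

Lemma measurable_superlevel (f : R -> R) : measurable_fun setT f ->
  measurable [set z : R * R | 0 < z.2 < f z.1].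
Proof.
move=> mf.
have mlt (g h : R * R -> R) : measurable_fun setT g -> measurable_fun setT h ->
    measurable [set z | g z < h z].
  move=> mg mh; have := measurable_fun_ltr mg mh.
  move=> /(_ measurableT [set true] I); rewrite setTI.
  by congr measurable; apply/seteqP; split=> z /=.
rewrite (_ : [set z | _] = [set z : R * R | 0 < z.2] `&` [set z | z.2 < f z.1]); last first.
  by apply/seteqP; split=> z /=; [move=> /andP[-> ->]|move=> [-> ->]].
apply: measurableI; first by apply: mlt; [exact: measurable_cst|exact: measurable_snd].
by apply: mlt; [exact: measurable_snd|apply: measurableT_comp => //; exact: measurable_fst].
Qed.

Lemma layer_cake (f : R -> R) : measurable_fun setT f ->
  (\int[mu]_x (Num.max 0 (f x))%:E = \int[mu]_(l in (`]0%R, +oo[ : set R)) mu [set x | (l < f x)%R])%E.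
Proof.
move=> mf; pose A := [set z : R * R | 0 < z.2 < f z.1].
have mA : measurable A by exact: measurable_superlevel.
have mF : measurable_fun setT (fun z : R * R => (\1_A z)%:E : \bar R).
  by apply/measurable_EFinP; exact: measurable_indic.
have F0 (z : R * R) : (0 <= (\1_A z)%:E :> \bar R)%E by rewrite lee_fin indicE.
have E := @fubini_tonelli _ _ _ _ R mu mu _ mF F0.
transitivity (\int[mu]_x \int[mu]_y (\1_A (x, y))%:E)%E.
  apply: eq_integral => x _.
  rewrite (_ : (fun y => _) = (fun y => (\1_(`]0, f x[ : set R) y)%:E)); last first.
    by apply/funext => y; rewrite !indicE /A !mem_setE.
  rewrite integral_indic // setIT /= lebesgue_measure_itv /= lte_fin.
  by rewrite maxElt; case: ifPn => // _; rewrite oppr0 addr0.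
rewrite E [RHS]integral_mkcond; apply: eq_integral => l _.
rewrite patchE; case: ifPn; rewrite ?inE ?notin_setE /= in_itv /= andbT => l0; last first.
  rewrite integral0_eq // => x _; rewrite indicE /A memNset //=.
  by move=> /andP[].
rewrite (_ : (fun x => _) = (fun x => (\1_[set x | l < f x] x)%:E)); last first.
  apply/funext => x; rewrite !indicE; congr ((_ : bool)%:R%:E).
  by apply/idP/idP; rewrite !inE /A /=; [case/andP|move=> ->; rewrite andbT].
rewrite integral_indic ?setIT //.
have := measurable_fun_ltr (measurable_cst l) mf.
move=> /(_ measurableT [set true] I); rewrite setTI.
by congr measurable; apply/seteqP; split=> z /=.
Qed.

End LayerCake.

(** * The energy of a convex function *)

Section Slopes.
Context (R : realType).
Local Notation mu := (@lebesgue_measure R).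

(* Halving [s, t] halves the bound, so the variation vanishes. *)
Lemma halving_const (G w : R -> R) (a b : R) : a <= b ->
  (forall s t, a <= s -> s < t -> t <= b -> `|G t - G s| <= (w t - w s) * (t - s)) ->
  G b = G a.
Proof.
move=> ab GP; have [->//|ab'] := eqVneq b a.
have {ab ab'}ab : a < b by rewrite lt_neqAle eq_sym ab' ab.
have half N : forall s t, a <= s -> s < t -> t <= b ->
    `|G t - G s| <= (w t - w s) * (t - s) / 2 ^+ N.
  elim: N => [|N IH] s t as_ st tb; first by rewrite expr0 divr1; exact: GP.
  pose m := (s + t) / 2.
  have sm : s < m by rewrite /m; lra.
  have mt : m < t by rewrite /m; lra.
  have h1 := IH s m as_ sm (ltW (lt_le_trans mt tb)).
  have h2 := IH m t (ltW (le_lt_trans as_ sm)) mt tb.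
  have -> : G t - G s = (G t - G m) + (G m - G s) by ring.
  apply: le_trans (ler_normD _ _) _; apply: le_trans (lerD h2 h1) _.
  rewrite le_eqVlt; apply/orP; left; apply/eqP.
  rewrite exprS /m; field; by rewrite expf_neq0.
apply/eqP; rewrite -subr_eq0 -normr_eq0; apply: contraT => d0.
have {}d0 : 0 < `|G b - G a| by rewrite lt_def d0 normr_ge0.
set M := (w b - w a) * (b - a).
pose N := (Num.truncn (M / `|G b - G a|)).+1.
have MN : M < `|G b - G a| * N%:R.
  by rewrite mulrC -ltr_pdivrMr //; exact: truncnS_gt.
have := half N a b (lexx _) ab (lexx _); rewrite -/M ler_pdivlMr ?exprn_gt0 //.
move=> h; have := le_lt_trans h MN; rewrite ltr_pM2l // -natrX ltr_nat.
by rewrite ltnNge ltnW // ltn_expl.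
Qed.

Lemma nonincreasing_measurable_pos (f : R -> R) :
  (forall s t, 0 < s -> s <= t -> f t <= f s) -> measurable_fun (`]0, +oo[ : set R) f.
Proof.
move=> fP; have m0 : measurable (`]0, +oo[ : set R) by exact: measurable_itv.
apply: (measurability (@RGenCInfty.G R)) => [|/= _ [_] [r] -> <-].
  exact: RGenCInfty.measurableE.
apply: is_interval_measurable => s t /= [+ ss] [+ tt] x /andP[sx xt].
rewrite !in_itv /= !andbT in ss tt * => s0 t0.
have x0 : 0 < x by exact: lt_le_trans sx.
by split=> //; apply: le_trans tt _; exact: fP.
Qed.

Lemma bounded_integrable_oc (f : R -> R) a b M : 0 < a ->
  measurable_fun (`]0, +oo[ : set R) f -> (forall x, a <= x <= b -> `|f x| <= M) ->
  mu.-integrable `]a, b] (EFin \o f).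
Proof.
move=> a0 mf fM; apply: measurable_bounded_integrable => //.
- by rewrite /= lebesgue_measure_itv /=; case: ifP => // _; rewrite -EFinD ltry.
- apply: measurable_funS mf => //.
  by move=> x /=; rewrite !in_itv /= andbT => /andP[/(lt_trans a0)].
- exists M; split; first exact: num_real.
  move=> N MN x /=; rewrite in_itv /= => /andP[ax xb].
  by apply: le_trans (ltW MN); apply: fM; rewrite (ltW ax).
Qed.

Lemma dist_mean (c d h I : R) :
  (c - d) * h <= I -> I <= (c + d) * h -> `|I - c * h| <= d * h.
Proof. by move=> h1 h2; rewrite ler_norml; apply/andP; split; lra. Qed.

(** A fundamental theorem for integrands that may jump: the error on [s, t] is an increment of w
    times the length, and such errors vanish under subdivision by [halving_const]. *)
Lemma FTC_halving (G F w : R -> R) a b : a <= b ->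
  mu.-integrable `]a, b] (EFin \o F) ->
  (forall s t y, a <= s -> s < y -> y <= t -> t <= b ->
     `|G t - G s - F y * (t - s)| <= (w t - w s) * (t - s)) ->
  \int[mu]_(x in `]a, b]) F x = G b - G a.
Proof.
move=> ab iF FP.
pose H x := \int[mu]_(y in `]a, x]) F y - G x.
have Ha : H a = - G a.
  by rewrite /H set_itv_ge ?bnd_simp ?ltxx // Rintegral_set0 add0r.
suff HE : H b = H a by rewrite -[LHS](subrK (G b)) -/(H b) HE Ha addrC.
apply: (@halving_const H w) => // s t as_ st tb.
have ts : 0 < t - s by rewrite subr_gt0.
have iFsub x y : a <= x -> y <= b -> mu.-integrable `]x, y] (EFin \o F).
  by move=> ax yb; apply: integrableS iF => // z /=; rewrite !in_itv /= =>
    /andP[xz zy]; rewrite (le_lt_trans ax xz) (le_trans zy yb).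
pose c := (G t - G s) / (t - s); pose d := w t - w s.
have Fcd y : s < y -> y <= t -> c - d <= F y <= c + d.
  move=> sy yt; have := FP s t y as_ sy yt tb.
  rewrite -[X in `|X - _|](divfK (lt0r_neq0 ts)) -mulrBl normrM (gtr0_norm ts).
  by rewrite ler_pM2r // -/c ler_distlC.
have cst_int (e : R) : \int[mu]_(x in `]s, t]) e = e * (t - s).
  by rewrite Rintegral_cst // /= lebesgue_measure_itv /= lte_fin st.
have icst (e : R) : mu.-integrable `]s, t] (EFin \o cst e).
  apply: measurable_bounded_integrable => //=.
  - by rewrite lebesgue_measure_itv /= lte_fin st -EFinD ltry.
  - exists `|e|; split; first exact: num_real.
    by move=> M eM x _; exact: ltW.
have ist := iFsub s t as_ tb.
have /andP[lo hi] : (c - d) * (t - s) <= \int[mu]_(x in `]s, t]) F x <= (c + d) * (t - s).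
  rewrite -!cst_int; apply/andP; split; apply: le_Rintegral => //;
    try (exact: icst); move=> x;
    by rewrite /= in_itv /= => /andP[sx xt]; case/andP: (Fcd x sx xt).
have -> : H t - H s = \int[mu]_(x in `]s, t]) F x - (G t - G s).
  rewrite -(@Rintegral_itvB _ F (BRight a) (BRight t) s) ?bnd_simp ?(ltW st) //.
    by rewrite /H; ring.
  exact: iFsub.
have cE : c * (t - s) = G t - G s by rewrite divfK ?lt0r_neq0.
by rewrite -cE; exact: dist_mean.
Qed.

Lemma continuous_bounded (f : R -> R) a b : continuous f ->
  exists2 M, 0 <= M & forall x, a <= x <= b -> `|f x| <= M.
Proof.
move=> cf; have [ab|ab] := leP a b; last first.
  by exists 0 => // x /andP[ax xb]; move: (le_trans ax xb); rewrite leNgt ab.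
have [|c _ cP] := @EVT_max R (fun x => `|f x|) a b ab.
  apply: continuous_subspaceT => x; apply: continuous_comp; first exact: cf.
  exact: norm_continuous.
by exists `|f c| => // x xab; apply: cP; rewrite in_itv.
Qed.

Lemma MVT_derive1 (f : R -> R) s t : (forall x, derivable f x 1) -> s <= t ->
  exists2 c, s <= c <= t & f t - f s = derive1 f c * (t - s).
Proof.
move=> df st; have [||c] := @MVT_segment R f (derive1 f) s t st.
- by move=> x _; rewrite derive1E; exact: derivableP.
- apply: derivable_within_continuous => x _; exact: df.
- by rewrite in_itv /= => cst fE; exists c.
Qed.

Lemma test_function_continuous (psi : R -> R) n : test_function psi ->
  continuous (derive1n n psi).
Proof.
by move=> [dpsi _] x; apply: differentiable_continuous; apply/derivable1_diffP; exact: dpsi.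
Qed.

Context (phi : R -> R).
Context (phi_conv : forall a b c, 0 <= a -> a < b -> b < c ->
  (phi b - phi a) * (c - b) <= (phi c - phi b) * (b - a)).
Context (phi_mono : forall a b, 0 <= a -> a <= b -> phi b <= phi a).

(* Minus the right derivative, as phi is convex. *)
Definition slope (s : R) : R :=
  sup [set (phi s - phi (s + h)) / h | h in [set h : R | 0 < h]].

Lemma slope_le s t : 0 < s -> s < t -> slope t <= (phi s - phi t) / (t - s).
Proof.
move=> s0 st; apply: ge_sup; first by exists ((phi t - phi (t + 1)) / 1); exists 1 => //=.
move=> _ [h /= h0 <-]; rewrite ler_pdivrMr // mulrAC ler_pdivlMr ?subr_gt0 //.
have := @phi_conv s t (t + h) (ltW s0) st; rewrite ltrDl h0 => /(_ isT); lra.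
Qed.

Lemma slope_ge s t : 0 < s -> s < t -> (phi s - phi t) / (t - s) <= slope s.
Proof.
move=> s0 st; apply: sup_ubound; last first.
  by exists (t - s); rewrite /= ?subr_gt0 // addrCA subrr addr0.
exists ((phi (s / 2) - phi s) / (s / 2)) => _ [h /= h0 <-].
have s2 : 0 < s / 2 by rewrite divr_gt0.
rewrite ler_pdivrMr // mulrAC ler_pdivlMr //.
have := @phi_conv (s / 2) s (s + h) (ltW s2); rewrite ltrDl h0 => /(_ _ isT).
have -> : s - s / 2 = s / 2 by field.
move=> /(_ _); have -> : s / 2 < s by lra.
move=> /(_ isT); lra.
Qed.

Lemma slope_ge0 s : 0 < s -> 0 <= slope s.
Proof.
move=> s0; apply: le_trans (@slope_ge s (s + 1) s0 _); last by rewrite ltrDl.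
by rewrite divr_ge0 // ?subr_ge0; [apply: phi_mono; lra|lra].
Qed.

Lemma slope_nincr s t : 0 < s -> s <= t -> slope t <= slope s.
Proof.
move=> s0; rewrite le_eqVlt => /orP[/eqP -> //|st].
exact: le_trans (slope_le s0 st) (slope_ge s0 st).
Qed.

Lemma measurable_slope : measurable_fun (`]0, +oo[ : set R) slope.
Proof. by apply: nonincreasing_measurable_pos; exact: slope_nincr. Qed.

Lemma measurable_phi : measurable_fun (`]0, +oo[ : set R) phi.
Proof. by apply: nonincreasing_measurable_pos => s t s0; apply: phi_mono; exact: ltW. Qed.

Lemma integrable_slope a b : 0 < a -> mu.-integrable `]a, b] (EFin \o slope).
Proof.
move=> a0; apply: (@bounded_integrable_oc _ _ _ (slope a)) => //; first exact: measurable_slope.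
move=> x /andP[ax _]; rewrite ger0_norm ?slope_ge0 ?(lt_le_trans a0) //.
exact: slope_nincr.
Qed.

Lemma slope_mean s t : 0 < s -> s < t ->
  slope t * (t - s) <= phi s - phi t <= slope s * (t - s).
Proof.
move=> s0 st; have := slope_le s0 st; have := slope_ge s0 st.
by rewrite ler_pdivrMr ?subr_gt0 // ler_pdivlMr ?subr_gt0 // => -> ->.
Qed.

Lemma FTC_slope a b : 0 < a -> a <= b ->
  \int[mu]_(x in `]a, b]) slope x = phi a - phi b.
Proof.
move=> a0 ab; have := @FTC_halving (fun x => - phi x) slope (fun x => - slope x) a b ab.
rewrite opprK addrC => -> //; first exact: integrable_slope.
move=> s t y as_ sy yt tb; have s0 : 0 < s by exact: lt_le_trans as_.
have st : s < t by exact: lt_le_trans yt.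
have ts : 0 < t - s by rewrite subr_gt0.
have /andP[h1 h2] := slope_mean s0 st.
have h3 := slope_nincr s0 (ltW sy); have h4 := slope_nincr (lt_trans s0 sy) yt.
have h5 : slope y * (t - s) <= slope s * (t - s) by rewrite ler_pM2r.
have h6 : slope t * (t - s) <= slope y * (t - s) by rewrite ler_pM2r.
rewrite ler_norml; apply/andP; split; lra.
Qed.

Lemma locally_integrable_slope : locally_integrable (`]0, +oo[ : set R) (fun t => - slope t).
Proof.
apply: locally_integrableN; split; [exact: measurable_slope|exact: interval_open|].
move=> C C0 cC; have clC := compact_closed (@Rhausdorff R) cC.
have [M [_ CM]] := compact_bounded cC.
have : (~` C) 0 by move=> /C0 /=; rewrite in_itv /= ltxx.
have /open_nbhs_nbhs : open_nbhs (0 : R) (~` C).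
  split; first exact: closed_openC.
  by move=> /C0 /=; rewrite in_itv /= ltxx.
move=> /nbhs_ballP[e /= e0 eC] _.
have CS : C `<=` `](e / 2), M + 1].
  move=> x Cx /=; rewrite in_itv /=; apply/andP; split.
    have := C0 x Cx; rewrite /= in_itv /= andbT => x0.
    rewrite ltNge; apply/negP => xe; apply: (eC x) => //.
    rewrite /ball /= sub0r normrN gtr0_norm //; lra.
  by apply: le_trans (ler_norm x) _; apply: CM => //; rewrite ltrDl.
have iC : mu.-integrable C (EFin \o slope).
  apply: integrableS (@integrable_slope (e / 2) (M + 1) _) => //.
    exact: compact_measurable.
  by rewrite divr_gt0.
by case/integrableP: iC.
Qed.

Lemma Rintegral_supp (F : R -> R) a b c d : 0 < c -> c < a -> b <= d ->
  (forall t, ~ (a <= t <= b) -> F t = 0) ->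
  \int[mu]_(t in (`]0%R, +oo[ : set R)) F t = \int[mu]_(t in (`]c, d] : set R)) F t.
Proof.
move=> c0 ca bd F0; rewrite Rintegral_mkcond [RHS]Rintegral_mkcond.
congr Rintegral; apply/funext => t; rewrite !patchE.
have [tab|/F0 ->] := pselect (a <= t <= b); last by rewrite !if_same.
have /andP[ta tb] := tab; rewrite !mem_set //= in_itv /= ?andbT.
  by rewrite (lt_le_trans ca ta) (le_trans tb bd).
by rewrite (lt_le_trans c0) // (le_trans (ltW ca)).
Qed.

(** Integration by parts: phi psi serves as a primitive of phi psi' - slope psi, although phi need
    not be differentiable everywhere, and it vanishes at both ends. *)
Lemma slope_distr : distr_derivative phi (fun t => - slope t).
Proof.
split; first exact: locally_integrable_slope.
move=> psi tpsi; have [dpsi [a [b [a0 psi0]]]] := tpsi.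
(* Both ends lie strictly outside the support, and [al] stays positive; the maximum covers the case
   b < a. *)
pose al := a / 2; pose be := Num.max a b + 1.
have al0 : 0 < al by rewrite divr_gt0.
have ala : al < a by rewrite /al; lra.
have aM : a <= Num.max a b by rewrite le_max lexx.
have bM : b <= Num.max a b by rewrite le_max lexx orbT.
have abe : a < be by rewrite /be; lra.
have bbe : b < be by rewrite /be; lra.
have albe : al <= be by apply: ltW; exact: lt_trans abe.
have out t : ~ (a <= t <= b) -> derive1 psi t = 0.
  move=> nt; rewrite derive1E.
  have nearE : {near t, psi =1 cst 0}.
    have /orP[ta|bt] : (t < a) || (b < t).
      by apply: contrapT => /negP; rewrite negb_or -!leNgt => /andP[h1 h2]; apply: nt; rewrite h1.
    - near=> y; apply: psi0 => /andP[ay _]; move: ay; rewrite leNgt => /negP; apply.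
      by near: y; exact: lt_nbhsl.
    - near=> y; apply: psi0 => /andP[_ yb]; move: yb; rewrite leNgt => /negP; apply.
      by near: y; exact: lt_nbhsr.
  by rewrite (near_eq_derive _ nearE) derive_cst.
have cpsi : continuous psi by have := @test_function_continuous psi 0 tpsi.
have cpsi1 : continuous (derive1 psi) by have := @test_function_continuous psi 1 tpsi.
have cpsi2 : continuous (derive1 (derive1 psi)) by have := @test_function_continuous psi 2 tpsi.
have dpsi0 : forall x, derivable psi x 1 by move=> x; exact: (dpsi 0%N).
have dpsi1 : forall x, derivable (derive1 psi) x 1 by move=> x; exact: (dpsi 1%N).
have [P P0 PP] := continuous_bounded al be cpsi.
have [L L0 LP] := continuous_bounded al be cpsi1.
have [L2 L20 L2P] := continuous_bounded al be cpsi2.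
have lip (f : R -> R) Lf : (forall x, derivable f x 1) ->
    (forall x, al <= x <= be -> `|derive1 f x| <= Lf) ->
    forall s t, al <= s -> s <= t -> t <= be -> `|f t - f s| <= Lf * (t - s).
  move=> df fP s t as_ st tb; have [c /andP[sc_ ct] ->] := MVT_derive1 df st.
  rewrite normrM (ger0_norm (_ : 0 <= t - s)) ?subr_ge0 //.
  apply: ler_wpM2r; first by rewrite subr_ge0.
  by apply: fP; rewrite (le_trans as_ sc_) (le_trans ct tb).
have mT (f : R -> R) : continuous f -> measurable_fun (`]0, +oo[ : set R) f.
  by move=> cf; apply: measurable_funS (continuous_measurable_fun cf).
pose B := `|phi al| + `|phi be|.
have B0 : 0 <= B by rewrite addr_ge0.
have phiB x : al <= x <= be -> `|phi x| <= B.
  move=> /andP[ax xb]; have h1 := phi_mono (ltW al0) ax.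
  have h2 := phi_mono (ltW (lt_le_trans al0 ax)) xb.
  have := ler_norm (phi al); have := ler_norm (- phi be); rewrite normrN => h3 h4.
  have := normr_ge0 (phi al); have := normr_ge0 (phi be); rewrite /B => h5 h6.
  by rewrite ler_norml; apply/andP; split; lra.
pose U := slope al.
have U0 : 0 <= U by exact: slope_ge0.
have slopeU x : al <= x -> 0 <= slope x <= U.
  move=> ax; rewrite slope_ge0 ?(lt_le_trans al0) //=; exact: slope_nincr.
have i1 : mu.-integrable `]al, be] (EFin \o (fun t => phi t * derive1 psi t)).
  apply: (@bounded_integrable_oc _ _ _ (B * L)) => //.
    by apply: measurable_funM; [exact: measurable_phi|exact: (mT _ cpsi1)].
  by move=> x xab; rewrite normrM ler_pM // ?phiB ?LP.
have i2 : mu.-integrable `]al, be] (EFin \o (fun t => slope t * psi t)).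
  apply: (@bounded_integrable_oc _ _ _ (U * P)) => //.
    by apply: measurable_funM; [exact: measurable_slope|exact: (mT _ cpsi)].
  move=> x xab; rewrite normrM ler_pM // ?PP //.
  by have /andP[ax _] := xab; have /andP[h1 h2] := slopeU x ax; rewrite ger0_norm.
rewrite (@Rintegral_supp _ a b al be) ?(ltW bbe) //; last by move=> t /out ->; rewrite mulr0.
rewrite (@Rintegral_supp (fun t => - slope t * psi t) a b al be) ?(ltW bbe) //; last first.
  by move=> t /psi0 ->; rewrite mulr0.
have -> : \int[mu]_(t in (`]al, be] : set R)) (- slope t * psi t) =
   - \int[mu]_(t in (`]al, be] : set R)) (slope t * psi t).
  rewrite -[RHS]mulN1r -RintegralZl //.
  by apply: eq_Rintegral => t _; rewrite mulN1r mulNr.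
rewrite opprK; apply/esym/eqP; rewrite -subr_eq0 -RintegralB //; apply/eqP.
have psial : psi al = 0 by apply: psi0 => /andP[]; rewrite leNgt ala.
have psibe : psi be = 0 by apply: psi0 => /andP[_]; rewrite leNgt bbe.
(* The weight collects four errors: the first-order remainder of phi gives P slope, the variations
   of psi and of phi give U L each, and the remainder of psi gives B L2. *)
rewrite (@FTC_halving (fun t => - (phi t * psi t)) _
  (fun x => (2 * U * L + B * L2) * x - P * slope x)) //.
- by rewrite psial psibe; ring.
- have := integrableB _ i2 i1; exact.
move=> s t y as_ sy yt tb; have s0 : 0 < s by exact: lt_le_trans as_.
have st : s < t by exact: lt_le_trans yt.
have ay : al <= y by exact: le_trans as_ (ltW sy).
have h0 : 0 <= t - s by rewrite subr_ge0 ltW.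
have [c /andP[sc_ ct] cE] := MVT_derive1 dpsi0 (ltW st).
have -> : - (phi t * psi t) - - (phi s * psi s) -
    (slope y * psi y - phi y * derive1 psi y) * (t - s) =
  (phi s - phi t - slope y * (t - s)) * psi t + slope y * (t - s) * (psi t - psi y)
  - phi s * ((derive1 psi c - derive1 psi y) * (t - s))
  - (phi s - phi y) * derive1 psi y * (t - s).
  have -> : psi t = psi s + derive1 psi c * (t - s) by rewrite -cE addrC subrK.
  ring.
have e1 : `|(phi s - phi t - slope y * (t - s)) * psi t| <= (slope s - slope t) * (t - s) * P.
  rewrite normrM ler_pM //; last by apply: PP; rewrite tb andbT; exact: le_trans as_ (ltW st).
  have /andP[m1 m2] := slope_mean s0 st.
  have m3 : slope y * (t - s) <= slope s * (t - s).
    by apply: ler_wpM2r => //; apply: slope_nincr => //; exact: ltW.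
  have m4 : slope t * (t - s) <= slope y * (t - s).
    by apply: ler_wpM2r => //; apply: slope_nincr => //; exact: lt_trans sy.
  by rewrite ler_norml; apply/andP; split; lra.
have /andP[u1 u2] := slopeU y ay.
have yts : t - y <= t - s by lra.
have ty0 : 0 <= t - y by rewrite subr_ge0.
have e2 : `|slope y * (t - s) * (psi t - psi y)| <= U * (t - s) * (L * (t - s)).
  rewrite normrM ler_pM //; first by rewrite normrM !ger0_norm // ler_wpM2r.
  by apply: le_trans (lip _ _ dpsi0 LP _ _ ay yt tb) _; rewrite ler_wpM2l.
have e3 : `|phi s * ((derive1 psi c - derive1 psi y) * (t - s))| <= B * (L2 * (t - s) * (t - s)).
  rewrite normrM ler_pM //; first by apply: phiB; rewrite as_ (le_trans (ltW st)).
  rewrite normrM (ger0_norm h0) ler_wpM2r //.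
  have [yc|cy] := leP y c.
    apply: le_trans (lip _ _ dpsi1 L2P _ _ ay yc (le_trans ct tb)) _.
    by rewrite ler_wpM2l //; lra.
  rewrite distrC; apply: le_trans (lip _ _ dpsi1 L2P _ _ (le_trans as_ sc_) (ltW cy) (le_trans yt tb)) _.
  by rewrite ler_wpM2l //; lra.
have e4 : `|(phi s - phi y) * derive1 psi y * (t - s)| <= U * (t - s) * L * (t - s).
  rewrite normrM (ger0_norm h0) ler_wpM2r // normrM ler_pM //; last first.
    by apply: LP; rewrite ay (le_trans yt tb).
  rewrite ger0_norm ?subr_ge0; last by apply: phi_mono (ltW s0) (ltW sy).
  have /andP[_ m2] := slope_mean s0 sy; apply: le_trans m2 _.
  have /andP[us uU] := slopeU s as_; rewrite ler_pM // ?subr_ge0 ?(ltW sy) //; lra.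
apply: le_trans (ler_normB _ _) _; apply: le_trans (lerD (ler_normB _ _) (lexx _)) _.
apply: le_trans (lerD (lerD (ler_normD _ _) (lexx _)) (lexx _)) _.
apply: le_trans (lerD (lerD (lerD e1 e2) e3) e4) _.
by rewrite le_eqVlt; apply/orP; left; apply/eqP; ring.
Unshelve. all: by end_near. Qed.

(** * Legendre duality and the energy *)

Context (a : R) (phi_ge : forall s, 0 <= s -> a <= phi s).
Context (phi_0 : forall e, 0 < e -> exists2 d, 0 < d & forall s, 0 < s -> s < d -> phi 0 - e < phi s).
Local Notation u := (slope).

(* The least p >= 0 such that t - p s <= phi s for all s > 0. *)
Definition tangent (t : R) : R :=
  sup [set y | y = 0 \/ exists2 s, 0 < s & y = (t - phi s) / s].

(** Near 0 continuity keeps phi above t, so the quotients are negative; beyond distance d they are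
    at most (t - a) / d or negative. *)
Lemma tangent_has_sup t : t < phi 0 ->
  has_sup [set y | y = 0 \/ exists2 s, 0 < s & y = (t - phi s) / s].
Proof.
move=> t0; split; first by exists 0; left.
have [|d d0 dP] := phi_0 (_ : 0 < phi 0 - t); first by rewrite subr_gt0.
exists (Num.max 0 ((t - a) / d)) => y [->|[s s0 ->]]; first by rewrite le_max lexx.
rewrite le_max; have [sd|ds] := ltP s d.
  apply/orP; left; rewrite ler_pdivrMr // mul0r subr_le0 ltW //.
  by have := dP s s0 sd; rewrite opprB addrCA subrr addr0.
have [at0|ta] := leP 0 (t - phi s); last first.
  by apply/orP; left; rewrite ler_pdivrMr // mul0r ltW.
apply/orP; right; apply: ler_pM => //; first by rewrite invr_ge0 ltW.
  by rewrite lerB // phi_ge // ltW.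
by rewrite lef_pV2.
Qed.

Lemma tangent_ge0 t : t < phi 0 -> 0 <= tangent t.
Proof. by move=> t0; apply: sup_ubound; [exact: (tangent_has_sup t0).2|left]. Qed.

Lemma tangent_gt t l : 0 <= l -> t < phi 0 ->
  l < tangent t <-> exists2 s, 0 < s & phi s + l * s < t.
Proof.
move=> l0 t0; split=> [|[s s0 st]].
  move=> /(sup_gt (tangent_has_sup t0).1)[y [->|[s s0 ->]]]; first by rewrite ltNge l0.
  by rewrite ltr_pdivlMr // => h; exists s => //; rewrite addrC -ltrBrDr.
apply: lt_le_trans (_ : (t - phi s) / s <= _).
  by rewrite ltr_pdivlMr // ltrBrDr addrC.
by apply: sup_ubound; [exact: (tangent_has_sup t0).2|right; exists s].
Qed.

Lemma tangent_nondecr s t : s <= t -> t < phi 0 -> tangent s <= tangent t.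
Proof.
move=> st t0; have s0 := le_lt_trans st t0.
rewrite leNgt; apply/negP => /(tangent_gt (tangent_ge0 t0) s0)[y y0 ys].
have : tangent t < tangent t; last by rewrite ltxx.
by apply/(tangent_gt (tangent_ge0 t0) t0); exists y => //; exact: lt_le_trans st.
Qed.

(** The Legendre transform of phi up to signs; [tangent_gt_conjugate] makes it the generalised
    inverse of [tangent]. *)
Definition conjugate (l : R) : R := inf [set phi s + l * s | s in [set s | 0 < s]].

Lemma conjugate_lb l : 0 <= l -> has_inf [set phi s + l * s | s in [set s | 0 < s]].
Proof.
move=> l0; split; first by exists (phi 1 + l * 1); exists 1 => //=.
by exists a => _ [s /= s0 <-]; apply: le_trans (phi_ge (ltW s0)) _; rewrite lerDl mulr_ge0 // ltW.
Qed.

Lemma conjugate_ge l : 0 <= l -> a <= conjugate l.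
Proof.
move=> l0; apply: lb_le_inf; first exact: (conjugate_lb l0).1.
by move=> _ [s /= s0 <-]; apply: le_trans (phi_ge (ltW s0)) _; rewrite lerDl mulr_ge0 // ltW.
Qed.

Lemma conjugate_le l s : 0 <= l -> 0 < s -> conjugate l <= phi s + l * s.
Proof. by move=> l0 s0; apply: ge_inf; [exact: (conjugate_lb l0).2|exists s]. Qed.

Lemma conjugate_le0 l : 0 <= l -> conjugate l <= phi 0.
Proof.
move=> l0; apply/ler_addgt0Pr => e e0.
pose s := e / (l + 1); have s0 : 0 < s by rewrite divr_gt0 // ltr_wpDl.
apply: le_trans (conjugate_le l0 s0) _; apply: lerD; first by apply: phi_mono (ltW s0).
by rewrite /s mulrA ler_pdivrMr ?ltr_wpDl // mulrC ler_wpM2l ?lerDl // ltW.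
Qed.

Lemma tangent_gt_conjugate t l : 0 <= l -> t < phi 0 -> l < tangent t <-> conjugate l < t.
Proof.
move=> l0 t0; split => [/(tangent_gt l0 t0)[s s0 st]|].
  exact: le_lt_trans (conjugate_le l0 s0) st.
move=> /(inf_lt (conjugate_lb l0).1)[_ [s /= s0 <-] st].
by apply/(tangent_gt l0 t0); exists s.
Qed.

(** The mean slope bounds need a positive left end, so they are used on [d, s] with d so small that
    the lost term u s d is at most e. *)
Lemma slope_drop s : 0 < s -> u s * s <= phi 0 - phi s.
Proof.
move=> s0; have us := slope_ge0 s0.
apply/ler_addgt0Pr => e e0.
pose d := Num.min (s / 2) (e / (u s + 1)).
have d0 : 0 < d by rewrite lt_min !divr_gt0 // ltr_wpDl.
have ds : d < s by rewrite gt_min; apply/orP; left; lra.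
have /andP[h _] := slope_mean d0 ds.
have h2 : u s * d <= e.
  have : d <= e / (u s + 1) by rewrite ge_min lexx orbT.
  rewrite ler_pdivlMr ?ltr_wpDl // => h2; apply: le_trans h2.
  by rewrite mulrC ler_wpM2l ?lerDl ?(ltW d0).
have := phi_mono (lexx 0) (ltW d0); lra.
Qed.

Lemma measurable_tangent : measurable_fun (`]a, phi 0[ : set R) tangent.
Proof.
have m0 : measurable (`]a, phi 0[ : set R) by exact: measurable_itv.
apply: (measurability (@RGenCInfty.G R)) => [|/= _ [_] [r] -> <-].
  exact: RGenCInfty.measurableE.
apply: is_interval_measurable => s t /= [+ ss] [+ tt] x /andP[sx xt].
rewrite !in_itv /= !andbT in ss tt * => /andP[as_ s0] /andP[_ t0].
have x0 : x < phi 0 by exact: le_lt_trans t0.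
split; first by rewrite (lt_le_trans as_ sx).
by apply: le_trans ss _; exact: tangent_nondecr.
Qed.

Lemma ler_max0 (x y : R) : x <= y -> Num.max 0 x <= Num.max 0 y.
Proof. by move=> xy; rewrite ge_max !le_max lexx xy !orbT. Qed.

Lemma excess_nincr l s t : 0 < s -> s <= t -> Num.max 0 (u t - l) <= Num.max 0 (u s - l).
Proof. by move=> s0 st; apply: ler_max0; rewrite lerB // (slope_nincr). Qed.

(** The running maximum G of - phi r - l r over [d, x] is a primitive of the integrand: it rises
    while the slope exceeds l and is constant afterwards. Its final value is at most - conjugate
    l. *)
Lemma excess_integral l d N : 0 < l -> 0 < d -> d <= N ->
  \int[mu]_(y in `]d, N]) Num.max 0 (u y - l) <= phi 0 - conjugate l.
Proof.
move=> l0 d0 dN; pose m y := Num.max 0 (u y - l).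
have unincr := slope_nincr.
have mnincr s t : 0 < s -> s <= t -> m t <= m s.
  exact: excess_nincr.
have mge0 y : 0 <= m y by rewrite /m le_max lexx.
have mgeu y : u y - l <= m y by rewrite /m le_max lexx orbT.
have g0c : 0 <= phi 0 - conjugate l by rewrite subr_ge0 conjugate_le0 // ltW.
(* If the slope is at most l from d on, the integrand vanishes. Otherwise l d <= u d d, which
   [slope_drop] absorbs into phi 0 - phi d at the end. *)
have [ul|lu] := leP (u d) l.
  rewrite (@eq_Rintegral _ _ _ mu _ (cst 0)) ?Rintegral_cst ?mul0r //.
  move=> y; rewrite inE /= in_itv /= => /andP[dy _]; apply/max_idPl.
  by rewrite subr_le0; apply: le_trans ul; apply: unincr => //; exact: ltW.
pose A x := [set - phi r - l * r | r in [set r | d <= r <= x]].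
have Aub x : has_ubound (A x).
  exists (- a) => _ [r /= /andP[dr _] <-]; have r0 : 0 <= r by exact: le_trans (ltW d0) dr.
  have := phi_ge r0; have : 0 <= l * r by rewrite mulr_ge0 // ltW.
  lra.
pose G x := sup (A x).
have Gge x r : d <= r -> r <= x -> - phi r - l * r <= G x.
  by move=> dr rx; apply: sup_ubound => //; exists r => //=; rewrite dr.
have Gle x c : d <= x -> (forall r, d <= r -> r <= x -> - phi r - l * r <= c) -> G x <= c.
  move=> dx h; apply: ge_sup; first by exists (- phi d - l * d); exists d; rewrite //= lexx.
  by move=> _ [r /= /andP[dr rx] <-]; exact: h.
have Gd : G d = - phi d - l * d.
  apply/eqP; rewrite eq_le Gge // andbT; apply: Gle => // r dr rd.
  by rewrite (le_anti (_ : d <= r <= d)) ?dr.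
have GN : G N <= - conjugate l.
  apply: Gle => // r dr rN; rewrite -opprD lerN2.
  by apply: conjugate_le; [exact: ltW|exact: lt_le_trans dr].
have bracket s t : d <= s -> s < t -> m t * (t - s) <= G t - G s <= m s * (t - s).
  move=> ds st; have s0 : 0 < s by exact: lt_le_trans ds.
  have ts : 0 < t - s by rewrite subr_gt0.
  have /andP[h1 h2] := slope_mean s0 st.
  apply/andP; split.
    have [ult|lut] := leP (u t) l.
      rewrite /m (max_idPl _) ?subr_le0 // mul0r subr_ge0.
      by apply: Gle => // r dr rs; apply: Gge => //; exact: le_trans (ltW st).
    have Gs : G s <= - phi s - l * s.
      apply: Gle => // r dr; rewrite le_eqVlt => /orP[/eqP -> //|rs].
      have r0 : 0 < r by exact: lt_le_trans dr.
      have /andP[k1 _] := slope_mean r0 rs.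
      have k2 : l * (s - r) <= u s * (s - r).
        rewrite ler_pM2r ?subr_gt0 //; apply: le_trans (ltW lut) _.
        by apply: unincr => //; exact: ltW.
      by rewrite mulrBr in k2; lra.
    have Gt := Gge t t (ltW (le_lt_trans ds st)) (lexx t).
    rewrite /m (max_idPr _) ?subr_ge0 ?(ltW lut) // mulrBl mulrBr; lra.
  rewrite lerBlDr; apply: Gle => [|r dr rt]; first exact: ltW (le_lt_trans ds st).
  have msts : 0 <= m s * (t - s) by rewrite mulr_ge0 // ltW.
  have [rs|sr] := leP r s; first by have := Gge s r dr rs; lra.
  have /andP[_ k2] := slope_mean s0 sr.
  have k3 := Gge s s ds (lexx s).
  have k4 : (u s - l) * (r - s) <= m s * (t - s).
    apply: (@le_trans _ _ (m s * (r - s))); first by rewrite ler_pM2r ?subr_gt0.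
    by rewrite ler_wpM2l // lerB.
  by rewrite mulrBl mulrBr in k4; lra.
rewrite (@FTC_halving G m (fun x => - m x) d N dN).
- rewrite Gd; have := slope_drop d0; have : l * d <= u d * d by rewrite ler_pM2r // ltW.
  lra.
- apply: (@bounded_integrable_oc _ _ _ (m d) d0).
    by apply: nonincreasing_measurable_pos => s t s0 st; exact: mnincr.
  by move=> x /andP[dx _]; rewrite ger0_norm //; exact: mnincr.
move=> s t y ds sy yt tN; have st : s < t by exact: lt_le_trans yt.
have ts : 0 <= t - s by rewrite subr_ge0 ltW.
have s0 : 0 < s by exact: lt_le_trans ds.
have /andP[h1 h2] := bracket s t ds st.
have h3 : m y * (t - s) <= m s * (t - s).
  by rewrite ler_wpM2r //; apply: mnincr => //; exact: ltW.
have h4 : m t * (t - s) <= m y * (t - s).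
  by rewrite ler_wpM2r //; apply: mnincr => //; exact: lt_trans sy.
rewrite ler_norml; apply/andP; split; lra.
Qed.

Lemma measurable_excess l (D : set R) : measurable D -> D `<=` (`]0, +oo[ : set R) ->
  measurable_fun D (fun y => (Num.max 0 (u y - l))%:E).
Proof.
move=> mD D0; apply/measurable_EFinP.
apply: (measurable_funS (measurable_itv `]0, +oo[) D0).
apply: nonincreasing_measurable_pos => s t s0 st.
exact: excess_nincr.
Qed.

(** The upper bound exhausts ]0, +oo[ by the intervals of [excess_integral]. For the lower bound, s
    nearly minimises phi s + l s and d is near 0: the integral of u - l over ]d, s] is phi d - phi s
    - l (s - d). *)
Lemma conjugate_integral l : 0 < l ->
  (\int[mu]_(y in (`]0%R, +oo[ : set R)) (Num.max 0 (u y - l))%:E = (phi 0 - conjugate l)%:E)%E.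
Proof.
move=> l0; pose m y : \bar R := (Num.max 0 (u y - l))%:E.
have m0 y : (0 <= m y)%E by rewrite lee_fin le_max lexx.
have sub d N : 0 < d -> (`]d, N] : set R) `<=` (`]0, +oo[ : set R).
  by move=> d0 x /=; rewrite !in_itv /= andbT => /andP[/(lt_trans d0)].
have intE d N : 0 < d -> (\int[mu]_(y in (`]d, N] : set R)) m y =
    (\int[mu]_(y in (`]d, N] : set R)) Num.max 0 (u y - l))%R%:E)%E.
  move=> d0; rewrite /Rintegral fineK //; apply: integrable_fin_num => //.
  apply: (@bounded_integrable_oc _ _ _ (Num.max 0 (u d - l)) d0).
    apply: nonincreasing_measurable_pos => s t s0 st.
    exact: excess_nincr.
  move=> x /andP[dx _]; (rewrite ger0_norm; last by rewrite le_max lexx).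
  by apply: excess_nincr => //; exact: ltW.
apply/eqP; rewrite eq_le; apply/andP; split.
  pose F (n : nat) : set R := [set` `]n.+1%:R^-1, n.+1%:R]].
  have F0 n : (0 : R) < n.+1%:R^-1 by rewrite invr_gt0.
  have mF n : measurable (F n) by exact: measurable_itv.
  have ndF : nondecreasing_seq F.
    move=> p q pq; apply/subsetPset => x /=; rewrite /F /= !in_itv /= => /andP[px xp].
    rewrite (le_trans xp) ?ler_nat // andbT; apply: le_lt_trans px.
    by rewrite lef_pV2 ?posrE ?ltr0n // ler_nat.
  have cv := @ge0_nondecreasing_set_cvg_integral _ (measurableTypeR R) R F m mu ndF mF
     (fun n => measurable_excess l (mF n) (sub _ _ (F0 n))) (fun n x _ => m0 x).
  have UF : \bigcup_n F n = `]0, +oo[%classic.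
    apply/seteqP; split=> [x [n _ Fx]|x /=]; first exact: (sub _ _ (F0 n)) Fx.
    rewrite in_itv /= andbT => x0; pose n := Num.truncn (Num.max x x^-1).
    exists n => //; rewrite /F /= in_itv /=.
    have := truncnS_gt (Num.max x x^-1); rewrite -/n gt_max => /andP[h1 h2].
    by rewrite (ltW h1) andbT -[x]invrK ltf_pV2 // posrE ?invr_gt0.
  rewrite UF in cv; rewrite -(cvg_lim _ cv) //; apply: lime_le; first by apply/cvg_ex; exists (\int[mu]_(y in (`]0%R, +oo[ : set R)) m y)%E.
  near=> n; rewrite intE // lee_fin; apply: excess_integral => //.
  by rewrite (@le_trans _ _ 1) ?invf_le1 ?ler1n.
apply/lee_addgt0Pr => e e0.
have e2 : 0 < e / 2 by rewrite divr_gt0.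
have [_ [s /= s0 <-] se] := inf_adherent e2 (conjugate_lb (ltW l0)).
have [d1 d10 d1P] := phi_0 e2.
pose d := Num.min (d1 / 2) (s / 2).
have d0 : 0 < d by rewrite lt_min !divr_gt0.
have dd1 : d < d1 by rewrite gt_min; apply/orP; left; lra.
have ds : d < s by rewrite gt_min; apply/orP; right; lra.
have := d1P d d0 dd1 => pd.
apply: (@le_trans _ _ ((phi d - phi s - l * (s - d))%R%:E + e%:E)%E).
  rewrite -EFinD lee_fin mulrBr; have : 0 <= l * d by rewrite mulr_ge0 // ltW.
  rewrite -/(conjugate l) in se; lra.
rewrite leeD2r //.
apply: (@le_trans _ _ (\int[mu]_(y in (`]d, s] : set R)) m y)%E); last first.
  apply: ge0_subset_integral => //; first exact: measurable_excess.
  exact: sub.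
rewrite intE // lee_fin -(FTC_slope d0 (ltW ds)).
have cstE : \int[mu]_(y in (`]d, s] : set R)) l = l * (s - d).
  by rewrite Rintegral_cst // /= lebesgue_measure_itv /= lte_fin ds.
have icst : mu.-integrable `]d, s] (EFin \o cst l).
  apply: (@bounded_integrable_oc _ _ _ `|l| d0) => //.
rewrite -cstE -RintegralB //; last exact: (integrable_slope).
apply: le_Rintegral => //.
- by have := integrableB _ (integrable_slope s d0) icst; exact.
- apply: (@bounded_integrable_oc _ _ _ (Num.max 0 (u d - l)) d0).
    apply: nonincreasing_measurable_pos => x t x0 st.
    exact: excess_nincr.
  move=> x /andP[dx _]; (rewrite ger0_norm; last by rewrite le_max lexx).
  by apply: excess_nincr => //; exact: ltW.
by move=> x _; rewrite le_max lexx orbT.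
Unshelve. all: by end_near. Qed.

Lemma ramp_integral (c : R) : 0 <= c ->
  (\int[mu]_(l in (`]0%R, +oo[ : set R)) (Num.max 0 (c - l))%:E = (c ^+ 2 / 2)%:E)%E.
Proof.
move=> c0; transitivity (\int[mu]_(l in (`]0%R, c] : set R)) (c - l)%:E)%E.
  rewrite integral_mkcond [RHS]integral_mkcond; apply: eq_integral => l _.
  rewrite !patchE !mem_setE /= !in_itv /= andbT.
  case: (ltP 0 l) => //= l0; case: (leP l c) => lc.
    by rewrite (max_idPr _) // subr_ge0.
  by rewrite (max_idPl _) // subr_le0 ltW.
have ic : mu.-integrable `]0, c] (EFin \o (fun l => c - l)).
  have ic0 : mu.-integrable `[0, c] (EFin \o (fun l => c - l)).
    apply: continuous_compact_integrable; first exact: segment_compact.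
    by apply: continuous_subspaceT => x; apply: cvgB; [exact: cvg_cst|exact: cvg_id].
  by apply: integrableS ic0 => //; exact: subset_itv_oc_cc.
have := @FTC_halving (fun x => - ((c - x) ^+ 2 / 2)) (fun l => c - l) id 0 c c0 ic.
rewrite /Rintegral subrr subr0 expr0n /= mul0r oppr0 add0r opprK => <-.
  by rewrite fineK //; apply: integrable_fin_num.
move=> s t y s0 sy yt tc; rewrite ler_norml; apply/andP; split; nra.
Qed.

Let tangent0 : R -> R := tangent \_ (`]a, phi 0[ : set R).

Lemma measurable_tangent0 : measurable_fun setT tangent0.
Proof.
apply: (measurable_restrictT _ _).1; first exact: measurable_itv.
exact: measurable_tangent.
Qed.

Lemma tangent0_superlevel l : 0 < l ->
  mu [set x | l < tangent0 x] = (phi 0 - conjugate l)%:E.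
Proof.
move=> l0; have l0' := ltW l0.
have ac := conjugate_ge l0'; have c0 := conjugate_le0 l0'.
rewrite (_ : [set x | _] = `]conjugate l, phi 0[%classic); last first.
  apply/seteqP; split=> x /=; rewrite /tangent0 patchE in_itv /=.
    case: ifPn; rewrite ?inE /= ?in_itv /=; last by rewrite ltNge l0'.
    by move=> /andP[ax x0] /(tangent_gt_conjugate l0' x0) ->.
  move=> /andP[cx x0]; rewrite mem_set; last by rewrite /= in_itv /= x0 (le_lt_trans ac).
  by apply/(tangent_gt_conjugate l0' x0).
rewrite /= lebesgue_measure_itv /= lte_fin; case: ltgtP c0 => // -> _.
by rewrite subrr.
Qed.

Let slope0 : R -> R := u \_ (`]0, +oo[ : set R).

Lemma measurable_slope0 : measurable_fun setT slope0.
Proof.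
apply: (measurable_restrictT _ _).1; first exact: measurable_itv.
exact: measurable_slope.
Qed.

Lemma slope0_ge0 y : 0 <= slope0 y.
Proof.
rewrite /slope0 patchE; case: ifPn => //; rewrite inE /= in_itv /= andbT => y0.
exact: (slope_ge0 y0).
Qed.

(** Both sides are the double integral of max(0, u(y) - l) over l, y > 0. Integrated in y first it
    is phi 0 - conjugate l, the length of the set where [tangent] exceeds l; integrated in l first
    it is u(y)^2 / 2. Both sides may be infinite. *)
Lemma energy_tangent :
  (\int[mu]_(t in (`]a, phi 0[ : set R)) (tangent t)%:E =
   (2^-1)%:E * \int[mu]_(s in (`]0%R, +oo[ : set R)) (u s ^+ 2)%:E)%E.
Proof.
pose F (z : R * R) : \bar R := (\1_(`]0, +oo[ : set R) z.1 * Num.max 0 (slope0 z.2 - z.1))%:E.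
have max0 (x : R) : 0 <= Num.max 0 x by rewrite le_max lexx.
have F0 z : (0 <= F z)%E by rewrite lee_fin mulr_ge0 // indicE.
have mF : measurable_fun setT F.
  apply/measurable_EFinP; apply: measurable_funM.
    by apply: measurableT_comp; [exact: measurable_indic|exact: measurable_fst].
  apply: measurable_maxr; first exact: measurable_cst.
  apply: measurable_funB; last exact: measurable_fst.
  by apply: measurableT_comp; [exact: measurable_slope0|exact: measurable_snd].
transitivity (\int[mu]_x (Num.max 0 (tangent0 x))%:E)%E.
  rewrite integral_mkcond; apply: eq_integral => x _.
  rewrite /tangent0 !patchE; case: ifPn => [|_]; last by rewrite maxxx.
  rewrite inE /= in_itv /= => /andP[_ x0].
  by rewrite (max_idPr _) // (tangent_ge0).
rewrite (layer_cake measurable_tangent0).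
transitivity (\int[mu]_l \int[mu]_y F (l, y))%E.
  rewrite integral_mkcond; apply: eq_integral => l _.
  rewrite patchE; case: ifPn; rewrite ?inE ?notin_setE /= in_itv /= andbT => l0; last first.
    by rewrite integral0_eq // => x _; rewrite /F /= indicE memNset ?mul0r //= in_itv /= andbT.
  rewrite tangent0_superlevel // -(conjugate_integral l0).
  rewrite integral_mkcond; apply: eq_integral => y _.
  rewrite /F /= indicE mem_set ?mul1r /= ?in_itv /= ?andbT // /slope0 !patchE.
  case: ifPn => // _; rewrite (max_idPl _) // sub0r oppr_le0; exact: ltW.
rewrite (@fubini_tonelli _ _ _ _ R mu mu _ mF F0).
transitivity (\int[mu]_y ((2^-1)%:E * (slope0 y ^+ 2)%:E))%E.
  apply: eq_integral => y _; rewrite -EFinM mulrC -(ramp_integral (slope0_ge0 y)).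
  rewrite [RHS]integral_mkcond; apply: eq_integral => l _.
  by rewrite /F /= indicE patchE; case: ifPn; rewrite ?mul1r ?mul0r.
rewrite ge0_integralZl_EFin //; last 2 first.
- by move=> y _; rewrite lee_fin sqr_ge0.
- by apply/measurable_EFinP; apply: measurable_funX; exact: measurable_slope0.
congr (_ * _)%E; rewrite [RHS]integral_mkcond; apply: eq_integral => y _.
by rewrite /slope0 !patchE; case: ifPn => // _; rewrite expr0n.
Qed.

End Slopes.

(** * Green functions and heights *)

Section Tree.
Context (R : realType) (k : fieldType) (X : projective_variety k).
Local Notation pt := (closed_point X).
Local Notation tree := (berkovich R X).
Implicit Types (x : pt).

Lemma xi0 x : xi x 0%E = eta0 :> tree.
Proof. by rewrite /xi insubF // ltxx. Qed.

Lemma xi_pos x (t : \bar R) (t0 : (0 < t)%E) : xi x t = on_branch x (exist _ t t0).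
Proof. by rewrite /xi insubT. Qed.

Lemma not_leaf x (t : R) : 0 <= t -> ~ leaf (xi x t%:E : tree).
Proof.
move=> t0 [y]; rewrite (xi_pos y (ltry 0)).
move: t0; rewrite le_eqVlt => /predU1P[<-|t0]; first by rewrite xi0.
have t0' : (0 < t%:E)%E by rewrite lte_fin.
by rewrite (xi_pos x t0') => -[].
Qed.

Lemma tree_ind (P : tree -> Prop) : P eta0 -> (forall x (t : R), 0 < t -> P (xi x t%:E)) ->
  (forall x, P (xi x +oo%E)) -> forall p, P p.
Proof.
move=> P0 Pt Pl [//|x [[t| |] t0]]; last by [].
- by rewrite -xi_pos; exact: Pt.
- by rewrite -xi_pos; exact: Pl.
Qed.

Section Potential.
Context (phi : tree -> R) (phi_cont : continuous phi).

Lemma preimage_itv_open (a b : R) : berkovich_open (phi @^-1` `]a, b[%classic).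
Proof. by have /continuousP := phi_cont; apply; exact: interval_open. Qed.

(** A neighbourhood of the root contains all but finitely many whole branches; this is what makes
    the lower bound of phi uniform. *)
Lemma root_near (e : R) : 0 < e ->
  finite_set [set x | ~ forall t : \bar R, (0 <= t)%E -> phi eta0 - e < phi (xi x t)].
Proof.
move=> e0; have [_] := preimage_itv_open (phi eta0 - e) (phi eta0 + e).
have U0 : (phi @^-1` `]phi eta0 - e, phi eta0 + e[%classic) eta0.
  by rewrite /= in_itv /=; apply/andP; split; lra.
move=> /(_ U0); apply: sub_finite_set => x /= nx h; apply: nx => t t0.
by have := h _ (ex_intro2 _ _ t t0 erefl); rewrite /= in_itv /= => /andP[].
Qed.

Lemma branch_near x (t0 : \bar R) (e : R) : (0 <= t0)%E -> 0 < e ->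
  exists2 V : set (\bar R), nbhs t0 V & forall t, V t -> (0 <= t)%E ->
    phi (xi x t0) - e < phi (xi x t) < phi (xi x t0) + e.
Proof.
move=> t00 e0; have [/(_ x)/open_subspaceP[V oV VE] _] :=
  preimage_itv_open (phi (xi x t0) - e) (phi (xi x t0) + e).
exists V => [|t Vt tge0].
  apply: open_nbhs_nbhs; split=> //.
  suff : (V `&` [set t : \bar R | (0 <= t)%E]) t0 by case.
  by rewrite VE; split=> //=; rewrite in_itv /=; apply/andP; split; lra.
have : (V `&` [set t : \bar R | (0 <= t)%E]) t by [].
by rewrite VE => -[/=]; rewrite in_itv.
Qed.

Lemma branch_near_root x (e : R) : 0 < e -> exists2 d : R, 0 < d &
  forall s, 0 < s -> s < d -> phi eta0 - e < phi (xi x s%:E).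
Proof.
move=> e0; have [V + VP] := @branch_near x 0%E e (lexx _) e0.
rewrite xi0 in VP; move=> /(nbhs_ballP (0 : R) (fun r => V r%:E))[d /= d0 dV].
exists d => // s s0 sd; have [||//] := andP (VP s%:E _ _).
  by apply: dV; rewrite /ball /= sub0r normrN gtr0_norm.
by rewrite lee_fin ltW.
Qed.

Lemma branch_near_leaf x (e : R) : 0 < e -> exists2 M : R, 0 <= M &
  forall s, M < s -> phi (xi x +oo%E) - e < phi (xi x s%:E) < phi (xi x +oo%E) + e.
Proof.
move=> e0; have [V [M [_ MV]] VP] := @branch_near x +oo%E e (leey _) e0.
exists (Num.max 0 M) => [|s]; first by rewrite le_max lexx.
by rewrite gt_max => /andP[s0 Ms]; apply: VP; [apply: MV; rewrite lte_fin|rewrite lee_fin ltW].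
Qed.

End Potential.
End Tree.

(** * Plurisubharmonic Green functions along the branches *)

Section GreenBranches.
Context (R : realType) (k : fieldType) (X : projective_variety k).
Local Notation pt := (closed_point X).
Local Notation tree := (berkovich R X).
Context (D : pt -> R) (g : tree -> \bar R).
Context (phi : tree -> R) (phi_cont : continuous phi).
Context (phiE : forall x (t : R), 0 <= t ->
  ((phi (xi x t%:E))%:E = g (xi x t%:E) - (D x * t)%:E)%E).
Context (g_psh : plurisubharmonic D g).
Local Notation branch := (phi_branch D g).
Implicit Types (x : pt).

Lemma greenE x t : 0 <= t -> g (xi x t%:E) = (phi (xi x t%:E) + D x * t)%:E.
Proof. by move=> t0; rewrite EFinD phiE // subeK. Qed.

Lemma branchE x t : 0 <= t -> branch x t = phi (xi x t%:E).
Proof. by move=> t0; rewrite /phi_branch greenE //= addrK. Qed.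

Lemma branch0 x : branch x 0 = phi eta0.
Proof. by rewrite branchE // xi0. Qed.

Lemma green_eta0 x : g eta0 = (phi eta0)%:E.
Proof. by rewrite -(xi0 R x) greenE // mulr0 addr0. Qed.

Definition section_height (s : ratR R X) : R :=
  fine (ereal_inf (range (green_add (canonical_green (fun y => ordR y s)) g))).

(** Plurisubharmonicity on a branch: g is a supremum of functions affine in t, with the heights of
    sections as constant terms. *)
Lemma branch_sup x t : 0 <= t ->
  (phi (xi x t%:E) + D x * t)%:E =
  ereal_sup [set (section_height s - t * ordR x s)%:E | s in GammaR D].
Proof.
move=> t0; rewrite -greenE // (g_psh (@not_leaf R k X x t t0)) /psh_envelope; congr ereal_sup.
apply: eq_imagel => s _; rewrite /normR /div_norm expRK EFinN oppeK EFinD addeC; congr (_ + _)%E.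
move: t0; rewrite le_eqVlt => /predU1P[<-|t0]; first by rewrite xi0 /= mul0r oppr0.
have t0' : (0 < t%:E)%E by rewrite lte_fin.
by rewrite (xi_pos x t0').
Qed.

Lemma branch_convex x a b c : 0 <= a -> a < b -> b < c ->
  (branch x b - branch x a) * (c - b) <= (branch x c - branch x b) * (b - a).
Proof.
move=> a0 ab bc; have b0 : 0 <= b by exact: ltW (le_lt_trans a0 ab).
have c0 : 0 <= c by exact: ltW (le_lt_trans b0 bc).
rewrite !branchE //; have ca : 0 < c - a by rewrite subr_gt0 (lt_trans ab).
have ub s t : GammaR D s -> 0 <= t ->
    section_height s - t * ordR x s <= phi (xi x t%:E) + D x * t.
  by move=> Gs t0; rewrite -lee_fin branch_sup //; apply: ereal_sup_ubound; exists s.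
have : ((phi (xi x b%:E) + D x * b)%:E <=
    (((c - b) * (phi (xi x a%:E) + D x * a) + (b - a) * (phi (xi x c%:E) + D x * c)) / (c - a))%:E)%E.
  rewrite branch_sup //; apply: ge_ereal_sup => _ [s Gs <-]; rewrite lee_fin ler_pdivlMr //.
  have ha := ub s a Gs a0; have hc := ub s c Gs c0.
  have h1 : 0 <= c - b by rewrite subr_ge0 ltW.
  have h2 : 0 <= b - a by rewrite subr_ge0 ltW.
  have := lerD (ler_wpM2l h1 ha) (ler_wpM2l h2 hc); lra.
by rewrite lee_fin ler_pdivlMr //; lra.
Qed.

(** A convex function that increases somewhere grows at least linearly, whereas phi has a finite
    limit at the leaf. *)
Lemma branch_nonincreasing x a b : 0 <= a -> a <= b -> branch x b <= branch x a.
Proof.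
move=> a0; rewrite le_eqVlt => /predU1P[-> //|ab]; rewrite leNgt; apply/negP => p0.
have b0 : 0 <= b by exact: ltW (le_lt_trans a0 ab).
have [M M0 MP] := branch_near_leaf phi_cont x ltr01.
set p := branch x b - branch x a; have pp : 0 < p by rewrite subr_gt0.
set q := `|phi (xi x +oo%E) + 1 - branch x b| * (b - a).
have q0 : 0 <= q by rewrite mulr_ge0 // subr_ge0 ltW.
(* Convexity gives p (c - b) <= q as c > M is close enough to the leaf, while c - b >= 1 + q / p
   gives p (c - b) >= p + q. *)
pose c := Num.max M b + 1 + q / p.
have qp0 : 0 <= q / p by rewrite divr_ge0 // ltW.
have Mc : M < c.
  apply: (@le_lt_trans _ _ (Num.max M b)); first by rewrite le_max lexx.
  by rewrite /c -addrA ltrDl ltr_pwDl.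
have bc1 : b + 1 + q / p <= c by rewrite /c lerD2r lerD2r le_max lexx orbT.
have bc : b < c by lra.
have c0 : 0 <= c by lra.
have := branch_convex x a0 ab bc; rewrite -/p => h1.
have h2 : p + q <= p * (c - b).
  have : p * (1 + q / p) <= p * (c - b) by rewrite ler_pM2l //; lra.
  by rewrite mulrDr mulr1 mulrCA divff ?mulr1 // gt_eqF.
have h3 : (branch x c - branch x b) * (b - a) <= q.
  rewrite ler_pM2r ?subr_gt0 //; apply: le_trans (ler_norm _).
  by rewrite lerB // branchE //; have /andP[_ /ltW] := MP c Mc.
lra.
Qed.

Lemma branch_ge_leaf x t : 0 <= t -> phi (xi x +oo%E) <= branch x t.
Proof.
move=> t0; apply/ler_addgt0Pr => e e0; have [M M0 MP] := branch_near_leaf phi_cont x e0.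
have tc : t <= Num.max t M + 1 by rewrite ler_wpDr // le_max lexx.
have Mc : M < Num.max t M + 1 by rewrite ltr_pwDr // le_max lexx orbT.
have /andP[+ _] := MP _ Mc; rewrite -branchE; last exact: le_trans tc.
have := branch_nonincreasing x t0 tc; lra.
Qed.

(** All but finitely many branches stay within 1 of the root value; each of the others is bounded
    below by its value at the leaf. *)
Lemma branch_lower_bound : exists2 A, A < phi eta0 & forall x t, 0 <= t -> A <= branch x t.
Proof.
have /finite_seqP[s sE] := root_near phi_cont ltr01.
have [A A0 AP] : exists2 A, A <= phi eta0 - 1 & forall x, x \in s -> A <= phi (xi x +oo%E).
  elim: {sE} s => [|x s [A A0 AP]]; first by exists (phi eta0 - 1).
  exists (Num.min A (phi (xi x +oo%E))); first by rewrite ge_min A0.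
  move=> y; rewrite inE => /predU1P[->|/AP Ay]; first by rewrite ge_min lexx orbT.
  by rewrite ge_min Ay.
exists A => [|x t t0]; first by lra.
have [xs|xs] := boolP (x \in s); first exact: le_trans (AP x xs) (branch_ge_leaf x t0).
apply: le_trans A0 _; rewrite branchE //; apply/ltW.
have : ~ [set` s] x by apply/negP.
rewrite -sE /= => /contrapT; by apply; rewrite lee_fin.
Qed.

Lemma branch_continuous0 x e : 0 < e -> exists2 d, 0 < d &
  forall s, 0 < s -> s < d -> branch x 0 - e < branch x s.
Proof.
move=> e0; have [d d0 dP] := branch_near_root phi_cont x e0; exists d => // s s0 sd.
by rewrite branch0 branchE ?(ltW s0) //; exact: dP.
Qed.

Definition height (n : nat) (E : pt -> R) : R :=
  fine (ereal_inf (range (green_add (canonical_green E) (fun p => n%:R%:E * g p)%E))).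

Lemma green_add_branch n E x (t : R) : 0 <= t ->
  green_add (canonical_green E) (fun p => n%:R%:E * g p)%E (xi x t%:E) =
  ((E x + n%:R * D x) * t + n%:R * branch x t)%:E.
Proof.
move=> t0; rewrite branchE //; have gx := greenE x t0.
move: t0 gx; rewrite le_eqVlt => /predU1P[<-|t0].
  rewrite xi0 !mulr0 addr0 add0r /green_add /= add0e => ->.
  by rewrite -EFinM.
have t0' : (0 < t%:E)%E by rewrite lte_fin.
rewrite (xi_pos x t0') /green_add /= => ->; rewrite -!EFinM -EFinD; congr (_%:E).
by ring.
Qed.

(** The value at a leaf is a limit along the branch, so its existence must be shown: it is [n * phi]
    at the leaf if the coefficient vanishes, and +oo if it is positive. *)
Lemma green_add_leaf n E x l : 0 <= E x + n%:R * D x ->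
  (forall t, 0 <= t -> l <= (E x + n%:R * D x) * t + n%:R * branch x t) ->
  (l%:E <= green_add (canonical_green E) (fun p => n%:R%:E * g p)%E (xi x +oo%E))%E.
Proof.
move=> c0 lP; rewrite (xi_pos x (ltry 0)) /green_add /=.
set F := (X in lim (X @ _)); set c := E x + _ in c0 lP.
have FE t : 0 < t -> F t = (c * t + n%:R * branch x t)%:E.
  move=> t0; have t0' : (0 < t%:E)%E by rewrite lte_fin.
  rewrite -(green_add_branch n E x (ltW t0)) /green_add {1}(xi_pos x t0') /=.
  by rewrite /F (xi_pos x t0').
apply: lime_ge; last first.
  near=> t; have t0 : 0 < t by near: t; apply: nbhs_pinfty_gt; exact: num_real.
  by rewrite FE // lee_fin; apply: lP; exact: ltW.
move: c0; rewrite le_eqVlt => /predU1P[c0|c0].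
  apply/cvg_ex; exists (n%:R * phi (xi x +oo%E))%:E.
  apply: (@cvg_trans _ ((fun t => (n%:R * branch x t)%:E) @ +oo%R)).
    apply: near_eq_cvg; near=> t.
    have t0 : 0 < t by near: t; apply: nbhs_pinfty_gt; exact: num_real.
    by rewrite FE // -c0 mul0r add0r.
  apply: cvg_EFin; first by near=> t.
  apply: cvgMr; apply/cvgrPdist_lt => e e0; have [M M0 MP] := branch_near_leaf phi_cont x e0.
  near=> t; have Mt : M < t by near: t; apply: nbhs_pinfty_gt; exact: num_real.
  rewrite /= branchE ?(le_trans M0 (ltW Mt)) //.
  by rewrite ltr_distlC; have := MP t Mt.
apply/cvg_ex; exists +oo%E; apply/cvgeyPge => A.
near=> t; have t0 : 0 < t by near: t; apply: nbhs_pinfty_gt; exact: num_real.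
have tA : (A - n%:R * phi (xi x +oo%E)) / c < t.
  by near: t; apply: nbhs_pinfty_gt; exact: num_real.
have tB : n%:R * phi (xi x +oo%E) <= n%:R * branch x t.
  by rewrite ler_wpM2l // (branch_ge_leaf) // ltW.
by rewrite FE // lee_fin; move: tA; rewrite ltr_pdivrMr // => tA; lra.
Unshelve. all: by end_near. Qed.

Context (x0 : pt).

Lemma height_bounds n E : (forall x, 0 <= E x + n%:R * D x) ->
  let I := ereal_inf (range (green_add (canonical_green E) (fun p => n%:R%:E * g p)%E)) in
  forall l, (l%:E <= I)%E <->
    forall x t, 0 <= t -> l <= (E x + n%:R * D x) * t + n%:R * branch x t.
Proof.
move=> E0 I l; split=> [lI x t t0|lP].
  rewrite -lee_fin -green_add_branch //; apply: le_trans lI _.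
  by apply: ereal_inf_lbound; exists (xi x t%:E).
apply: le_ereal_inf_tmp => _ [p _ <-]; elim/tree_ind: p => [|x t t0|x].
- by rewrite -(xi0 R x0) green_add_branch // lee_fin lP.
- by rewrite green_add_branch ?(ltW t0) // lee_fin lP // ltW.
- by apply: green_add_leaf => // t t0; exact: lP.
Qed.

Lemma height_fin n E : (forall x, 0 <= E x + n%:R * D x) ->
  ereal_inf (range (green_add (canonical_green E) (fun p => n%:R%:E * g p)%E)) \is a fin_num.
Proof.
move=> E0; have [A _ AP] := branch_lower_bound.
rewrite fin_real //; apply/andP; split.
  apply: lt_le_trans (ltNyr (n%:R * A)) _; apply/(height_bounds E0) => x t t0.
  by rewrite ler_wpDl ?mulr_ge0 // ler_wpM2l // AP.
apply: le_lt_trans (ltry (n%:R * phi eta0)).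
have -> : (n%:R * phi eta0)%:E = ((E x0 + n%:R * D x0) * 0 + n%:R * branch x0 0)%:E.
  by rewrite mulr0 add0r branch0.
by rewrite -green_add_branch //; apply: ereal_inf_lbound; exists (xi x0 0%:E).
Qed.

Lemma heightP n E l : (forall x, 0 <= E x + n%:R * D x) ->
  l <= height n E <-> forall x t, 0 <= t -> l <= (E x + n%:R * D x) * t + n%:R * branch x t.
Proof.
by move=> E0; rewrite -(height_bounds E0) -lee_fin /height fineK //; exact: height_fin.
Qed.

Lemma height_le_root n E : (forall x, 0 <= E x + n%:R * D x) -> height n E <= n%:R * phi eta0.
Proof.
move=> E0; have /(_ x0 0 (lexx _)) := (heightP (height n E) E0).1 (lexx _).
by rewrite mulr0 add0r branch0.
Qed.

Lemma section_heightE s : section_height s = height 1 (fun x => ordR x s).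
Proof.
have gE : (fun p => 1%:R%:E * g p)%E = g.
  by apply/funext => p; rewrite -[LHS]/(1 * g p)%E mul1e.
by rewrite /section_height /height gE.
Qed.

Lemma tangent_le_section s x t : GammaR D s -> t < section_height s -> t < phi eta0 ->
  tangent (branch x) t <= ordR x s + D x.
Proof.
move=> Gs ts t0; apply: ge_sup; first by exists 0; left.
have E0 y : 0 <= ordR y s + 1%:R * D y by rewrite mul1r; exact: Gs.
move=> _ [->|[r r0 ->]]; first exact: Gs.
rewrite section_heightE in ts; have := (heightP t E0).1 (ltW ts) x r (ltW r0).
by rewrite !mul1r ler_pdivrMr // lerBlDr.
Qed.

Lemma section_above t : t < phi eta0 -> exists2 s, GammaR D s & t < section_height s.
Proof.
move=> t0; have := branch_sup x0 (lexx 0); rewrite xi0 mulr0 addr0 => E.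
have : (t%:E < (phi eta0)%:E)%E by rewrite lte_fin.
rewrite E => /ereal_sup_gt[_ [s Gs <-]]; rewrite mul0r subr0 lte_fin => ts; by exists s.
Qed.

(** At distance r > 0 the condition reads n (t - phi r) / r <= E x + n D x, and [tangent] is the
    supremum of these quotients together with 0; at the root it is t <= phi eta0. *)
Lemma height_tangent n E t : (0 < n)%N -> (forall x, 0 <= E x + n%:R * D x) -> t < phi eta0 ->
  n%:R * t <= height n E <-> forall x, 0 <= E x + n%:R * (D x - tangent (branch x) t).
Proof.
move=> n0 E0 t0; have n0' : (0 : R) < n%:R by rewrite ltr0n.
have [A _ AP] := branch_lower_bound.
have tb x : t < branch x 0 by rewrite branch0.
have hs x : has_sup [set y | y = 0 \/ exists2 s, 0 < s & y = (t - branch x s) / s].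
  by apply: (tangent_has_sup (AP x) (branch_continuous0 x)).
split=> [/(heightP _ E0) h x|h].
  rewrite mulrBr addrA subr_ge0 mulrC -ler_pdivlMr //.
  apply: ge_sup; first exact: (hs x).1.
  move=> _ [->|[r r0 ->]]; first by rewrite divr_ge0 // ltW.
  rewrite ler_pdivrMr // mulrAC ler_pdivlMr // mulrBl.
  by have := h x r (ltW r0); rewrite [t * _]mulrC [branch x r * _]mulrC; lra.
apply/(heightP _ E0) => x r; rewrite le_eqVlt => /predU1P[<-|r0].
  by rewrite mulr0 add0r ler_pM2l // ltW.
have : (t - branch x r) / r <= tangent (branch x) t.
  by apply: sup_ubound; [exact: (hs x).2|right; exists r].
rewrite ler_pdivrMr // => h1; have := h x; rewrite mulrBr addrA subr_ge0 => h2.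
have h3 : n%:R * (t - branch x r) <= (E x + n%:R * D x) * r.
  apply: le_trans (_ : n%:R * (tangent (branch x) t * r) <= _); first by rewrite ler_pM2l.
  by rewrite mulrA ler_pM2r.
by rewrite mulrBr in h3; lra.
Qed.

Local Notation K := (ratf X).
Local Notation sc := (Defs.scalar X).
Local Notation mu := (@lebesgue_measure R).
Context (X_curve : is_curve X) (X_regular : is_regular X).
Context (r0 : nat) (regular_fin : forall m, dimge sc (@regular_fun k X) m -> (m <= r0)%N).
Context (D_div : is_Rdivisor D).
Context (a : R) (branch_ge : forall x t, 0 <= t -> a <= branch x t).

Lemma branch_tangent_ge0 y t : t < phi eta0 -> 0 <= tangent (branch y) t.
Proof.
move=> t0; apply: (tangent_ge0 (branch_ge y) (branch_continuous0 y)).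
by rewrite branch0.
Qed.

Lemma branch_tangent_nondecr y s t : s <= t -> t < phi eta0 ->
  tangent (branch y) s <= tangent (branch y) t.
Proof.
move=> st t0; apply: (tangent_nondecr (branch_ge y) (branch_continuous0 y)) => //.
by rewrite branch0.
Qed.

Lemma measurable_branch_tangent y :
  measurable_fun [set` `]a, phi eta0[] (tangent (branch y)).
Proof.
have := measurable_tangent (branch_ge y) (branch_continuous0 y).
by rewrite branch0.
Qed.

(** Since phi eta0 is the supremum of the heights of sections, some section s has height above t.
    Then (s) + D is effective of degree deg D and dominates P_t, which bounds both the support and
    the degree. *)
Lemma tangent_divisor t : t < phi eta0 ->
  is_Rdivisor (fun y => tangent (branch y) t) /\
  0 <= deg (fun y => tangent (branch y) t) <= deg D.
Proof.
move=> t0; have [s Gs ts] := section_above t0.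
set P := fun y => tangent (branch y) t.
have [ds Ds] := tensor_principal X_curve X_regular regular_fin (repr (s : {eq_quot (tensor_equiv R X)}%qT)).
pose C y := ordR y s + D y.
have dC : is_Rdivisor C by exact: is_RdivisorD.
have degC : deg C = deg D.
  have := (degB dC ds).2; rewrite Ds subr0 => <-.
  by congr deg; apply/funext => y; rewrite /C addrAC subrr add0r.
have PC y : P y <= C y by exact: (tangent_le_section y Gs ts t0).
have P0 y : 0 <= P y by exact: branch_tangent_ge0.
have dP : is_Rdivisor P.
  apply: sub_finite_set dC => y /= Py; rewrite gt_eqF //; apply: lt_le_trans (PC y).
  by rewrite lt_neqAle eq_sym Py P0.
split=> //; rewrite deg_ge0 //= -degC -subr_ge0 -(degB dC dP).2; apply: deg_ge0; last first.
  by move=> y; rewrite subr_ge0.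
by have [] := degB dC dP.
Qed.

Lemma level_divisor t : t < phi eta0 ->
  let E := fun y => D y - tangent (branch y) t in
  [/\ is_Rdivisor E, 0 <= deg E & deg E = deg D - deg (fun y => tangent (branch y) t)].
Proof.
move=> t0 E; have [dP /andP[P0 PD]] := tangent_divisor t0.
by have [dE degE] := degB D_div dP; rewrite /E degE subr_ge0.
Qed.

Definition fun_height (n : nat) (f : K) : R := height n (fun x => (ord x f)%:~R).

Local Notation nD n := (fun y => n%:R * D y).

Lemma H0_effective n u : H0 (nD n) u -> u != 0 -> forall x, 0 <= (ord x u)%:~R + n%:R * D x.
Proof. by move=> [->|[_ //]]; rewrite eqxx. Qed.

Lemma fun_heightZ n c u : c != 0 -> u != 0 -> fun_height n (sc c * u) = fun_height n u.
Proof.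
move=> c0 u0; congr height; apply/funext => x.
by rewrite (ordM X_curve X_regular regular_fin) ?fmorph_eq0 // (ord_sc X_curve X_regular regular_fin) // add0r.
Qed.

Lemma fun_heightD n u v : u != 0 -> v != 0 -> u + v != 0 -> H0 (nD n) u -> H0 (nD n) v ->
  Num.min (fun_height n u) (fun_height n v) <= fun_height n (u + v).
Proof.
move=> u0 v0 uv0 hu hv; have hP := heightP.
have huv : H0 (nD n) (u + v).
  exact: (lin_closedD (H0_lin_closed X_curve X_regular regular_fin _) hu hv).
set l := Num.min _ _; apply/(hP n _ l (H0_effective huv uv0)) => x t t0.
have lu : l <= fun_height n u by rewrite ge_min lexx.
have lv : l <= fun_height n v by rewrite ge_min lexx orbT.
have {lu}lu := (hP n _ l (H0_effective hu u0)).1 lu x t t0.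
have {lv}lv := (hP n _ l (H0_effective hv v0)).1 lv x t t0.
have := ord_min X_curve X_regular regular_fin x u0 v0 uv0.
rewrite ge_min => /orP[h|h]; [apply: le_trans lu _|apply: le_trans lv _];
  by rewrite lerD2r ler_wpM2r // lerD2r ler_int.
Qed.

Lemma fun_height_bounds n u : H0 (nD n) u -> u != 0 ->
  n%:R * a <= fun_height n u <= n%:R * phi eta0.
Proof.
move=> hu u0; have E0 := H0_effective hu u0; apply/andP; split.
  apply/(heightP _ E0) => x t t0.
  by rewrite ler_wpDl ?mulr_ge0 // ler_wpM2l // branch_ge.
exact: (height_le_root E0).
Qed.

Lemma fun_height_level n t : (0 < n)%N -> t < phi eta0 ->
  [set u | H0 (nD n) u /\ (u = 0 \/ n%:R * t <= fun_height n u)] =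
  H0 (fun y => n%:R * (D y - tangent (branch y) t)).
Proof.
move=> n0 t0; apply/seteqP; split=> u /=.
  move=> [hu hh]; have [->|u0] := eqVneq u 0; [by left|right; split=> //].
  case: hh => [u0'|hh]; first by rewrite u0' eqxx in u0.
  exact: (height_tangent n0 (H0_effective hu u0) t0).1.
move=> [->|[u0 uP]]; first by split; left.
have hu : H0 (nD n) u.
  right; split=> // x; apply: le_trans (uP x) _; rewrite lerD2l ler_wpM2l //.
  by rewrite gerBl branch_tangent_ge0.
split=> //; right.
exact: (height_tangent n0 (H0_effective hu u0) t0).2.
Qed.

Lemma energy_branch y : ((residue_degree y)%:R%:E * energy (branch y) =
  (2 * (residue_degree y)%:R)%:E * \int[mu]_(t in [set` `]a, phi eta0[]) (tangent (branch y) t)%:E)%E.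
Proof.
have cv := @branch_convex y.
have mono := @branch_nonincreasing y.
rewrite (energyE (slope_distr cv mono)).
have := energy_tangent cv mono (branch_ge y) (branch_continuous0 y).
rewrite branch0 => ->; rewrite muleA -EFinM mulrAC divff // mul1r; congr (_ * _)%E.
by apply: eq_integral => t _; rewrite sqrrN.
Qed.

End GreenBranches.

Lemma ler_sum_support (R : numDomainType) (T : eqType) (F : T -> R) (r s : seq T) :
  uniq r -> uniq s -> (forall x, 0 <= F x) -> (forall x, x \in r -> F x != 0 -> x \in s) ->
  \sum_(x <- r) F x <= \sum_(x <- s) F x.
Proof.
move=> ur us F0 Frs; rewrite (bigID (mem s)) /= [X in _ + X]big_seq_cond [X in _ + X]big1; last first.
  by move=> x /andP[xr xs]; apply/eqP; apply: contraNT xs => /(Frs x xr).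
rewrite addr0 -big_filter [leRHS](bigID (mem r)) /= -[X in _ <= X + _]big_filter.
rewrite (perm_big [seq x <- s | x \in r]) ?lerDl ?sumr_ge0 //.
by apply: uniq_perm; rewrite ?filter_uniq // => x; rewrite !mem_filter andbC.
Qed.

(** * Sums and limits of integrals *)

Section EsumIntegral.
Context (R : realType) (T : choiceType).
Local Notation mu := (@lebesgue_measure R).
Context (w : T -> R) (f : T -> R -> R) (B : R -> R) (a b M : R).
Local Notation I := [set` `]a, b[].
Context (w0 : forall x, 0 <= w x) (f0 : forall x t, t < b -> 0 <= f x t).
Context (f_nondecr : forall x s t, s <= t -> t < b -> f x s <= f x t).
Context (mf : forall x, measurable_fun I (f x)) (mB : measurable_fun I B).
Context (BM : forall t, t < b -> B t <= M).
Context (B_sum : forall t, t < b -> exists s : seq T, [/\ uniq s,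
  forall x, f x t != 0 -> x \in s & forall s', uniq s' -> (forall x, f x t != 0 -> x \in s') ->
  B t = \sum_(x <- s') w x * f x t]).

Let wf_ge0 x t : t < b -> 0 <= w x * f x t.
Proof. by move=> tb; rewrite mulr_ge0 ?f0. Qed.

Let B_ge0 t : t < b -> 0 <= B t.
Proof.
by move=> tb; have [s [us sP BE]] := B_sum tb; rewrite (BE s) // sumr_ge0 // => x _; exact: wf_ge0.
Qed.

Let integral_sum (s : seq T) : (\int[mu]_(t in I) (\sum_(x <- s) w x * f x t)%:E =
  \sum_(x <- s) (w x)%:E * \int[mu]_(t in I) (f x t)%:E)%E.
Proof.
transitivity (\int[mu]_(t in I) (\sum_(x <- s) ((w x)%:E * (f x t)%:E)))%E.
  by apply: eq_integral => t _; rewrite -sumEFin; apply: eq_bigr => x _; rewrite EFinM.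
rewrite ge0_integral_sum //.
- apply: eq_bigr => x _; rewrite ge0_integralZl_EFin //.
    by move=> t /=; rewrite in_itv /= => /andP[_ tb]; rewrite lee_fin f0.
  by apply/measurable_EFinP; exact: mf.
- by move=> x; apply/measurable_EFinP; apply: measurable_funM => //; exact: mf.
by move=> x t /=; rewrite in_itv /= => /andP[_ tb]; rewrite lee_fin wf_ge0.
Qed.

(** The support of f at t is finite for each t < b but may grow without bound as t tends to b, over
    an index type that may be uncountable. By monotonicity the support at c = b - d serves every t
    <= c, and [c, b[ contributes at most M d <= e to the integral of B. *)
Lemma esum_integral : a < b ->
  (\esum_(x in [set: T]) ((w x)%:E * \int[mu]_(t in I) (f x t)%:E) = \int[mu]_(t in I) (B t)%:E)%E.
Proof.
move=> ab; have int0 x : (0 <= \int[mu]_(t in I) (f x t)%:E)%E.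
  by apply: integral_ge0 => t /=; rewrite in_itv /= => /andP[_ tb]; rewrite lee_fin f0.
have msum (s : seq T) : measurable_fun I (fun t => (\sum_(x <- s) w x * f x t)%:E).
  apply/measurable_EFinP; apply: measurable_sum => x; by apply: measurable_funM => //; exact: mf.
apply/eqP; rewrite eq_le; apply/andP; split.
  rewrite /esum; apply: ge_ereal_sup => _ [A [finA _] <-]; rewrite fsbig_finite //= -integral_sum.
  apply: ge0_le_integral => //.
  - move=> t /=; rewrite in_itv /= => /andP[_ tb].
    by rewrite lee_fin sumr_ge0 // => x _; exact: wf_ge0.
  - exact: msum.
  - by apply/measurable_EFinP; exact: mB.
  move=> t /=; rewrite in_itv /= => /andP[_ tb]; rewrite lee_fin.
  have [s [us sP BE]] := B_sum tb; rewrite (BE s) //.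
  apply: (ler_sum_support (finmap.fset_uniq _) us) => x; first exact: wf_ge0.
  by move=> _; rewrite mulf_eq0 negb_or => /andP[_ /sP].
have M0 : 0 <= M.
  have h : (a + b) / 2 < b by lra.
  exact: le_trans (B_ge0 h) (BM h).
apply/lee_addgt0Pr => e e0.
pose d := Num.min ((b - a) / 2) (e / (M + 1)).
have d0 : 0 < d by rewrite lt_min !divr_gt0 ?subr_gt0 // ltr_wpDl.
have Md : M * d <= e.
  have : d <= e / (M + 1) by rewrite ge_min lexx orbT.
  rewrite ler_pdivlMr ?ltr_wpDl // => h; apply: le_trans h.
  by rewrite mulrC ler_wpM2l ?lerDl // ltW.
have da : d <= (b - a) / 2 by rewrite ge_min lexx.
pose c := b - d; have ac : a < c by rewrite /c; lra.
have cb : c < b by rewrite /c ltrBlDr ltrDl.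
have [s [us sP _]] := B_sum cb.
have BE t : t <= c -> B t = \sum_(x <- s) w x * f x t.
  move=> tc; have tb := le_lt_trans tc cb; have [_ [_ _ Bs]] := B_sum tb.
  apply: Bs => // x fx.
  apply: sP; rewrite gt_eqF //; apply: lt_le_trans (f_nondecr x tc cb).
  by rewrite lt_neqAle eq_sym fx f0.
have mcb : measurable (`[c, b[ : set R) by exact: measurable_itv.
apply: (@le_trans _ _ (\int[mu]_(t in I) ((\sum_(x <- s) w x * f x t)%:E +
    M%:E * (\1_(`[c, b[ : set R) t)%:E))%E).
  apply: ge0_le_integral => //.
  - by move=> t /=; rewrite in_itv /= => /andP[_ tb]; rewrite lee_fin B_ge0.
  - by apply/measurable_EFinP; exact: mB.
  - apply: emeasurable_funD; first exact: msum.
    apply: emeasurable_funM; first exact: measurable_cst.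
    by apply/measurable_EFinP; apply: measurable_funTS; exact: measurable_indic.
  move=> t /=; rewrite in_itv /= => /andP[at_ tb]; rewrite -EFinM -EFinD lee_fin.
  have s0 : 0 <= \sum_(x <- s) w x * f x t by rewrite sumr_ge0 // => x _; exact: wf_ge0.
  have [tc|ct] := leP t c; first by rewrite BE // lerDl mulr_ge0 // indicE.
  rewrite indicE mem_set ?mulr1; last by rewrite /= in_itv /= tb ltW.
  by apply: le_trans (BM tb) _; rewrite lerDr.
rewrite ge0_integralD //; last 4 first.
- move=> t /=; rewrite in_itv /= => /andP[_ tb].
  by rewrite lee_fin sumr_ge0 // => x _; exact: wf_ge0.
- exact: msum.
- by move=> t _; rewrite -EFinM lee_fin mulr_ge0 // indicE.
- apply: emeasurable_funM; first exact: measurable_cst.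
  by apply/measurable_EFinP; apply: measurable_funTS; exact: measurable_indic.
apply: leeD; last first.
  rewrite ge0_integralZl_EFin //; last first.
    by apply/measurable_EFinP; apply: measurable_funTS; exact: measurable_indic.
  rewrite integral_indic // setIidl; last first.
    by move=> t /=; rewrite !in_itv /= => /andP[ct ->]; rewrite (lt_le_trans ac).
  by rewrite /= lebesgue_measure_itv /= lte_fin cb -EFinD -EFinM lee_fin /c subKr.
rewrite integral_sum; apply: esum_ge; exists [set` s]; first by split.
by rewrite -fsbig_seq.
Qed.

End EsumIntegral.

(** * Convergence of normalised sums of heights *)

Section HeightsLimit.
Context (R : realType).
Local Notation mu := (@lebesgue_measure R).
Context (a b : R) (ab : a < b).
Local Notation I := [set` `]a, b[].

Lemma measurable_le (y : R) : measurable [set t : R | t <= y].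
Proof.
rewrite (_ : [set t | _] = [set` `]-oo, y]]); first exact: measurable_itv.
by apply/seteqP; split=> t /=; rewrite in_itv.
Qed.

Lemma clipped_length y : a <= y -> y <= b ->
  (\int[mu]_(t in I) (\1_[set t | t <= y] t)%:E = (y - a)%:E)%E.
Proof.
move=> ay yb; have my := measurable_le y.
rewrite integral_indic //.
have [yb'|] := ltP y b; last first.
  move=> by_; rewrite setIidr; last first.
    by move=> t /=; rewrite in_itv /= => /andP[_ /ltW tb]; exact: le_trans by_.
  rewrite /= lebesgue_measure_itv /= lte_fin ab -EFinD.
  by congr (_%:E); have := le_anti (introT andP (conj yb by_)) => ->.
rewrite (_ : _ `&` _ = [set` `]a, y]]); last first.
  apply/seteqP; split=> t /=; rewrite !in_itv /=; first by move=> [-> /andP[->]].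
  by move=> /andP[-> ty]; split=> //; rewrite (le_lt_trans ty).
rewrite /= lebesgue_measure_itv /= lte_fin; by case: ltgtP ay => // -> _; rewrite subrr.
Qed.

Context (r : nat -> nat) (H : forall n, 'I_(r n) -> R) (q : R -> R) (q0 K : R).
Context (H_bounds : forall n (i : 'I_(r n)), (0 < n)%N -> n%:R * a <= H i <= n%:R * b).
Context (r_le : forall n, (0 < n)%N -> (r n)%:R <= n%:R * K).
Context (r_cvg : (r n)%:R / n%:R @[n --> \oo] --> q0).
Context (count_cvg : forall t, a < t < b ->
  #|[pred i : 'I_(r n) | n%:R * t <= H i]|%:R / n%:R @[n --> \oo] --> q t).

(** The normalised count of heights above n t, written with indicators so that its integral over ]a,
    b[ is computed term by term. *)
Let F n t : R := \sum_(i < r n) n%:R^-1 * \1_[set t | t <= H i / n%:R] t.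

Let F_count n t : (0 < n)%N -> F n t = #|[pred i : 'I_(r n) | n%:R * t <= H i]|%:R / n%:R.
Proof.
move=> n0; rewrite /F -big_distrr /= mulrC; congr (_ / _).
rewrite -sum1_card natr_sum [RHS]big_mkcond /=; apply: eq_bigr => i _.
rewrite indicE inE /= -[X in _ = if X then _ else _]/(n%:R * t <= H i).
case: ifPn => h.
  by rewrite mem_set //= ler_pdivlMr ?ltr0n // mulrC.
by rewrite memNset //= ler_pdivlMr ?ltr0n // mulrC; exact/negP.
Qed.

Let mF n : measurable_fun I (F n).
Proof.
apply: measurable_sum => i; apply: measurable_funM => //; apply: measurable_funTS.
by apply: measurable_indic; exact: measurable_le.
Qed.

Let F_ge0 n t : 0 <= F n t.
Proof. by apply: sumr_ge0 => i _; rewrite mulr_ge0 ?invr_ge0 // indicE. Qed.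

Let F_le n t : F n t <= `|K|.
Proof.
have [->|n0] := posnP n.
  by rewrite /F big1 // => i _; rewrite invr0 mul0r.
rewrite F_count // ler_pdivrMr ?ltr0n //; apply: (@le_trans _ _ (n%:R * K)).
  by apply: le_trans _ (r_le n0); rewrite ler_nat -[leqRHS]card_ord max_card.
  by rewrite [leRHS]mulrC ler_wpM2l // ler_norm.
Qed.

Let mq : measurable_fun I q.
Proof.
apply: (@measurable_fun_cvg _ _ _ _ F) => // t /=; rewrite in_itv /= => tab.
apply: cvg_trans (count_cvg tab); apply: near_eq_cvg.
by near=> n; rewrite F_count //; near: n; exists 1%N.
Unshelve. all: by end_near. Qed.

Let int_F n : (0 < n)%N ->
  (\int[mu]_(t in I) (F n t)%:E = (\sum_(i < r n) (H i / n%:R ^+ 2) - a * ((r n)%:R / n%:R))%:E)%E.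
Proof.
move=> n0; have n0' : (0 : R) < n%:R by rewrite ltr0n.
transitivity (\int[mu]_(t in I) (\sum_(i < r n) ((n%:R^-1)%:E * (\1_[set t | (t <= H i / n%:R)%R] t)%:E)))%E.
  by apply: eq_integral => t _; rewrite -sumEFin; apply: eq_bigr => i _; rewrite EFinM.
have mi i : measurable_fun I (fun t => (\1_[set t | t <= H (n := n) i / n%:R] t)%:E).
  apply/measurable_EFinP; apply: measurable_funTS; apply: measurable_indic; exact: measurable_le.
rewrite ge0_integral_sum //; last first.
  by move=> i; apply: emeasurable_funM; [exact: measurable_cst|exact: mi].
transitivity (\sum_(i < r n) (H i / n%:R ^+ 2 - a / n%:R)%:E)%E.
  apply: eq_bigr => i _; rewrite ge0_integralZl_EFin ?invr_ge0 //; last exact: mi.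
  have /andP[h1 h2] := H_bounds i n0.
  rewrite clipped_length -?EFinM.
  - by congr (_%:E); field; rewrite gt_eqF.
  - by rewrite ler_pdivlMr // mulrC.
  - by rewrite ler_pdivrMr // mulrC.
rewrite sumEFin sumrB; congr ((_ - _)%:E).
by rewrite sumr_const card_ord -mulr_natr; ring.
Qed.

(** The integral of F_n is the sum of H_i / n^2 minus a r_n / n. Dominated convergence with bound
    |K| sends it to J, and a r_n / n tends to a q0; the factor 2 comes from n^2 / 2. *)
Lemma heights_limit : exists J : R, [/\ measurable_fun I q,
  (\int[mu]_(t in I) (q t)%:E = J%:E)%E, (forall t, a < t < b -> 0 <= q t <= `|K|) &
  (\sum_(i < r n) H i) / (n%:R ^+ 2 / 2) @[n --> \oo] --> 2 * (a * q0 + J)].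
Proof.
have Fq t : a < t < b -> F n t @[n --> \oo] --> q t.
  move=> tab; apply: cvg_trans (count_cvg tab); apply: near_eq_cvg.
  by near=> n; rewrite F_count //; near: n; exists 1%N.
have mI : measurable (I : set R) by exact: measurable_itv.
have icst : mu.-integrable I (EFin \o cst `|K|).
  apply: measurable_bounded_integrable => //.
    by rewrite /= lebesgue_measure_itv /=; case: ifP => // _; rewrite -EFinD ltry.
  exists `|K|; split; first exact: num_real.
  by move=> N KN t _ /=; rewrite normr_id ltW.
have [iq _ cv] : [/\ mu.-integrable I (EFin \o q),
   \int[mu]_(x in I) `|(F n x)%:E - (q x)%:E|%E @[n --> \oo] --> 0%E
   & \int[mu]_(x in I) (F n x)%:E @[n --> \oo] --> \int[mu]_(x in I) (q x)%:E]%E.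
  apply: (@dominated_convergence _ _ _ mu I mI (fun n => EFin \o F n) (EFin \o q) (cst `|K|%:E)).
  - by move=> n; apply/measurable_EFinP; exact: mF.
  - by apply/measurable_EFinP; exact: mq.
  - apply: aeW => t /=; rewrite in_itv /= => tab; apply: cvg_EFin; first by near=> n.
    exact: Fq.
  - exact: icst.
  - apply: aeW => t n _ /=; rewrite lee_fin ger0_norm ?F_ge0 //; exact: F_le.
pose J := fine (\int[mu]_(t in I) (q t)%:E)%E.
have JE : (\int[mu]_(t in I) (q t)%:E = J%:E)%E by rewrite /J fineK //; exact: integrable_fin_num.
exists J; split=> //.
  move=> t tab; apply/andP; split.
    by apply: (cvgr_to_ge (Fq t tab)); near=> n; exact: F_ge0.
  by apply: (cvgr_to_le (Fq t tab)); near=> n; exact: F_le.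
rewrite JE in cv.
have cvJ : (\sum_(i < r n) (H i / n%:R ^+ 2) - a * ((r n)%:R / n%:R)) @[n --> \oo] --> J.
  move/fine_cvgP : cv => [_]; apply: cvg_trans; apply: near_eq_cvg.
  by near=> n; rewrite /= int_F //=; near: n; exists 1%N.
pose S n := 2 * ((\sum_(i < r n) (H i / n%:R ^+ 2) - a * ((r n)%:R / n%:R)) + a * ((r n)%:R / n%:R)).
have cS : S n @[n --> \oo] --> 2 * (J + a * q0).
  by apply: cvgM; [exact: cvg_cst|apply: cvgD => //; apply: cvgM => //; exact: cvg_cst].
rewrite [a * _ + J]addrC; apply: cvg_trans cS; apply: near_eq_cvg; near=> n.
by rewrite /S /= subrK -big_distrl /= invf_div; ring.
Unshelve. all: by end_near. Qed.

End HeightsLimit.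

(** * Determinant norms and the self-intersection number *)

Theorem theorem1p1 (R : realType) (k : fieldType) (X : projective_variety k)
    (X_curve : is_curve X) (X_regular : is_regular X)
    (D : closed_point X -> R) (D_div : is_Rdivisor D)
    (g : berkovich R X -> \bar R) (g_green : is_green D g)
    (degD_gt0 : 0 < deg D) (g_psh : plurisubharmonic D g)
    (r : nat -> nat) (s : forall n : nat, 'I_(r n) -> ratf X)
    (s_basis : forall n : nat, is_basis (H0 (fun x => n%:R * D x)) (s n)) :
  ((- ln (det_norm (H0 (fun x => n%:R * D x))
                   (norm (fun p => n%:R%:E * g p)%E) (s n))
      / (n%:R ^+ 2 / 2))%:E @[n --> \oo]) --> self_intersection D g.
Proof.
have [_ [phi [phi_cont phiE]]] := g_green.
(* For n = 0 the space H^0(nD) consists of the regular functions, and [s 0] is a finite basis of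
   it. *)
have regular_fin m : dimge (Defs.scalar X) (@regular_fun k X) m -> (m <= r 0)%N.
  move=> dm; apply/(basis_dimge m (s_basis 0)); apply: dimge_sub dm => f [->|[f0 fP]]; first by left.
  by right; split=> // x; rewrite mul0r addr0 ler0z.
(* Without closed points the degree would be an empty sum. *)
have [x0 _] : exists x : closed_point X, True.
  apply: contrapT => nX; move: degD_gt0.
  rewrite (@deg_seq _ _ _ _ [::]) ?big_nil ?ltxx // => y _.
  by exfalso; apply: nX; exists y.
have [a ab branch_ge] := branch_lower_bound phi_cont phiE g_psh.
pose h n := fun_height g n.
pose E n := H0 (fun x => n%:R * D x).
have linE n : lin_closed (Defs.scalar X) (E n) by exact: (H0_lin_closed X_curve X_regular regular_fin).
have hZ n c u : c != 0 -> u != 0 -> E n u -> h n (Defs.scalar X c * u) = h n u.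
  by move=> c0 u0 _; exact: (fun_heightZ g X_curve X_regular regular_fin n c0 u0).
have hD n u v : u != 0 -> v != 0 -> u + v != 0 -> E n u -> E n v ->
    Num.min (h n u) (h n v) <= h n (u + v).
  exact: (fun_heightD phi_cont phiE g_psh x0 X_curve X_regular regular_fin).
pose good n (e : 'I_(r n) -> ratf X) := [/\ is_basis (E n) e, wedge_eq (E n) e (s n) &
  forall c i, c i != 0 -> h n (\sum_l Defs.scalar X (c l) * e l) <= h n (e i)].
have good_ex n : {e | good n e}.
  by apply: cid; exact: (orthogonal_basis (linE n) (@hZ n) (@hD n) (s_basis n)).
pose e n := sval (good_ex n); have eP n : good n (e n) := svalP (good_ex n).
pose H n i := h n (e n i).
have detE n : - ln (det_norm (E n) (norm (fun p => n%:R%:E * g p)%E) (s n)) = \sum_(i < r n) H n i.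
  have [be we oe] := eP n; apply: (det_norm_orthogonal (linE n) be oe we) => u u0 _.
  by rewrite /norm (negPf u0).
have e_neq0 n i : e n i != 0 by have [be _ _] := eP n; exact: basis_neq0 be.
have Ee n i : E n (e n i) by have [[Ee _ _] _ _] := eP n.
pose P t := fun y => tangent (phi_branch D g y) t.
pose q t := deg (fun y => D y - P t y).
have lvl t := level_divisor phi_cont phiE g_psh x0 X_curve X_regular regular_fin D_div branch_ge (t := t).
have [[K K0 r_le] r_cvg] : (exists2 L : R, 0 <= L & forall n, (0 < n)%N -> (r n)%:R <= n%:R * L) /\
    (r n)%:R / n%:R @[n --> \oo] --> deg D.
  apply: (dimension_cvg X_curve X_regular regular_fin D_div (ltW degD_gt0)) => n j _.
  exact: basis_dimge (s_basis n).
have count_cvg t : a < t < phi eta0 ->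
    #|[pred i : 'I_(r n) | n%:R * t <= H n i]|%:R / n%:R @[n --> \oo] --> q t.
  move=> /andP[_ t0]; have [dE degE _] := lvl t t0.
  apply: (dimension_cvg X_curve X_regular regular_fin dE degE _).2 => n j n0.
  rewrite -(fun_height_level phi_cont phiE g_psh x0 branch_ge n0 t0).
  by have [be we oe] := eP n; exact: (dimge_height (linE n) be oe (n%:R * t) j).
have H_bounds n (i : 'I_(r n)) : (0 < n)%N -> n%:R * a <= H n i <= n%:R * phi eta0.
  by move=> _; exact: (fun_height_bounds phi_cont phiE g_psh x0 branch_ge (Ee n i) (e_neq0 n i)).
have [J [mq JE q0 lim]] := heights_limit ab H_bounds r_le r_cvg count_cvg.
have -> : self_intersection D g = (2 * (a * deg D + J))%:E.
  rewrite /self_intersection (green_eta0 phiE x0) /=.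
  (* Equal to 2 deg P_t below phi eta0, but expressed through q, whose measurability is known since
     q is a limit of counting functions. *)
  pose B t := 2 * (deg D - q t).
  have BE t : t < phi eta0 -> B t = 2 * deg (P t).
    by move=> t0; have [_ _ qE] := lvl t t0; rewrite /B /q qE subKr.
  have PD t := tangent_divisor phi_cont phiE g_psh x0 X_curve X_regular regular_fin D_div branch_ge (t := t).
  have mB : measurable_fun [set` `]a, phi eta0[] B.
    apply: measurable_funM => //; apply: measurable_funB => //.
  have -> : (\esum_(x in [set: closed_point X]) ((residue_degree x)%:R%:E * energy (phi_branch D g x)) =
      \int[@lebesgue_measure R]_(t in [set` `]a, phi eta0[]) (B t)%:E)%E.
    rewrite (eq_esum (fun x _ => energy_branch phi_cont phiE g_psh branch_ge x)).
    apply: (@esum_integral R (closed_point X) (fun x => 2 * (residue_degree x)%:R)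
      (fun x => tangent (phi_branch D g x)) B a (phi eta0) (2 * deg D)) => //.
    - by move=> x t t0; exact: (branch_tangent_ge0 phi_cont phiE branch_ge).
    - by move=> x t u tu u0; exact: (branch_tangent_nondecr phi_cont phiE branch_ge).
    - by move=> x; exact: (measurable_branch_tangent phi_cont phiE branch_ge).
    - by move=> t t0; rewrite BE // ler_pM2l //; have [_ /andP[]] := PD t t0.
    move=> t t0; have [dP _] := PD t t0; have [l [ul lP]] := Rdivisor_seq dP.
    exists l; split=> // l' ul' l'P; rewrite BE // (deg_seq ul' l'P) mulr_sumr.
    by apply: eq_bigr => x _; rewrite mulrA.
  have intI (c : R) : (\int[@lebesgue_measure R]_(t in [set` `]a, phi eta0[]) c%:E =
      (c * (phi eta0 - a))%:E)%E.
    by rewrite integral_cst //= lebesgue_measure_itv /= lte_fin ab -EFinM.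
  (* Added as nonnegative integrals first; the finite 2 J is then cancelled, so finiteness of the
     integral of B is a consequence. *)
  have sumE : (\int[@lebesgue_measure R]_(t in [set` `]a, phi eta0[]) (B t)%:E + (2 * J)%:E =
      (2 * deg D * (phi eta0 - a))%:E)%E.
    rewrite -intI [in LHS]EFinM -JE -ge0_integralZl_EFin //; last 2 first.
    - by move=> t /=; rewrite in_itv /= lee_fin => /q0/andP[].
    - by apply/measurable_EFinP.
    rewrite -ge0_integralD //; last 4 first.
    - move=> t /=; rewrite in_itv /= => /andP[_ t0]; rewrite lee_fin BE // mulr_ge0 //.
      by have [_ /andP[]] := PD t t0.
    - by apply/measurable_EFinP.
    - by move=> t /=; rewrite in_itv /= -EFinM lee_fin => /q0/andP[h1 _]; rewrite mulr_ge0.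
    - by apply/measurable_EFinP; apply: measurable_funM.
    by apply: eq_integral => t _; rewrite -EFinM -EFinD /B; congr (_%:E); ring.
  have -> : (\int[@lebesgue_measure R]_(t in [set` `]a, phi eta0[]) (B t)%:E =
      (2 * deg D * (phi eta0 - a) - 2 * J)%:E)%E.
    by rewrite EFinB -sumE addeK.
  by rewrite -EFinB; congr (_%:E); ring.
apply: cvg_EFin; first exact: nearW.
apply: cvg_trans lim; apply: near_eq_cvg; apply: nearW => n /=.
by rewrite -detE.
Qed.
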